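(* Let $A$ be an infinite-dimensional simple unital $C^*$-algebra, let $G$ be a finite group, let $\alpha:G\to\mathrm{Aut}(A)$ be an action, and let $\omega$ be a free ultrafilter on $\mathbb{N}$. Suppose that for every finite subset $F\subset A$, every $\varepsilon>0$ and every $x\in A_+\setminus\{0\}$, there exist a separable $C^*$-subalgebra $B\subset A$ and a positive element $c\in A\cap B'$ with $\|c\|=1$ such that: (1) $\|ca-ac\|<\varepsilon$ for all $a\in F$; (2) for each $a\in F$ there is $b\in B$ with $\|ca-b\|<\varepsilon$; (3) $1-c\precsim x$; (4) the relative commutant $A_\omega\cap B'$ has real rank zero. Then $\alpha$ has the tracial Rokhlin property if and only if $\alpha$ has the weak tracial Rokhlin property.
   Context: For positive elements $a,b$ of a $C^*$-algebra $A$, $a\precsim b$ (Cuntz subequivalence) means there is a sequence $(v_n)$ in $A$ with $\|a-v_nbv_n^*\|\to 0$. $A\cap B'$ denotes the set of elements of $A$ commuting with every element of $B$. The ultrapower is $A_\omega=\ell^\infty(A)/\{(a_n): \lim_{n\to\omega}\|a_n\|=0\}$, with $A$ identified with the classes of constant sequences, and $A_\omega\cap B'$ is the relative commutant of $B$ in $A_\omega$. An action $\alpha$ of a finite group $G$ on a simple unital $C^*$-algebra $A$ has the weak tracial Rokhlin property if for every finite subset $F\subset A$, every $\varepsilon>0$ and every $x\in A_+$ with $\|x\|=1$, there exist mutually orthogonal positive contractions $f_g\in A$ ($g\in G$), with $f=\sum_{g\in G}f_g$, such that: (a) $\|f_ga-af_g\|<\varepsilon$ for all $g\in G$, $a\in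 F$; (b) $\|\alpha_g(f_h)-f_{gh}\|<\varepsilon$ for all $g,h\in G$; (c) $1-f\precsim x$; (d) $\|fxf\|>1-\varepsilon$. It has the tracial Rokhlin property if the $f_g$ can moreover be chosen to be mutually orthogonal projections. *)

(* Defs.v *)
From HB Require Import structures.
From mathcomp Require Import all_boot all_order all_algebra all_fingroup.
From mathcomp Require Import all_classical all_reals all_analysis.
From mathcomp Require Import complex.
Set Implicit Arguments. Unset Strict Implicit. Unset Printing Implicit Defensive.
Import Order.TTheory GRing.Theory Num.Theory.
Import numFieldNormedType.Exports.
Local Open Scope classical_set_scope.
Local Open Scope ring_scope.

Record ucstar {R : realType} (A : completeNormedModType R[i]) := UCstar {
  cmul : A -> A -> A;
  cone : A;
  cadj : A -> A;
  cmulA : forall x y z, cmul x (cmul y z) = cmul (cmul x y) z;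
  cmulDl : forall (k : R[i]) x y z, cmul (k *: x + y) z = k *: cmul x z + cmul y z;
  cmulDr : forall (k : R[i]) x y z, cmul z (k *: x + y) = k *: cmul z x + cmul z y;
  cmul1l : forall x, cmul cone x = x;
  cmul1r : forall x, cmul x cone = x;
  cadjK : forall x, cadj (cadj x) = x;
  cadjD : forall (k : R[i]) x y, cadj (k *: x + y) = (Num.conj k) *: cadj x + cadj y;
  cadjM : forall x y, cadj (cmul x y) = cmul (cadj y) (cadj x);
  cnormM : forall x y, `|cmul x y| <= `|x| * `|y|;
  cnormC : forall x, `|cmul (cadj x) x| = `|x| ^+ 2;
  cone_neq0 : cone != 0
}.

Definition infinite_dimensional {R : realType} (A : completeNormedModType R[i]) :=
  ~ exists (n : nat) (v : 'I_n -> A),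
    forall a : A, exists c : 'I_n -> R[i], a = \sum_(i < n) c i *: v i.

Section CstarNotions.
Context {R : realType} {A : completeNormedModType R[i]} (S : ucstar A).
Local Notation C := R[i].
Local Notation mul := (cmul S).
Local Notation one := (cone S).
Local Notation adj := (cadj S).

Definition self_adjoint (a : A) := adj a = a.
Definition invertible (a : A) := exists b, mul a b = one /\ mul b a = one.
Definition positive (a : A) :=
  self_adjoint a /\ forall l : C, ~ (0 <= l) -> invertible (a - l *: one).
Definition projection (p : A) := adj p = p /\ mul p p = p.
Definition contraction (a : A) := `|a| <= 1.

Definition cuntz_le (a b : A) := exists v : nat -> A,
  forall e : C, 0 < e -> exists N : nat, forall n, (N <= n)%N ->
    `|a - mul (v n) (mul b (adj (v n)))| < e.

Definition closed_ideal (I : set A) :=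
  [/\ I 0, (forall (k : C) x y, I x -> I y -> I (k *: x + y)),
      (forall a x, I x -> I (mul a x) /\ I (mul x a)) & closed I].
Definition simple_cstar := forall I, closed_ideal I -> I = [set 0] \/ I = setT.


Definition star_automorphism (f : A -> A) :=
  [/\ bijective f, (forall (k : C) x y, f (k *: x + y) = k *: f x + f y),
      (forall x y, f (mul x y) = mul (f x) (f y)),
      (forall x, f (adj x) = adj (f x)) & f one = one].
Definition cstar_action (G : finGroupType) (alpha : G -> A -> A) :=
  [/\ forall g, star_automorphism (alpha g),
      alpha 1%g =1 id & forall g h, alpha (g * h)%g =1 alpha g \o alpha h].

Definition cstar_subalgebra (B : set A) :=
  [/\ B 0, (forall (k : C) x y, B x -> B y -> B (k *: x + y)),
      (forall x y, B x -> B y -> B (mul x y)), (forall x, B x -> B (adj x))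
    & closed B].
Definition separable (B : set A) :=
  exists d : nat -> A, (forall n, B (d n)) /\ B `<=` closure (range d).
Definition commutes_with (B : set A) (c : A) := forall b, B b -> mul c b = mul b c.

(* Ultrapower A_omega: elements are represented by bounded sequences,
   modulo sequences whose norm tends to 0 along omega. *)
Definition free_ultrafilter (w : set_system nat) :=
  UltraFilter w /\ forall X : set nat, finite_set X -> ~ w X.
Definition w_null (w : set_system nat) (x : nat -> A) :=
  forall e : C, 0 < e -> w [set n | `|x n| < e].
Definition bounded_seq (x : nat -> A) := exists M : C, forall n, `|x n| <= M.
Definition in_relcomm (w : set_system nat) (B : set A) (x : nat -> A) :=
  bounded_seq x /\ forall b, B b -> w_null w (fun n => mul (x n) b - mul b (x n)).
(* A_omega \cap B' (a unital C*-algebra) has real rank zero: invertible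
   self-adjoint elements are dense among self-adjoint elements. *)
Definition relcomm_real_rank_zero (w : set_system nat) (B : set A) :=
  forall x, in_relcomm w B x -> w_null w (fun n => adj (x n) - x n) ->
  forall e : C, 0 < e -> exists y, [/\ in_relcomm w B y,
    w_null w (fun n => adj (y n) - y n),
    (exists z, [/\ in_relcomm w B z,
        w_null w (fun n => mul (y n) (z n) - one)
      & w_null w (fun n => mul (z n) (y n) - one)])
    & w [set n | `|x n - y n| < e]].

Definition rokhlin_towers (G : finGroupType) (alpha : G -> A -> A)
    (proj : bool) :=
  forall (F : seq A) (e : C), 0 < e -> forall x : A, positive x -> `|x| = 1 ->
  exists f : G -> A,
    [/\ forall g, positive (f g) /\ contraction (f g),
        forall g, proj -> projection (f g)
      & forall g h, g != h -> mul (f g) (f h) = 0]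
    /\ [/\ forall g a, a \in F -> `|mul (f g) a - mul a (f g)| < e,
        forall g h, `|alpha g (f h) - f (g * h)%g| < e,
        cuntz_le (one - \sum_(g : G) f g) x
      & 1 - e < `|mul (\sum_(g : G) f g) (mul x (\sum_(g : G) f g))| ].
Definition weak_tracial_rokhlin (G : finGroupType) (alpha : G -> A -> A) :=
  rokhlin_towers alpha false.
Definition tracial_rokhlin (G : finGroupType) (alpha : G -> A -> A) :=
  rokhlin_towers alpha true.

End CstarNotions.

(* Main.v *)
(* The implication from weak tracial to tracial is proved inside A, without
   constructing the ultrapower.

   Given c and B, let d = 1 - c, let h be the function (1 - d/delta)_+ of d, and
   take weak Rokhlin towers (f_g) that are asymptotically central for B.  Then
   k = h f_1 h lies in the relative commutant of B, so real rank zero yields a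
   self-adjoint invertible y near k^2 - t commuting asymptotically with B.  With
   p the positive spectral projection of y, the corner p k^2 p is bounded below,
   and q = k p (p k^2 p)^-1 p k is a projection in kAk with (1 - q)k small
   (the Brown-Pedersen argument).

   Since q lies in hA, c q is close to q; as c maps alpha_g^-1(F) approximately into B, the
   translates alpha_g(q) almost commute with F, and since q lies in kAk they are
   almost orthogonal; perturbing them gives orthogonal projections E_g.  The
   remainder r = 1 - sum E_g satisfies r alpha_g(k) ~ 0 and
   f_1 <= 2 k + (2/delta) d, so r is dominated by (1 - f) + (2/delta) sum alpha_g(d);
   each of these |G| + 1 terms is absorbed by one of as many orthogonal pieces
   of x, which exist because A is simple and infinite-dimensional.  Condition
   (d) follows from (a) for a larger F by simplicity. *)

(* An element of the relative commutant is handled as a bounded sequence whose commutators vanish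
   along [w], so spectral projections are formed at one index at a time. Their commutator bounds
   must not depend on the index: they may use only bounds for [y] and its inverse. Invertibility of
   [y] supplies the gap at 0 that [k^2 - t] may lack; the sign of [y] is then reached by a truncated
   square-root iteration with an explicit rate, which turns small commutators of [y] into small
   commutators of [p].

   The order of choices is the other constraint. The pieces of [x] come before [c], and [delta]
   depends only on [F] and the tolerance. The lower bound for the norm of [k] depends on how 1 is
   written as a sum of terms [a h^2 b], so [t] is chosen after [h], but before the tower; the
   tolerance of the tower depends on [t] and is chosen last. The factor [2/delta] is harmless, since
   conjugation by a scalar absorbs it. *)
Require Import Defs.
From HB Require Import structures.
From mathcomp Require Import all_boot all_order all_algebra all_fingroup.
From mathcomp Require Import all_classical all_reals all_analysis.
From mathcomp Require Import complex.
From mathcomp Require Import ring lra.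
From Stdlib Require Ncring Ncring_tac Algebra_syntax.
Set Implicit Arguments. Unset Strict Implicit. Unset Printing Implicit Defensive.
Import Order.TTheory GRing.Theory Num.Theory.
Import numFieldNormedType.Exports.
Local Open Scope classical_set_scope.
Local Open Scope ring_scope.

(** * The algebra as a real algebra with a real-valued norm *)

(* Only real scalars act on this copy of A; complex ones are recovered through
   the central element J = i 1. *)
Definition calg {R : realType} {A : completeNormedModType R[i]} (S : ucstar A) : Type := A.

Section RealAlgebra.
Context {R : realType} {A : completeNormedModType R[i]} (S : ucstar A).
Local Notation T := (calg S).
HB.instance Definition _ := GRing.Zmodule.copy (calg S) A.

Lemma cmul_addl (x y z : A) : cmul S (x + y) z = cmul S x z + cmul S y z.
Proof. by have := cmulDl S 1 x y z; rewrite !scale1r. Qed.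
Lemma cmul_addr (x y z : A) : cmul S z (x + y) = cmul S z x + cmul S z y.
Proof. by have := cmulDr S 1 x y z; rewrite !scale1r. Qed.
Lemma cmul0l (x : A) : cmul S 0 x = 0.
Proof. by apply: (addrI (cmul S 0 x)); rewrite -cmul_addl !addr0. Qed.
Lemma cmul0r (x : A) : cmul S x 0 = 0.
Proof. by apply: (addrI (cmul S x 0)); rewrite -cmul_addr !addr0. Qed.
Lemma cmulZl k (x y : A) : cmul S (k *: x) y = k *: cmul S x y.
Proof. by have := cmulDl S k x 0 y; rewrite cmul0l !addr0. Qed.
Lemma cmulZr k (x y : A) : cmul S y (k *: x) = k *: cmul S y x.
Proof. by have := cmulDr S k x 0 y; rewrite cmul0r !addr0. Qed.

HB.instance Definition _ := GRing.Zmodule_isNzRing.Build (calg S)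
  (cmulA S) (cmul1l S) (cmul1r S) cmul_addl (fun z x y => cmul_addr x y z) (cone_neq0 S).

Definition calg_scale (r : R) (x : T) : T := (r%:C)%C *: (x : A).
Fact calg_scaleA (a b : R) (v : T) : calg_scale a (calg_scale b v) = calg_scale (a * b) v.
Proof. by rewrite /calg_scale scalerA rmorphM. Qed.
Fact calg_scale1 : left_id (1 : R) calg_scale.
Proof. by move=> v; rewrite /calg_scale rmorph1 scale1r. Qed.
Fact calg_scaleDr : right_distributive calg_scale +%R.
Proof. by move=> a u v; rewrite /calg_scale scalerDr. Qed.
Fact calg_scaleDl (v : T) : {morph calg_scale^~ v : a b / a + b}.
Proof. by move=> a b; rewrite /calg_scale rmorphD scalerDl. Qed.
HB.instance Definition _ := GRing.Zmodule_isLmodule.Build R (calg S)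
  calg_scaleA calg_scale1 calg_scaleDr calg_scaleDl.
Fact calg_scaleAl (a : R) (u v : T) : a *: (u * v) = (a *: u) * v.
Proof. by rewrite /GRing.scale /= /calg_scale /GRing.mul /= cmulZl. Qed.
HB.instance Definition _ := GRing.Lmodule_isLalgebra.Build R (calg S) calg_scaleAl.
Fact calg_scaleAr (a : R) (u v : T) : a *: (u * v) = u * (a *: v).
Proof. by rewrite /GRing.scale /= /calg_scale /GRing.mul /= cmulZr. Qed.
HB.instance Definition _ := GRing.Lalgebra_isAlgebra.Build R (calg S) calg_scaleAr.
End RealAlgebra.

(** * Real-valued norm, involution and completeness *)

Section Norm.
Context {R : realType} {A : completeNormedModType R[i]} (S : ucstar A).
Local Notation T := (calg S).

Implicit Types (x y z : T) (r s t : R).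

Definition nm (x : T) : R := complex.Re (`|x : A| : R[i]).
Definition st (x : T) : T := cadj S x.
Definition J : T := ('i%C : R[i]) *: (cone S).
Local Notation N := nm.

Lemma nmE x : `|x : A| = ((N x)%:C)%C.
Proof.
have : 0 <= (`|x : A| : R[i]) by exact: normr_ge0.
by rewrite /nm; case: (`|x : A|) => a b; rewrite lecE /= => /andP[/eqP -> _].
Qed.
Lemma nm_ge0 x : 0 <= N x.
Proof. by have : 0 <= `|x : A| by []; rewrite nmE lecR. Qed.
Lemma nm0 : N 0 = 0.
Proof. by rewrite /nm normr0. Qed.
Lemma nm_eq0 x : (N x == 0) = (x == 0).
Proof.
apply/eqP/eqP => [h|->]; last exact: nm0.
by apply/eqP; rewrite -(@normr_eq0 _ A) nmE h.
Qed.
Lemma nm_le0 x : (N x <= 0) = (x == 0).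
Proof. by rewrite -nm_eq0 eq_le nm_ge0 andbT. Qed.
Lemma nm_gt0 x : (0 < N x) = (x != 0).
Proof. by rewrite -nm_le0 ltNge. Qed.
Lemma nmD x y : N (x + y) <= N x + N y.
Proof. by have := ler_normD (x : A) (y : A); rewrite !nmE -rmorphD lecR. Qed.
Lemma nmN x : N (- x) = N x.
Proof. by rewrite /nm normrN. Qed.
Lemma nmBC x y : N (x - y) = N (y - x).
Proof. by rewrite -nmN opprB. Qed.
Lemma nmB x y : N (x - y) <= N x + N y.
Proof. by rewrite -(nmN y) nmD. Qed.
Lemma nmZ r x : N (r *: x) = `|r| * N x.
Proof.
apply: (@complexI R); rewrite rmorphM /= -!nmE normrZ normc_def /= expr0n /= addr0 sqrtr_sqr.
by [].
Qed.
Lemma nmM x y : N (x * y) <= N x * N y.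
Proof. by have := cnormM S x y; rewrite !nmE -rmorphM lecR. Qed.
Lemma stD x y : st (x + y) = st x + st y.
Proof. by have := cadjD S 1 x y; rewrite rmorph1 !scale1r. Qed.
Lemma st0 : st 0 = 0.
Proof. by apply: (addrI (st 0)); rewrite -stD !addr0. Qed.
Lemma stN x : st (- x) = - st x.
Proof. by apply: (addrI (st x)); rewrite -stD !subrr st0. Qed.
Lemma stB x y : st (x - y) = st x - st y.
Proof. by rewrite stD stN. Qed.
Lemma stM x y : st (x * y) = st y * st x.
Proof. exact: cadjM. Qed.
Lemma stK x : st (st x) = x.
Proof. exact: cadjK. Qed.
Lemma st1 : st 1 = 1.
Proof. by have := stM (st 1) 1; rewrite mulr1 stK mulr1 => <-. Qed.
Lemma stZ r x : st (r *: x) = r *: st x.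
Proof.
have hr : Num.conj (r%:C)%C = (r%:C)%C :> R[i].
  by rewrite conj_Creal //; apply/complex_realP; exists r.
have := cadjD S (r%:C)%C x 0; rewrite -/(st _) -/(st _) -/(st 0) st0 !addr0 hr.
exact.
Qed.

Lemma nm_adj x : N (st x) = N x.
Proof.
have sq y : N (st y * y) = N y ^+ 2.
  apply: (@complexI R); rewrite rmorphXn /= -!nmE; exact: cnormC.
have le y : N y <= N (st y).
  have [->|y0] := eqVneq y 0; first by rewrite st0.
  rewrite -(ler_pM2r (_ : 0 < N y)) ?nm_gt0 // -expr2 -sq; exact: nmM.
by apply/eqP; rewrite eq_le le -{2}(stK x) le.
Qed.
Lemma nm_stM x : N (st x * x) = N x ^+ 2.
Proof. apply: (@complexI R); rewrite rmorphXn /= -!nmE; exact: cnormC. Qed.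
Lemma nm_Mst x : N (x * st x) = N x ^+ 2.
Proof. by rewrite -{1}(stK x) nm_stM nm_adj. Qed.
Lemma nm_sqr x : st x = x -> N (x ^+ 2) = N x ^+ 2.
Proof. by move=> h; rewrite -nm_stM h -expr2. Qed.
Lemma nm1 : N 1 = 1.
Proof.
have h : N 1 = N 1 ^+ 2 by rewrite -nm_stM st1 mulr1.
have n0 : N 1 != 0 by rewrite nm_eq0 oner_neq0.
by apply: (mulfI n0); rewrite -expr2 -h mulr1.
Qed.
Lemma nmX x n : N (x ^+ n) <= N x ^+ n.
Proof.
elim: n => [|n ih]; first by rewrite !expr0 nm1.
by rewrite !exprS (le_trans (nmM _ _)) // ler_wpM2l ?nm_ge0.
Qed.
Lemma nm_sum I (s : seq I) (P : pred I) (F : I -> T) :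
  N (\sum_(i <- s | P i) F i) <= \sum_(i <- s | P i) N (F i).
Proof.
elim/big_rec2: _ => [|i u v _ h]; first by rewrite nm0.
by rewrite (le_trans (nmD _ _)) // lerD2l.
Qed.
Lemma st_sum I (s : seq I) (P : pred I) (F : I -> T) :
  st (\sum_(i <- s | P i) F i) = \sum_(i <- s | P i) st (F i).
Proof.
by elim/big_rec2: _ => [|i u v _ <-]; rewrite ?st0 // stD.
Qed.
Lemma nmM2 x y a b : N x <= a -> N y <= b -> N (x * y) <= a * b.
Proof.
move=> hx hy; apply: (le_trans (nmM _ _)).
by apply: ler_pM => //; exact: nm_ge0.
Qed.
Lemma nmD2 x y a b : N x <= a -> N y <= b -> N (x + y) <= a + b.
Proof. by move=> hx hy; apply: (le_trans (nmD _ _)); apply: lerD. Qed.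
Lemma nmB2 x y a b : N x <= a -> N y <= b -> N (x - y) <= a + b.
Proof. by move=> hx hy; apply: (le_trans (nmB _ _)); apply: lerD. Qed.
Lemma nm_triB x y z : N (x - z) <= N (x - y) + N (y - z).
Proof. by rewrite -(subrKA y) nmD. Qed.

Lemma J_comm x : J * x = x * J.
Proof. by rewrite /J /GRing.mul /= cmulZl cmulZr cmul1l cmul1r. Qed.
Lemma J_sqr : J * J = -1.
Proof.
by rewrite /J /GRing.mul /= cmulZl cmulZr cmul1r scalerA -expr2 sqr_i scaleN1r.
Qed.
Lemma st_J : st J = - J.
Proof.
have hi : Num.conj 'i%C = - 'i%C :> R[i].
  by apply/eqP; rewrite eq_complex /= oppr0 !eqxx.
have h1 : cadj S (cone S) = cone S by exact: st1.
have := cadjD S 'i%C (cone S) 0; rewrite -/(st 0) st0 !addr0 hi h1 /J => h.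
rewrite /st h; transitivity ((- 'i%C : R[i]) *: (cone S : A)); first by [].
by rewrite scaleNr.
Qed.
Lemma complex_scale (k : R[i]) x :
  (k *: (x : A) : A) = (complex.Re k *: x + complex.Im k *: (J * x) : T).
Proof.
rewrite {1}[k]complexE scalerDl ['i%C * _]mulrC -scalerA /J /GRing.mul /= cmulZl cmul1l.
by [].
Qed.

Lemma closureP (X : set A) (x : T) :
  closure X x <-> forall e : R, 0 < e -> exists2 y : T, X y & N (x - y) < e.
Proof.
split=> [h e e0|h B].
  have [|y [Xy hy]] := h (ball (x : A) (e%:C)%C); first by apply: nbhsx_ballx; rewrite ltcR.
  by exists y => //; move: hy; rewrite -ball_normE /= nmE ltcR.
move/nbhs_ballP => [e /= e0 hB].
have [er0 eE] : 0 < complex.Re e /\ e = ((complex.Re e)%:C)%C.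
  by move: e0; case: (e) => a b; rewrite ltcE /= => /andP[/eqP -> ->].
have [y Xy hy] := h _ er0; exists y; split => //; apply: hB.
by rewrite -ball_normE /= (nmE (x - y)) eE ltcR.
Qed.

(** The scalars [U] majorise the increments of [u], so completeness gives a limit and telescoping
    gives the explicit error [M - U n]. The Neumann series and the square root take their
    convergence rates from here. *)
Lemma dominated_limit (u : nat -> T) (U : nat -> R) M :
  (forall n, N (u n.+1 - u n) <= U n.+1 - U n) -> (forall n, U n <= M) ->
  exists l : T, forall n, N (u n - l) <= M - U n.
Proof.
move=> hu hM.
have tel n k : N (u (n + k)%N - u n) <= U (n + k)%N - U n.
  elim: k => [|k ih]; first by rewrite addn0 !subrr nm0.
  rewrite addnS (le_trans (nm_triB _ (u (n + k)%N) _)) //.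
  have := hu (n + k)%N; lra.
have ndU : {homo U : n m / (n <= m)%N >-> n <= m}.
  apply: homo_leq => // [x y z|n]; first exact: le_trans.
  by rewrite -subr_ge0 (le_trans _ (hu n)) // nm_ge0.
have supU : has_sup (range U).
  by split; [exists (U 0%N), 0%N | exists M => _ [n _ <-]].
have near_sup e : 0 < e -> exists n, forall m, (n <= m)%N -> N (u m - u n) < e.
  move=> e0; have [_ [n _ <-] hn] := sup_adherent e0 supU; exists n => m nm.
  rewrite -(subnKC nm); apply: le_lt_trans (tel _ _) _.
  have := ub_le_sup (proj2 supU) (ex_intro2 _ _ (n + (m - n))%N I erefl); lra.
have cu : cvg ((u : nat -> A) @ \oo).
  apply/cauchy_cvgP/cauchy_ballP => e e0.
  have [er0 eE] : 0 < complex.Re e /\ e = ((complex.Re e)%:C)%C.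
    by move: e0; case: (e) => a b; rewrite ltcE /= => /andP[/eqP -> ->].
  have [n hn] := near_sup (complex.Re e / 2) (divr_gt0 er0 (ltr0n _ 2)).
  exists ([set x | exists2 m, (n <= m)%N & u m = x], [set x | exists2 m, (n <= m)%N & u m = x]) => /=.
    by split; exists n => // m /= nm; exists m.
  move=> [_ _] /= [[m nm <-] [p np <-]].
  rewrite -ball_normE /= (nmE (u m - u p)) eE ltcR.
  apply: le_lt_trans (nm_triB _ (u n) _) _.
  by rewrite [ltRHS]splitr ltrD ?hn // nmBC hn.
exists (lim ((u : nat -> A) @ \oo)) => n.
apply/ler_addgt0Pr => e e0.
have /cvg_ballP/(_ (e%:C)%C) := cu; rewrite ltcR => /(_ e0) [m _ hm].
have := hm (n + m)%N (leq_addl _ _); rewrite -ball_normE /= nmE ltcR => h.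
apply: le_trans (nm_triB _ (u (n + m)%N) _) _.
have h1 : N (u n - u (n + m)%N) <= M - U n.
  by rewrite nmBC (le_trans (tel _ _)) // lerD2r.
by rewrite lerD // nmBC ltW.
Qed.
End Norm.

(** * Normalisation of identities in a non-commutative ring *)

Section NcRing.
Variable T : nzRingType.
#[global] Instance nc_ops : @Ncring.Ring_ops T 0%R 1%R +%R *%R (fun x y => x - y) -%R eq := {}.
#[global] Instance nc_ring : @Ncring.Ring T _ _ _ _ _ _ _ nc_ops.
Proof.
split; rewrite /Algebra_syntax.addition /Ncring.add_notation /Algebra_syntax.multiplication /Ncring.mul_notation
  /Algebra_syntax.opposite /Ncring.opp_notation /Algebra_syntax.subtraction /Ncring.sub_notation
  /Algebra_syntax.equality /Ncring.eq_notation /Algebra_syntax.zero /Ncring.zero_notation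
  /Algebra_syntax.one /Ncring.one_notation.
- exact: RelationClasses.eq_equivalence.
- by move=> ?? -> ?? ->.
- by move=> ?? -> ?? ->.
- by move=> ?? -> ?? ->.
- by move=> ?? ->.
- exact: add0r.
- exact: addrC.
- exact: addrA.
- exact: mul1r.
- exact: mulr1.
- exact: mulrA.
- exact: mulrDl.
- by move=> x y z; rewrite mulrDr.
- by [].
- exact: addrN.
Qed.
End NcRing.
Ltac ncring := Ncring_tac.non_commutative_ring.

(** * Neumann series, square roots and positive elements *)

Section SquareRoots.
Context {R : realType} {A : completeNormedModType R[i]} {S : ucstar A}.
Local Notation T := (calg S).
Local Notation N := (@nm R A S).
Local Notation st := (@st R A S).
Implicit Types (a b c x y z : T) (r t e : R).

Lemma expr_small (c C e : R) : 0 <= c < 1 -> 0 < e -> exists n, C * c ^+ n <= e.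
Proof.
move=> /andP[c0 c1] e0.
have h : (fun n => C * c ^+ n) @ \oo --> (0 : R).
  rewrite -(mulr0 C); apply: cvgM; first exact: cvg_cst.
  by apply: cvg_expr; rewrite ger0_norm.
move/cvgrPdist_le : h => /(_ _ e0) [n _ hn]; exists n.
by have := hn n (leqnn n); rewrite sub0r normrN => /(le_trans (ler_norm _)).
Qed.

Lemma nm_le_small x : (forall e, 0 < e -> N x <= e) -> x = 0.
Proof.
move=> h; apply/eqP; rewrite -nm_le0.
by apply/ler_addgt0Pr => e e0; rewrite add0r h.
Qed.

Lemma comm_inv x y z : x * y = 1 -> y * x = 1 -> GRing.comm x z -> GRing.comm y z.
Proof.
move=> xy yx xz; rewrite /GRing.comm.
by rewrite -[y * z]mulr1 -xy -[y * z * _]mulrA [z * _]mulrA -xz -[_ * y]mulrA mulrA yx mul1r.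
Qed.

Lemma inv_sa x y : x * y = 1 -> y * x = 1 -> st x = x -> st y = y.
Proof.
move=> xy yx sx.
have h : st y * x = 1 by rewrite -{1}sx -stM xy st1.
by rewrite -[st y]mulr1 -xy mulrA h mul1r.
Qed.

(** The geometric series in [x] is majorised by the one in [c]; the error bound at [n = 0] is the
    norm of the inverse. *)
Lemma neumann x (c : R) : N x <= c -> c < 1 ->
  exists y, [/\ (1 - x) * y = 1, y * (1 - x) = 1 & N y <= (1 - c)^-1].
Proof.
move=> xc c1; have c0 : 0 <= c := le_trans (nm_ge0 _) xc.
have d0 : 0 < 1 - c by rewrite subr_gt0.
pose u n := \sum_(i < n) x ^+ i; pose U n := \sum_(i < n) c ^+ i.
have UE n : U n = (1 - c)^-1 - c ^+ n / (1 - c).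
  apply: (mulfI (lt0r_neq0 d0)); rewrite mulrBr mulfV ?lt0r_neq0 //.
  rewrite [(1 - c) * (_ / _)]mulrC divfK ?lt0r_neq0 //.
  by rewrite -[in LHS](opprB c 1) mulNr -subrX1 opprB.
have Xn n : N (x ^+ n) <= c ^+ n.
  by apply: (le_trans (nmX _ _)); apply: lerXn2r; rewrite ?nnegrE ?nm_ge0.
have [||y hy] := @dominated_limit _ _ _ u U (1 - c)^-1.
- by move=> n; rewrite /u /U !big_ord_recr /= [X in X - _]addrC addrK [X in _ <= X - _]addrC addrK.
- by move=> n; rewrite UE lerBlDr lerDl divr_ge0 ?exprn_ge0 // ltW.
have hy' n : N (u n - y) <= c ^+ n / (1 - c) by apply: le_trans (hy n) _; rewrite UE; lra.
have xB : N (1 - x) <= 2.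
  by apply: le_trans (nmB _ _) _; rewrite nm1; lra.
have key n : (1 - x) * u n = 1 - x ^+ n.
  by rewrite -(opprB x 1) mulNr -subrX1 opprB.
have key' n : u n * (1 - x) = 1 - x ^+ n.
  rewrite -key; apply/commr_sym/commr_sum => i _; apply/commr_sym.
  by apply: commrB; [exact: commr1 | apply/commr_sym/commrX].
have small e : 0 < e -> exists n, 2 * (c ^+ n / (1 - c)) + c ^+ n <= e.
  move=> e0; have [|n hn] := @expr_small c (2 / (1 - c) + 1) e _ e0; first by rewrite c0.
  by exists n; apply: le_trans hn; rewrite mulrDl mul1r; lra.
exists y; split.
- apply/eqP; rewrite -subr_eq0; apply/eqP/nm_le_small => e /small[n hn]; apply: le_trans hn.
  have -> : (1 - x) * y - 1 = - ((1 - x) * (u n - y)) - x ^+ n by rewrite mulrBr key; ncring.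
  apply: nmB2 => //; rewrite nmN; exact: nmM2.
- apply/eqP; rewrite -subr_eq0; apply/eqP/nm_le_small => e /small[n hn]; apply: le_trans hn.
  have -> : y * (1 - x) - 1 = - ((u n - y) * (1 - x)) - x ^+ n by rewrite mulrBl key'; ncring.
  apply: nmB2 => //; rewrite nmN mulrC; exact: nmM2.
by have := hy 0%N; rewrite /u /U !big_ord0 sub0r nmN subr0.
Qed.

(* The Newton-type iteration u |-> (b + u^2)/2, whose fixed point u satisfies (1 - u)^2 = 1 - b. *)
Fixpoint sqrt_it b n : T := if n is m.+1 then 2^-1 *: (b + sqrt_it b m * sqrt_it b m) else 0.
(** The same iteration for the scalar [b = 1], where it increases to 1; it majorises [sqrt_it b] for
    every [b] in the unit ball. *)
Fixpoint sqrt_bound n : R := if n is m.+1 then (1 + sqrt_bound m * sqrt_bound m) / 2 else 0.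

Lemma sqrt_bound_itv n : 0 <= sqrt_bound n <= 1.
Proof.
elim: n => [|n /andP[h0 h1]] /=; first by rewrite lexx ler01.
by apply/andP; split; nra.
Qed.

(** The gap [e = 1 - sqrt_bound n] becomes [e - e^2 / 2] in one step, hence decays like [2 / n].
    This rate does not depend on [b], which later makes commutator estimates uniform along a
    sequence. *)
Lemma sqrt_bound_cvg n : 1 - sqrt_bound n <= 2 / n.+2%:R.
Proof.
elim: n => [|n ih] /=; first by rewrite subr0 divff ?pnatr_eq0.
have /andP[h0 h1] := sqrt_bound_itv n; set v := sqrt_bound n in ih h0 h1 *.
have n2 : 0 < n.+2%:R :> R by rewrite ltr0n.
have n3 : n.+3%:R = n.+2%:R + 1 :> R by rewrite -natr1.
rewrite n3; set m : R := n.+2%:R in ih n2 *.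
have m2 : 2 <= m by rewrite /m ler_nat.
rewrite ler_pdivlMr; last lra.
rewrite ler_pdivlMr // in ih.
set e := 1 - v in ih; have -> : v = 1 - e by rewrite /e; lra.
have e0 : 0 <= e by rewrite /e; lra. have e1 : e <= 1 by rewrite /e; lra.
rewrite -subr_ge0; nra.
Qed.


Lemma sqrt_it_comm b n z : GRing.comm b z -> GRing.comm (sqrt_it b n) z.
Proof.
move=> bz; elim: n => [|n ih] /=; first by apply/commr_sym/commr0.
have h : GRing.comm (b + sqrt_it b n * sqrt_it b n) z.
  by apply/commr_sym/commrD; [|apply: commrM]; apply/commr_sym.
by rewrite /GRing.comm -scalerAl -scalerAr h.
Qed.

Lemma sqrt_it_le b n : N b <= 1 -> N (sqrt_it b n) <= sqrt_bound n.
Proof.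
move=> b1; elim: n => [|n ih] /=; first by rewrite nm0.
rewrite nmZ ger0_norm ?invr_ge0 // mulrC ler_wpM2r ?invr_ge0 //.
by apply: nmD2 => //; apply: nmM2.
Qed.

(** Consecutive iterates commute, so the difference of their squares factors and the increments obey
    the recursion of the scalar ones. *)
Lemma sqrt_it_step b n : N b <= 1 ->
  N (sqrt_it b n.+1 - sqrt_it b n) <= sqrt_bound n.+1 - sqrt_bound n.
Proof.
move=> b1; elim: n => [|n ih].
  rewrite [sqrt_bound]lock /= -lock mul0r addr0 !subr0 nmZ ger0_norm ?invr_ge0 //=.
  by rewrite mul0r addr0 mul1r ler_piMr ?invr_ge0.
set u := sqrt_it b n.+1 in ih *; set v := sqrt_it b n in ih *.
set U := sqrt_bound n.+1 in ih *; set V := sqrt_bound n in ih *.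
have uv : GRing.comm u v by apply/commr_sym/sqrt_it_comm/commr_sym/sqrt_it_comm.
have -> : sqrt_it b n.+2 - u = 2^-1 *: ((u - v) * (u + v)).
  rewrite [in X in _ - X = _]/u /= -/u -/v -scalerBr; congr (_ *: _).
  have := uv; rewrite /GRing.comm => h; transitivity (u * u - v * v); first ncring.
  by transitivity (u * u - v * v + (u * v - v * u)); [rewrite h; ncring | ncring].
have -> : sqrt_bound n.+2 - U = 2^-1 * ((U - V) * (U + V)).
  transitivity ((1 + U * U) / 2 - (1 + V * V) / 2); first by [].
  by clearbody U V; field.
rewrite nmZ ger0_norm ?invr_ge0 // ler_wpM2l ?invr_ge0 //.
by apply: nmM2 => //; apply: nmD2; apply: sqrt_it_le.
Qed.


Lemma half_addr x : 2^-1 *: x + 2^-1 *: x = x.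
Proof. by rewrite -scalerDl -[RHS]scale1r; congr (_ *: _); field. Qed.

Lemma inv_small (r e : R) : 0 < e -> exists n, r / n.+2%:R <= e.
Proof.
move=> e0; exists (Num.truncn (r / e)).
have h := truncnS_gt (r / e).
rewrite ler_pdivrMr ?ltr0n // -ler_pdivrMl // mulrC ltW // (lt_le_trans h) //.
by rewrite ler_nat.
Qed.

Lemma sqrt_lim b : N b <= 1 -> exists u, [/\ u + u = b + u * u, N u <= 1 &
  forall n, N (sqrt_it b n - u) <= 2 / n.+2%:R].
Proof.
move=> b1.
have [||u hu] := @dominated_limit _ _ _ (sqrt_it b) sqrt_bound 1.
- by move=> n; apply: sqrt_it_step.
- by move=> n; case/andP: (sqrt_bound_itv n).
have u1 : N u <= 1 by have := hu 0%N; rewrite /= sub0r nmN subr0.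
have hu' n : N (sqrt_it b n - u) <= 2 / n.+2%:R.
  exact: le_trans (hu n) (sqrt_bound_cvg n).
exists u; split => //.
apply/eqP; rewrite -subr_eq0; apply/eqP/nm_le_small => e e0.
have [n hn] := inv_small 8 e0; apply: le_trans hn.
have v1 : N (sqrt_it b n) <= 1.
  by apply: le_trans (sqrt_it_le _ b1) _; case/andP: (sqrt_bound_itv n).
have hn' : N (sqrt_it b n.+1 - u) <= 2 / n.+2%:R.
  apply: le_trans (hu' n.+1) _.
  by rewrite ler_wpM2l // lef_pV2 ?posrE ?ltr0n // ler_nat.
set v' := sqrt_it b n.+1 in hn'; set v := sqrt_it b n in v1.
have v'E : v' + v' = b + v * v by exact: half_addr.
have -> : u + u - (b + u * u) = (v * (v - u) + (v - u) * u) - ((v' - u) + (v' - u)).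
  transitivity (u + u + (v * v - u * u) - (v' + v')); first by rewrite v'E; ncring.
  by ncring.
have -> : 8 / n.+2%:R = (1 * (2 / n.+2%:R) + 2 / n.+2%:R * 1) + (2 / n.+2%:R + 2 / n.+2%:R) :> R by ring.
have hv : N (v - u) <= 2 / n.+2%:R by exact: hu'.
by apply: nmB2; apply: nmD2 => //; apply: nmM2.
Qed.

Lemma sqrt_lim_comm b u z : (forall n, N (sqrt_it b n - u) <= 2 / n.+2%:R) ->
  GRing.comm b z -> GRing.comm u z.
Proof.
move=> hu bz; apply/eqP; rewrite -subr_eq0; apply/eqP/nm_le_small => e e0.
have [n hn] := inv_small (4 * N z) e0; apply: le_trans hn.
have h := @sqrt_it_comm b n z bz.
have -> : u * z - z * u = z * (sqrt_it b n - u) - (sqrt_it b n - u) * z.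
  by rewrite mulrBl h; ncring.
have -> : 4 * N z / n.+2%:R = N z * (2 / n.+2%:R) + 2 / n.+2%:R * N z by ring.
by apply: nmB2; apply: nmM2.
Qed.

Lemma sqrt_lim_sa b u : (forall n, N (sqrt_it b n - u) <= 2 / n.+2%:R) ->
  st b = b -> st u = u.
Proof.
move=> hu sb; apply/eqP; rewrite -subr_eq0; apply/eqP/nm_le_small => e e0.
have [n hn] := inv_small 4 e0; apply: le_trans hn.
have h : st (sqrt_it b n) = sqrt_it b n.
  by elim: n => [|n ih] /=; rewrite ?st0 // stZ stD stM ih sb.
have -> : st u - u = (sqrt_it b n - u) - st (sqrt_it b n - u).
  by rewrite stB h; ncring.
have -> : 4 / n.+2%:R = 2 / n.+2%:R + 2 / n.+2%:R :> R by ring.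
by apply: nmB2; rewrite ?nm_adj.
Qed.

(** The product rule gives linear growth in [n]. It is played against the truncation error
    [2 / n.+2], with [n] fixed beforehand by the tolerance. *)
Lemma sqrt_it_commutator b n z : N b <= 1 ->
  N (sqrt_it b n * z - z * sqrt_it b n) <= n%:R * N (b * z - z * b).
Proof.
move=> b1; elim: n => [|n ih] /=; first by rewrite !mul0r mulr0 subrr nm0.
set v := sqrt_it b n in ih *.
have v1 : N v <= 1.
  by apply: le_trans (sqrt_it_le _ b1) _; case/andP: (sqrt_bound_itv n).
rewrite -scalerAl -scalerAr -scalerBr nmZ ger0_norm ?invr_ge0 //.
have -> : (b + v * v) * z - z * (b + v * v) =
  (b * z - z * b) + (v * (v * z - z * v) + (v * z - z * v) * v) by ncring.
rewrite ler_pdivrMl // -natr1.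
have h1 : N (v * (v * z - z * v)) <= 1 * (n%:R * N (b * z - z * b)) by apply: nmM2.
have h2 : N ((v * z - z * v) * v) <= (n%:R * N (b * z - z * b)) * 1 by apply: nmM2.
apply: le_trans (nmD _ _) _; have := nmD (v * (v * z - z * v)) ((v * z - z * v) * v).
have := nm_ge0 (b * z - z * b); lra.
Qed.

(** Positivity as a norm inequality: [a] lies in the ball of radius [t] about [t]. Sums are then
    immediate and square roots come from a convergent iteration; agreement with the spectral
    definition is [positiveP]. *)
Definition Pos a := st a = a /\ exists t, N (t%:A - a) <= t.

Lemma nm_alg r : N (r%:A) = `|r|.
Proof. by rewrite nmZ nm1 mulr1. Qed.
Lemma st_alg r : st r%:A = r%:A.
Proof. by rewrite stZ st1. Qed.

Lemma Pos_ex a : Pos a -> exists2 t, 0 < t & N (t%:A - a) <= t.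
Proof.
move=> [_ [t ht]]; have t0 : 0 <= t := le_trans (nm_ge0 _) ht.
exists (t + 1); first by rewrite ltr_wpDl.
have -> : (t + 1)%:A - a = (t%:A - a) + 1 by rewrite scalerDl scale1r; ncring.
by apply: nmD2 => //; rewrite nm1.
Qed.

Lemma PosZ r a : 0 <= r -> Pos a -> Pos (r *: a).
Proof.
move=> r0 [sa [t ht]]; split; first by rewrite stZ sa.
by exists (r * t); rewrite -scalerA -scalerBr nmZ ger0_norm // ler_wpM2l.
Qed.

Lemma PosD a b : Pos a -> Pos b -> Pos (a + b).
Proof.
move=> [sa [t ht]] [sb [s hs]]; split; first by rewrite stD sa sb.
exists (t + s); rewrite scalerDl.
have -> : t%:A + s%:A - (a + b) = (t%:A - a) + (s%:A - b) by ncring.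
exact: nmD2.
Qed.

Lemma Pos_of_nm r y : st y = y -> N y <= r -> Pos (r%:A - y).
Proof.
move=> sy yr; split; first by rewrite stB st_alg sy.
by exists r; rewrite opprB addrC subrK.
Qed.

Lemma Pos_alg r : 0 <= r -> Pos (r%:A).
Proof. by move=> r0; rewrite -[r%:A]subr0; apply: Pos_of_nm; rewrite ?st0 ?nm0. Qed.
Lemma Pos1 : Pos 1.
Proof. by rewrite -[1]scale1r; apply: Pos_alg. Qed.
Lemma Pos0 : Pos 0.
Proof. by rewrite -(scale0r (1 : T)); apply: Pos_alg. Qed.

Lemma Pos_sum I (l : seq I) (P : pred I) (F : I -> T) :
  (forall i, P i -> Pos (F i)) -> Pos (\sum_(i <- l | P i) F i).
Proof. by move=> h; elim/big_rec: _ => [|i x Pi hx]; [exact: Pos0 | apply: PosD => //; apply: h]. Qed.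

Lemma Pos_sqrt a : Pos a -> exists s, [/\ Pos s, s * s = a &
  forall z, GRing.comm a z -> GRing.comm s z].
Proof.
move=> pa; have [t t0 ht] := Pos_ex pa; have [sa _] := pa.
(* Rescaling puts [b] in the unit ball, and the limit [u] satisfies [(1 - u)^2 = 1 - b = a / t]. *)
pose b : T := 1 - t^-1 *: a.
have b1 : N b <= 1.
  have -> : b = t^-1 *: (t%:A - a) by rewrite scalerBr scalerA mulVf ?gt_eqF // scale1r.
  by rewrite nmZ gtr0_norm ?invr_gt0 // ler_pdivrMl ?mulr1.
have [u [uE u1 hu]] := sqrt_lim b1.
have su : st u = u.
  by apply: (sqrt_lim_sa hu); rewrite stB st1 stZ sa.
have tt : Num.sqrt t * Num.sqrt t = t by rewrite -expr2 sqr_sqrtr // ltW.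
exists (Num.sqrt t *: (1 - u)); split.
- rewrite scalerBr; apply: Pos_of_nm; first by rewrite stZ su.
  by rewrite nmZ ger0_norm ?sqrtr_ge0 // ler_piMr ?sqrtr_ge0.
- rewrite -scalerAl -scalerAr scalerA tt.
  have -> : (1 - u) * (1 - u) = 1 - (u + u) + u * u by ncring.
  have -> : 1 - (u + u) + u * u = t^-1 *: a by rewrite uE /b; ncring.
  by rewrite scalerA mulfV ?gt_eqF // scale1r.
move=> z az.
have uz : GRing.comm u z.
  apply: (sqrt_lim_comm hu); apply/commr_sym/commrB; first exact: commr1.
  by apply/commr_sym; rewrite /GRing.comm -scalerAl -scalerAr az.
rewrite /GRing.comm -scalerAl -scalerAr mulrBl mulrBr uz mulr1 mul1r //.
Qed.

(* y + i s is r times a unitary, and y is its real part. *)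
Lemma nm_le_unitary y s r : st y = y -> st s = s -> GRing.comm y s -> 0 <= r ->
  y * y + s * s = (r ^+ 2)%:A -> N y <= r.
Proof.
move=> sy ss ys r0 h.
pose J0 : T := J S.
have Jc x : J0 * x = x * J0 by exact: J_comm.
pose w := y + J0 * s.
have sw : st w = y - J0 * s by rewrite /w stD stM sy ss st_J -/J0 mulrN -Jc.
have E : st w * w = y * y + s * s.
  have e1 : J0 * s * (J0 * s) = - (s * s) by rewrite -mulrA [s * _]mulrA -[s * J0]Jc !mulrA J_sqr !mulNr mul1r.
  have e2 : y * (J0 * s) = J0 * s * y by rewrite mulrA -Jc -!mulrA ys.
  rewrite sw /w mulrDr !mulrBl e1 e2; ncring.
have nw : N w = r.
  have := nm_stM w; rewrite E h nm_alg ger0_norm ?exprn_ge0 //.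
  move/eqP; rewrite eqrXn2 ?nm_ge0 // => /eqP <- //.
have -> : y = 2^-1 *: (w + st w).
  by rewrite -[LHS]half_addr sw /w -scalerDr; congr (_ *: _); ncring.
rewrite nmZ ger0_norm ?invr_ge0 // ler_pdivrMl //.
have -> : 2 * r = r + r by ring.
by apply: nmD2; rewrite ?nm_adj nw.
Qed.

End SquareRoots.

(** * Order and norm on the positive cone *)

Section PositiveCone.
Context {R : realType} {A : completeNormedModType R[i]} {S : ucstar A}.
Local Notation T := (calg S).
Local Notation N := (@nm R A S).
Local Notation st := (@st R A S).
Implicit Types (a b c x y z : T) (r t e : R).

Lemma Pos_sa a : Pos a -> st a = a. Proof. by case. Qed.

Lemma nm_sqr_le y r : st y = y -> 0 <= r -> N (y * y) <= r ^+ 2 -> N y <= r.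
Proof.
move=> sy r0; rewrite -{1}sy nm_stM => h.
by rewrite -(ler_pXn2r (n := 2)) ?nnegrE ?nm_ge0.
Qed.

(** With [u] the limit for [b = y^2], the element [s = 1 - u] satisfies [s^2 + y^2 = 1]. It is the
    real part of the unitary [s + i y], so it has norm at most 1, and so has [s^2 = 1 - y^2]. This
    is why squares of self-adjoint elements satisfy [Pos]. *)
Lemma nm_one_sub_sqr y : st y = y -> N y <= 1 -> N (1 - y * y) <= 1.
Proof.
move=> sy y1.
have yy1 : N (y * y) <= 1 by rewrite -[leRHS]mulr1; apply: nmM2.
have [u [uE u1 hu]] := sqrt_lim yy1.
have su : st u = u by apply: (sqrt_lim_sa hu); rewrite stM sy.
have uy : GRing.comm u y by apply: (sqrt_lim_comm hu); rewrite /GRing.comm mulrA.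
have ssE : (1 - u) * (1 - u) = 1 - y * y.
  have -> : (1 - u) * (1 - u) = 1 - (u + u) + u * u by ncring.
  by rewrite uE; ncring.
have s1 : N (1 - u) <= 1.
  apply: (@nm_le_unitary _ _ _ (1 - u) y) => //.
  - by rewrite stB st1 su.
  - by apply/commr_sym/commrB; [exact: commr1 | apply/commr_sym].
  - by rewrite ssE subrK expr1n scale1r.
by rewrite -ssE -[leRHS]mulr1; apply: nmM2.
Qed.

Lemma nm_sub_sqr y r : st y = y -> 0 <= r -> N y <= r -> N ((r ^+ 2)%:A - y * y) <= r ^+ 2.
Proof.
move=> sy r0 yr; have [r00|rN0] := eqVneq r 0.
  have -> : y = 0 by apply/eqP; rewrite -nm_le0 -r00.
  by rewrite r00 expr0n /= scale0r mul0r subrr nm0.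
have rp : 0 < r by rewrite lt_def rN0.
have h : N (1 - (r^-1 *: y) * (r^-1 *: y)) <= 1.
  apply: nm_one_sub_sqr; first by rewrite stZ sy.
  by rewrite nmZ gtr0_norm ?invr_gt0 // ler_pdivrMl ?mulr1.
have -> : (r ^+ 2)%:A - y * y = r ^+ 2 *: (1 - (r^-1 *: y) * (r^-1 *: y)) :> T.
  rewrite scalerBr -scalerAl -scalerAr !scalerA; congr (_ - _).
  have -> : r ^+ 2 / r / r = 1 by field.
  by rewrite scale1r.
by rewrite nmZ ger0_norm ?exprn_ge0 // ler_piMr ?exprn_ge0.
Qed.

Lemma Pos_sqr y : st y = y -> Pos (y * y).
Proof.
by move=> sy; split; [rewrite stM sy | exists (N y ^+ 2); apply: nm_sub_sqr; rewrite ?nm_ge0].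
Qed.

(** A square root reduces this to [nm_sub_sqr]; the existential [t] in [Pos] may thus be any bound
    for the norm. *)
Lemma Pos_nm a r : Pos a -> N a <= r -> N (r%:A - a) <= r.
Proof.
move=> pa ar; have r0 : 0 <= r := le_trans (nm_ge0 _) ar.
have [s [ps sE _]] := Pos_sqrt pa; have ss := Pos_sa ps.
rewrite -sE -(sqr_sqrtr r0); apply: nm_sub_sqr => //.
by apply: nm_sqr_le; rewrite ?sqrtr_ge0 // sE sqr_sqrtr.
Qed.

Lemma Pos_mul a b : Pos a -> Pos b -> GRing.comm a b -> Pos (a * b).
Proof.
move=> pa pb ab.
have [s [ps sE sc]] := Pos_sqrt pa; have [v [pv vE vc]] := Pos_sqrt pb.
have sv : GRing.comm s v by apply/commr_sym/vc/commr_sym/sc.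
have -> : a * b = (s * v) * (s * v).
  by rewrite -sE -vE -!mulrA; congr (_ * _); rewrite !mulrA sv.
by apply: Pos_sqr; rewrite stM (Pos_sa ps) (Pos_sa pv) sv.
Qed.

(** Since [(b - r/2)^2 + b (r - b) = (r/2)^2] and [b (r - b)] is a square, [b - r/2] is [r/2] times
    the real part of a unitary. *)
Lemma Pos_nm_le b r : Pos b -> Pos (r%:A - b) -> N b <= r.
Proof.
move=> pb prb.
have r0 : 0 <= r.
  have [_ [t]] := PosD prb pb; rewrite subrK -scalerBl nm_alg => h.
  by have := le_trans (ler_norm _) h; lra.
have [s [ps sE sc]] : exists s, [/\ Pos s, s * s = b * (r%:A - b) &
    forall z, GRing.comm (b * (r%:A - b)) z -> GRing.comm s z].
  apply: Pos_sqrt; apply: Pos_mul => //.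
  by apply: commrB => //; apply/commr_sym/comm_alg.
have bc : GRing.comm (b * (r%:A - b)) b.
  rewrite /GRing.comm !mulrBr !mulrBl; congr (_ - _); last by rewrite mulrA.
  by rewrite -mulrA mulr_algl mulr_algr.
have h : N (b - (r / 2)%:A) <= r / 2.
  apply: (@nm_le_unitary _ _ _ _ s).
  - by rewrite stB st_alg (Pos_sa pb).
  - exact: Pos_sa ps.
  - apply/commr_sym/commrB; first by apply: sc.
    by apply/commr_sym/comm_alg.
  - by rewrite divr_ge0.
  - have rE : r%:A = (r / 2)%:A + (r / 2)%:A :> T by rewrite -scalerDl; congr (_ *: _); field.
    have r2E : (r / 2) ^+ 2 *: 1 = (r / 2)%:A * (r / 2)%:A :> T by rewrite mulr_algl scalerA.
    have cb : (r / 2)%:A * b = b * (r / 2)%:A by rewrite mulr_algl mulr_algr.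
    rewrite sE rE r2E; transitivity ((r / 2)%:A * (r / 2)%:A - (r / 2)%:A * b + b * (r / 2)%:A).
      by ncring.
    by rewrite cb subrK.
have -> : b = (b - (r / 2)%:A) + (r / 2)%:A by rewrite subrK.
rewrite [r in _ <= r]splitr; apply: nmD2 => //.
by rewrite nm_alg ger0_norm // divr_ge0.
Qed.

Lemma Pos_le_nm a b : Pos a -> Pos (b - a) -> N a <= N b.
Proof.
move=> pa pba; apply: Pos_nm_le => //.
have -> : (N b)%:A - a = ((N b)%:A - b) + (b - a) by ncring.
apply: PosD => //; apply: Pos_of_nm => //.
by rewrite -(subrK a b) stD (Pos_sa pba) (Pos_sa pa).
Qed.

Lemma Pos_antisym a : Pos a -> Pos (- a) -> a = 0.
Proof.
move=> pa pa'; apply/eqP; rewrite -nm_le0; apply: Pos_nm_le => //.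
by rewrite scale0r sub0r.
Qed.

Lemma Pos_limit a : (forall e, 0 < e -> exists2 b, Pos b & N (a - b) <= e) -> Pos a.
Proof.
move=> h; split.
  apply/eqP; rewrite -subr_eq0; apply/eqP/nm_le_small => e e0.
  have [b pb hb] := h (e / 2) (divr_gt0 e0 (ltr0n _ 2)).
  have -> : st a - a = st (a - b) - (a - b) by rewrite stB (Pos_sa pb); ncring.
  by rewrite [e]splitr; apply: nmB2; rewrite ?nm_adj.
(* One radius that serves all approximants at distance at most 1. *)
exists (N a + 1); apply/ler_addgt0Pr => e e0.
pose e' := Num.min (e) 1.
have e'0 : 0 < e' by rewrite lt_min e0 ltr01.
have [b pb hb] := h e' e'0.
have e'1 : e' <= 1 by rewrite ge_min lexx orbT.
have e'e : e' <= e by rewrite ge_min lexx.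
have nb : N b <= N a + 1.
  have -> : b = a - (a - b) by ncring.
  by apply: nmB2 => //; exact: le_trans hb _.
have -> : (N a + 1)%:A - a = ((N a + 1)%:A - b) - (a - b) by ncring.
apply: nmB2; first exact: Pos_nm.
exact: le_trans hb _.
Qed.

Lemma Pos_inv x y : Pos x -> x * y = 1 -> y * x = 1 -> Pos y.
Proof.
move=> px xy yx.
have [s [ps sE sc]] := Pos_sqrt px.
have ys : GRing.comm y s by apply: (comm_inv xy yx); rewrite -sE /GRing.comm mulrA.
have sy := inv_sa xy yx (Pos_sa px).
have -> : y = (s * y) * (s * y).
  by rewrite -mulrA [y * _]mulrA ys !mulrA sE xy mul1r.
by apply: Pos_sqr; rewrite stM sy (Pos_sa ps) ys.
Qed.

(** With [r = N a], [a + t = (r + t) (1 - (r - a) / (r + t))], so the Neumann series converges. The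
    sharp bound [1/t] comes from order instead: [1/t - y = a y / t] is positive. *)
Lemma Pos_add_inv a t : Pos a -> 0 < t ->
  exists y, [/\ (a + t%:A) * y = 1, y * (a + t%:A) = 1, Pos y & N y <= t^-1].
Proof.
move=> pa t0; set r := N a; have r0 : 0 <= r by exact: nm_ge0.
have rt : 0 < r + t by rewrite ltr_wpDl.
have hr : N (r%:A - a) <= r by apply: Pos_nm.
have [||y [xy yx _]] := @neumann _ _ _ ((r + t)^-1 *: (r%:A - a)) (r / (r + t)).
- by rewrite nmZ gtr0_norm ?invr_gt0 // mulrC ler_wpM2r // invr_ge0 ltW.
- by rewrite ltr_pdivrMr // mul1r ltrDl.
have E : (r + t) *: (1 - (r + t)^-1 *: (r%:A - a)) = a + t%:A.
  by rewrite scalerBr scalerA mulfV ?gt_eqF // scale1r scalerDl; ncring.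
pose y' := (r + t)^-1 *: y.
have xy' : (a + t%:A) * y' = 1.
  by rewrite -E /y' -scalerAl -scalerAr scalerA mulfV ?gt_eqF // scale1r.
have yx' : y' * (a + t%:A) = 1.
  by rewrite -E /y' -scalerAl -scalerAr scalerA mulVf ?gt_eqF // scale1r.
have py : Pos y'.
  by apply: Pos_inv xy' yx'; apply: PosD => //; apply: Pos_alg; exact: ltW.
exists y'; split => //; apply: Pos_nm_le => //.
have -> : t^-1%:A - y' = t^-1 *: (a * y').
  have -> : a * y' = 1 - t *: y' by rewrite -xy' mulrDl mulr_algl; ncring.
  by rewrite scalerBr scalerA mulVf ?gt_eqF // scale1r.
apply: PosZ; first by rewrite invr_ge0 ltW.
apply: Pos_mul => //; apply/commr_sym/(comm_inv xy' yx').
by apply/commr_sym/commrD => //; apply/commr_sym/comm_alg.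
Qed.
End PositiveCone.

(** * Positive and negative parts, and positivity of [st z * z] *)

Section Decomposition.
Context {R : realType} {A : completeNormedModType R[i]} {S : ucstar A}.
Local Notation T := (calg S).
Local Notation N := (@nm R A S).
Local Notation st := (@st R A S).
Implicit Types (a b c x y z : T) (r t e : R).

Lemma Pos_double a : Pos (a + a) -> Pos a.
Proof.
by move=> h; rewrite -[a]half_addr -scalerDr; apply: PosZ.
Qed.

Lemma comm_halves m a z : GRing.comm m z -> GRing.comm a z -> GRing.comm (m + a) z.
Proof. by move=> h1 h2; apply/commr_sym/commrD; apply/commr_sym. Qed.

(* With y = |a| + a we have y^2 = 2|a|y, and y is the limit of (|a| + e)^-1 y^2 / 2 as e -> 0. *)
Lemma Pos_abs_add m a : st a = a -> Pos m -> m * m = a * a -> GRing.comm m a -> Pos (m + a).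
Proof.
move=> sa pm mE ma; set y := m + a.
have sy : st y = y by rewrite stD sa (Pos_sa pm).
have yy : y * y = m * y + m * y.
  rewrite /y mulrDl !mulrDr -mE ma; ncring.
have my : GRing.comm m y by apply: commrD.
have ay : GRing.comm a y by apply: commrD => //; apply/commr_sym.
apply: Pos_limit => e e0.
pose d := e / 2; have d0 : 0 < d by rewrite divr_gt0.
have [v [xv vx pv vN]] := Pos_add_inv pm d0.
have cv z : GRing.comm m z -> GRing.comm v z.
  move=> mz; apply: (comm_inv xv vx); apply: comm_halves => //.
  exact: comm_alg.
have vm : GRing.comm v m by apply: cv.
have va : GRing.comm v a by apply: cv.
have vy : GRing.comm v y by apply: cv.
have vmE : v * m = 1 - d *: v by rewrite -vx mulrDr mulr_algr; ncring.
have vm1 : N (v * m) <= 1.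
  apply: Pos_nm_le; first by apply: Pos_mul.
  rewrite scale1r vmE (_ : 1 - (1 - d *: v) = d *: v); last by ncring.
  by apply: PosZ => //; exact: ltW.
have va1 : N (v * a) <= 1.
  apply: nm_sqr_le => //; first by rewrite stM sa (Pos_sa pv) va.
  have -> : v * a * (v * a) = v * m * (v * m).
    have sq u : GRing.comm v u -> v * u * (v * u) = v * v * (u * u).
      by move=> vu; rewrite -mulrA [u * (v * u)]mulrA -vu; ncring.
    by rewrite !sq // mE.
  by rewrite expr1n -[leRHS]mulr1; apply: nmM2.
exists (2^-1 *: (v * (y * y))).
  apply: PosZ; first by rewrite invr_ge0.
  apply: Pos_mul => //; first exact: Pos_sqr.
  exact: commrM.
have -> : y - 2^-1 *: (v * (y * y)) = d *: (v * y).
  rewrite yy mulrDr scalerDr half_addr mulrA vmE mulrBl mul1r -scalerAl; ncring.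
rewrite nmZ gtr0_norm // [e]splitr -/d -mulr2n -mulr_natr ler_wpM2l ?(ltW d0) //.
have -> : v * y = v * m + v * a by rewrite mulrDr.
by apply: le_trans (nmD2 vm1 va1) _; lra.
Qed.

(** Here [p = (|a| + a) / 2] and [n = (|a| - a) / 2]; they are orthogonal because [|a|] commutes
    with [a] and has the same square. *)
Lemma Pos_parts a : st a = a -> exists p n,
  [/\ Pos p, Pos n, a = p - n, p * n = 0 & n * p = 0] /\
  forall z, GRing.comm a z -> GRing.comm p z /\ GRing.comm n z.
Proof.
move=> sa; have [m [pm mE mc]] := Pos_sqrt (Pos_sqr sa).
have ma : GRing.comm m a by apply: mc; rewrite /GRing.comm mulrA.
have pp : Pos (2^-1 *: (m + a)) by apply: PosZ; rewrite ?invr_ge0 //; apply: Pos_abs_add.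
have pn : Pos (2^-1 *: (m - a)).
  apply: PosZ; rewrite ?invr_ge0 //; apply: Pos_abs_add => //.
  - by rewrite stN sa.
  - by rewrite mulrNN.
  - exact: commrN.
exists (2^-1 *: (m + a)), (2^-1 *: (m - a)); split; first split => //.
- by rewrite -scalerBr -[LHS]half_addr -scalerDr; congr (_ *: _); ncring.
- rewrite -scalerAl -scalerAr mulrDl !mulrBr mE ma.
  by rewrite (_ : _ + _ = 0) ?scaler0 //; ncring.
- rewrite -scalerAl -scalerAr mulrBl !mulrDr mE ma.
  by rewrite (_ : _ - _ = 0) ?scaler0 //; ncring.
move=> z az; have mz : GRing.comm m z by apply: mc; apply/commr_sym/commrM; apply/commr_sym.
have naz : GRing.comm (- a) z by apply/commr_sym/commrN/commr_sym.
have h (u : T) : GRing.comm u z -> GRing.comm (2^-1 *: u) z.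
  by move=> uz; rewrite /GRing.comm -scalerAl -scalerAr uz.
by split; apply: h; apply: comm_halves.
Qed.

Definition has_inv x := exists y, x * y = 1 /\ y * x = 1.

(** If [y] inverts [N b - b], then [1 <= N y (N b - b)], that is [b <= N b - 1 / N y], which is too
    small a bound for the norm of [b]. *)
Lemma Pos_nm_spectrum b : Pos b -> 0 < N b -> ~ has_inv ((N b)%:A - b).
Proof.
move=> pb b0 [y [xy yx]]; set x := (N b)%:A - b in xy yx.
have px : Pos x by apply: Pos_of_nm => //; exact: Pos_sa.
have py := Pos_inv px xy yx.
have y0 : 0 < N y.
  rewrite nm_gt0; apply/eqP => y0; move: xy; rewrite y0 mulr0 => /eqP.
  by rewrite eq_sym oner_eq0.
have pm : Pos (((N y)%:A - y) * x).
  apply: Pos_mul => //; first by apply: Pos_of_nm => //; exact: Pos_sa.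
  apply/commr_sym/commrB; first by apply/commr_sym/comm_alg.
  by rewrite /GRing.comm xy yx.
have := PosZ (_ : 0 <= (N y)^-1) pm; rewrite invr_ge0 nm_ge0 => /(_ isT).
rewrite mulrBl yx mulr_algl scalerBr scalerA mulVf ?gt_eqF // scale1r => h.
have := @Pos_nm_le _ _ _ b (N b - (N y)^-1) pb.
rewrite scalerBl (_ : _ - _ - b = x - (N y)^-1%:A); last by rewrite /x; ncring.
move=> /(_ h); have : 0 < (N y)^-1 by rewrite invr_gt0.
by lra.
Qed.

Lemma has_inv_mul x y : GRing.comm x y -> has_inv (x * y) -> has_inv x.
Proof.
move=> xy [z [h1 h2]]; exists (y * z); split; first by rewrite mulrA.
have zx : GRing.comm z x by apply: (comm_inv h1 h2); rewrite /GRing.comm -mulrA -xy mulrA.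
by rewrite -mulrA zx mulrA -xy.
Qed.

(** For [t = N n] one has [(t - n) (p + t) = t (a + t)]. Invertibility of [a + t] would make
    [N n - n] invertible, which is impossible unless [n = 0]. *)
Lemma Pos_spectral a : st a = a -> (forall t, 0 < t -> has_inv (a + t%:A)) -> Pos a.
Proof.
move=> sa h; have [p [n [[pp pn aE pn0 np0] _]]] := Pos_parts sa.
suff n0 : n = 0 by rewrite aE n0 subr0.
apply/eqP; rewrite -nm_le0 leNgt; apply/negP => nn.
apply: (Pos_nm_spectrum pn nn); set t := N n in nn *.
have E : (t%:A - n) * (p + t%:A) = t *: (a + t%:A).
  rewrite mulrBl !mulrDr np0 !mulr_algl mulr_algr aE scalerDr scalerBr; ncring.
have E' : (p + t%:A) * (t%:A - n) = t *: (a + t%:A).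
  rewrite mulrDl !mulrBr pn0 !mulr_algl mulr_algr aE scalerDr scalerBr; ncring.
apply: (@has_inv_mul _ (p + t%:A)); first by rewrite /GRing.comm E E'.
rewrite E; have [y [h1 h2]] := h t nn.
exists (t^-1 *: y); rewrite -!scalerAl -!scalerAr !scalerA mulfV ?mulVf ?gt_eqF // !scale1r.
by [].
Qed.

(** Let [n] be the negative part of [st z * z] and [x = z * n], so that [st x * x = - n^3]. The
    products [st x * x] and [x * st x] have the same spectrum away from 0, so both are negative,
    while their sum is half a sum of squares of self-adjoint elements. Hence [n^3 = 0]. *)
Lemma Pos_stM z : Pos (st z * z).
Proof.
pose a := st z * z; have sa : st a = a by rewrite /a stM stK.
have [p [n [[pp pn aE pn0 np0] _]]] := Pos_parts sa.
suff n0 : n = 0 by rewrite -/a aE n0 subr0.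
pose x := z * n.
have E : st x * x = - (n * n * n).
  rewrite /x stM (Pos_sa pn) -mulrA [st z * _]mulrA -/a aE mulrBl pn0 sub0r.
  by rewrite mulrN mulrA.
have pnnn : Pos (n * n * n).
  by apply: Pos_mul => //; [apply: Pos_sqr; exact: Pos_sa | rewrite /GRing.comm mulrA].
have pxx : Pos (- (x * st x)).
  apply: Pos_spectral; first by rewrite stN stM stK.
  move=> t t0; have [y [h1 h2 _ _]] := Pos_add_inv pnnn t0.
  rewrite -[n * n * n]opprK -E in h1 h2.
  have k1 : y * (st x * x) = t *: y - 1.
    rewrite -h2 mulrDr mulr_algr mulrN; ncring.
  have k2 : st x * x * y = t *: y - 1.
    rewrite -h1 mulrDl mulr_algl mulNr; ncring.
  (* Jacobson's formula: the inverse of [t - x * st x] from the inverse [y] of [t - st x * x]. *)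
  exists (t^-1 *: (1 + x * y * st x)); rewrite -scalerAr -scalerAl; split.
    rewrite (_ : _ * _ = t%:A) ?scalerA ?mulVf ?gt_eqF ?scale1r //.
    rewrite mulrDr mulr1 [X in _ + X](_ : _ = x * st x); first by ncring.
    rewrite mulrDl mulr_algl mulNr.
    have -> : x * st x * (x * y * st x) = x * (st x * x * y) * st x by ncring.
    rewrite k2 mulrBr mulrBl -!scalerAr -!scalerAl; ncring.
  rewrite (_ : _ * _ = t%:A) ?scalerA ?mulVf ?gt_eqF ?scale1r //.
  rewrite mulrDl mul1r [X in _ + X](_ : _ = x * st x); first by ncring.
  rewrite mulrDr mulr_algr mulrN.
  have -> : x * y * st x * (x * st x) = x * (y * (st x * x)) * st x by ncring.
  rewrite k1 mulrBr mulrBl -!scalerAr -!scalerAl; ncring.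
have xx0 : st x * x = 0.
  apply: Pos_antisym; last by rewrite E opprK.
  (* Up to sign, twice the real and imaginary parts of [x]; hence
     [u^2 + v^2 = 2 (st x * x + x * st x)]. *)
  pose u := x + st x; pose v : T := J S * (x - st x).
  have su : st u = u by rewrite /u stD stK addrC.
  have sv : st v = v.
    by rewrite /v stM st_J stB stK mulrN -mulNr opprB J_comm.
  have vvE : v * v = - ((x - st x) * (x - st x)).
    rewrite /v; set w := x - st x; have jw : J S * w = w * J S by exact: J_comm.
    transitivity (J S * (w * J S) * w); first by ncring.
    rewrite -jw; transitivity (J S * J S * (w * w)); first by ncring.
    by rewrite J_sqr; ncring.
  have uvE : u * u + v * v = (st x * x + st x * x) + (x * st x + x * st x).
    by rewrite vvE /u; ncring.
  apply: Pos_double.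
  have -> : st x * x + st x * x = (u * u + v * v) + (- (x * st x) - x * st x).
    by rewrite uvE; ncring.
  by apply: PosD; apply: PosD => //; apply: Pos_sqr.
have n3 : n * n * n = 0 by apply/eqP; rewrite -oppr_eq0 -E xx0.
have sn := Pos_sa pn.
have n4 : (n * n) * (n * n) = 0 by rewrite mulrA n3 mul0r.
have n2 : n * n = 0.
  apply/eqP; rewrite -nm_le0; apply: nm_sqr_le => //; first by rewrite stM sn.
  by rewrite n4 nm0 expr0n.
apply/eqP; rewrite -nm_le0; apply: nm_sqr_le => //.
by rewrite n2 nm0 expr0n.
Qed.

Lemma Pos_Mst z : Pos (z * st z).
Proof. by rewrite -{1}(stK z); apply: Pos_stM. Qed.

Lemma Pos_conj z b : Pos b -> Pos (z * b * st z).
Proof.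
move=> pb; have [s [ps <- _]] := Pos_sqrt pb.
have -> : z * (s * s) * st z = (z * s) * st (z * s) by rewrite stM (Pos_sa ps) !mulrA.
exact: Pos_Mst.
Qed.

Lemma Pos_conj_sa y b : st y = y -> Pos b -> Pos (y * b * y).
Proof. by move=> sy pb; rewrite -{2}sy; apply: Pos_conj. Qed.
End Decomposition.

(** * Spectral positivity, Cuntz comparison, simplicity, automorphisms *)

Section Interface.
Context {R : realType} {A : completeNormedModType R[i]} {S : ucstar A}.
Local Notation T := (calg S).
Local Notation N := (@nm R A S).
Local Notation st := (@st R A S).
Implicit Types (a b c x y z : T) (r t e : R).

Lemma scale_coneE (l : R[i]) :
  (l *: cone S : A) = (complex.Re l)%:A + complex.Im l *: J S :> T.
Proof. by rewrite (@complex_scale _ _ S) -[cone S]/(1 : T) mulr1. Qed.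

(** Towards [Pos], negative real [l] feed [Pos_spectral]. Conversely, a non-real [l = al + i be] is
    reached through [(b - i be) (b + i be) = b^2 + be^2] with [b = a - al], whose right side is
    invertible. *)
Lemma positiveP a : positive S a <-> Pos a.
Proof.
split=> [[sa h]|pa].
  apply: Pos_spectral => // t t0; have [|y [h1 h2]] := h (- (t%:C)%C).
    by rewrite oppr_ge0 lecR; apply/negP; rewrite -ltNge.
  exists y; move: h1 h2; rewrite scaleNr opprK => h1 h2; split.
    by rewrite -[RHS]h1 -[_ *: cone S]/(t%:A : T).
  by rewrite -[RHS]h2 -[_ *: cone S]/(t%:A : T).
have sa := Pos_sa pa; split => // l hl.
suff [y [h1 h2]] : has_inv (a - ((complex.Re l)%:A + complex.Im l *: J S)).
  by exists y; rewrite -scale_coneE in h1 h2; split.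
case: l hl => al be /= hl.
have [b0|b0] := eqVneq be 0.
  have al0 : 0 < - al.
    rewrite oppr_gt0 ltNge; apply/negP => al0; apply: hl.
    by rewrite b0 lecE /= eqxx al0.
  have [y [h1 h2 _ _]] := Pos_add_inv pa al0.
  by exists y; rewrite b0 scale0r addr0 -scaleNr.
set b := a - al%:A; have sb : st b = b by rewrite stB st_alg sa.
have -> : a - (al%:A + be *: J S) = b - be *: J S by rewrite opprD addrA.
have Jb : J S * b = b * J S by exact: J_comm.
clearbody b.
have b2 : 0 < be ^+ 2 by rewrite exprn_even_gt0.
have [y [h1 h2 _ _]] := Pos_add_inv (Pos_sqr sb) b2.
have E : (b - be *: J S) * (b + be *: J S) = b * b + (be ^+ 2)%:A.
  rewrite mulrBl !mulrDr -!scalerAl -!scalerAr scalerA J_sqr scalerN Jb expr2; ncring.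
have E' : (b + be *: J S) * (b - be *: J S) = b * b + (be ^+ 2)%:A.
  rewrite mulrDl !mulrBr -!scalerAl -!scalerAr scalerA J_sqr scalerN Jb expr2; ncring.
by apply: (@has_inv_mul _ _ _ _ (b + be *: J S)); [rewrite /GRing.comm E E' | exists y; rewrite E].
Qed.

Lemma complex_gt0 (e : R[i]) : 0 < e -> 0 < complex.Re e /\ e = ((complex.Re e)%:C)%C.
Proof. by case: (e) => u v; rewrite ltcE /= => /andP[/eqP -> ->]. Qed.

Lemma norm_lt_complex x (e : R[i]) : 0 < e -> (`|x : A| < e) = (N x < complex.Re e).
Proof. by move=> /complex_gt0[_ {1}->]; rewrite nmE ltcR. Qed.

Lemma cuntz_leP a b : (forall e, 0 < e -> exists v, N (a - v * b * st v) < e) ->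
  cuntz_le S a b.
Proof.
move=> h; have h' n : exists v, N (a - v * b * st v) < n.+1%:R^-1.
  by apply: h; rewrite invr_gt0 ltr0n.
have [v hv] := choice h'; exists v => e /[dup] e0 /complex_gt0[er _].
have [n hn] := inv_small 1 er; exists n.+1 => m nm.
rewrite norm_lt_complex // (_ : cmul S _ _ = v m * b * st (v m)); last by rewrite -mulrA.
apply: lt_le_trans (hv m) _; apply: le_trans hn; rewrite div1r.
by rewrite lef_pV2 ?posrE ?ltr0n // ler_nat.
Qed.

Lemma cuntz_leE a b e : cuntz_le S a b -> 0 < e -> exists v, N (a - v * b * st v) < e.
Proof.
move=> [v hv] e0; have [|n hn] := hv (e%:C)%C; first by rewrite ltcR.
exists (v n : T); have := hn n (leqnn n); rewrite norm_lt_complex ?ltcR //.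
by rewrite (_ : cmul S _ _ = (v n : T) * b * st (v n)) // -mulrA.
Qed.

(** The algebraic ideal generated by [y] is dense, so it has an element within 1 of the unit. That
    element is invertible, and multiplying by its inverse stays in the ideal, which gives an exact
    finite sum. *)
Lemma simple_full y : simple_cstar S -> y != 0 ->
  exists s : seq (T * T), \sum_(p <- s) p.1 * y * p.2 = 1.
Proof.
move=> simp y0.
pose I0 : set A := [set x : A | exists s : seq (T * T), x = \sum_(p <- s) p.1 * y * p.2 :> T].
have cI : closed_ideal S (closure I0).
  split; last exact: closed_closure.
  - by apply: subset_closure; exists [::]; rewrite big_nil.
  - move=> k x z /(@closureP _ _ S) hx /(@closureP _ _ S) hz; apply/(@closureP _ _ S) => e e0.
    (* Turns the complex scalar into left multiplication, which the real algebra can express. *)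
    pose K : T := k *: cone S.
    have KE (u : A) : k *: u = K * u :> T.
      by rewrite /K /GRing.mul /= cmulZl cmul1l.
    have c0 : 0 < N K + 1 by rewrite ltr_wpDl ?nm_ge0.
    have e'0 : 0 < e / 2 / (N K + 1) by rewrite !divr_gt0.
    have e2 : 0 < e / 2 by rewrite divr_gt0.
    have [x' [s sE] hx'] := hx _ e'0; have [z' [s' sE'] hz'] := hz _ e2.
    exists (K * x' + z').
      exists ([seq (K * p.1, p.2) | p <- s] ++ s').
      rewrite big_cat big_map /= -sE' sE mulr_sumr; congr (_ + _).
      by apply: eq_bigr => p _; rewrite !mulrA.
    rewrite -/(K * x' + z') KE.
    have -> : K * (x : T) + z - (K * x' + z') = K * ((x : T) - x') + ((z : T) - z') by ncring.
    rewrite [e]splitr; apply: le_lt_trans (nmD _ _) _; apply: ltr_leD; last exact: ltW.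
    apply: le_lt_trans (nmM _ _) _.
    apply: (@le_lt_trans _ _ ((N K + 1) * N ((x : T) - x'))).
      by rewrite ler_wpM2r ?nm_ge0 // lerDl.
    by rewrite -ltr_pdivlMl // mulrC.
  - move=> a x /(@closureP _ _ S) hx; split; apply/(@closureP _ _ S) => e e0.
      have c0 : 0 < N a + 1 by rewrite ltr_wpDl ?nm_ge0.
      have [x' [s sE] hx'] := hx _ (divr_gt0 e0 c0).
      exists ((a : T) * x').
        exists [seq ((a : T) * p.1, p.2) | p <- s].
        by rewrite big_map /= sE mulr_sumr; apply: eq_bigr => p _; rewrite !mulrA.
      rewrite -[cmul S a x]/((a : T) * x) -mulrBr; apply: le_lt_trans (nmM _ _) _.
      apply: (@le_lt_trans _ _ ((N a + 1) * N ((x : T) - x'))).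
        by rewrite ler_wpM2r ?nm_ge0 // lerDl.
      by rewrite -ltr_pdivlMl // mulrC.
    have c0 : 0 < N a + 1 by rewrite ltr_wpDl ?nm_ge0.
    have [x' [s sE] hx'] := hx _ (divr_gt0 e0 c0).
    exists (x' * (a : T)).
      exists [seq (p.1, p.2 * (a : T)) | p <- s].
      by rewrite big_map /= sE mulr_suml; apply: eq_bigr => p _; rewrite !mulrA.
    rewrite -[cmul S x a]/((x : T) * a) -mulrBl; apply: le_lt_trans (nmM _ _) _.
    apply: (@le_lt_trans _ _ (N ((x : T) - x') * (N a + 1))).
      by rewrite ler_wpM2l ?nm_ge0 // lerDl.
    by rewrite -ltr_pdivlMr.
have Iy : closure I0 y.
  by apply: subset_closure; exists [:: (1, 1)]; rewrite big_seq1 mulr1 mul1r.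
have [I00|IT] := simp _ cI.
  by move: Iy; rewrite I00 => /= yE; move: y0; rewrite -nm_eq0 yE nm0 eqxx.
have : closure I0 (1 : T) by rewrite IT.
move=> /(@closureP _ _ S)/(_ 1 ltr01) [x [s sE] hx].
have [y' [h1 h2 _]] := neumann (lexx _) hx.
exists [seq (p.1, p.2 * y') | p <- s].
rewrite -[RHS]h1 opprB addrC subrK sE mulr_suml big_map.
by apply: eq_bigr => p _; rewrite !mulrA.
Qed.

Section Aut.
Variable f : T -> T.
Hypothesis hf : star_automorphism S f.
Lemma autD x y : f (x + y) = f x + f y.
Proof. by case: hf => _ h _ _ _; have := h 1 x y; rewrite !scale1r. Qed.
Lemma aut0 : f 0 = 0.
Proof. by apply: (addrI (f 0)); rewrite -autD !addr0. Qed.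
Lemma autN x : f (- x) = - f x.
Proof. by apply: (addrI (f x)); rewrite -autD !subrr aut0. Qed.
Lemma autB x y : f (x - y) = f x - f y.
Proof. by rewrite autD autN. Qed.
Lemma autM x y : f (x * y) = f x * f y.
Proof. by case: hf => _ _ h _ _; exact: h. Qed.
Lemma aut_st x : f (st x) = st (f x).
Proof. by case: hf => _ _ _ h _; exact: h. Qed.
Lemma aut1 : f 1 = 1.
Proof. by case: hf. Qed.
Lemma autZ r x : f (r *: x) = r *: f x.
Proof.
case: hf => _ h _ _ _; have := h (r%:C)%C x 0.
by rewrite -[f 0]/(f (0 : T)) aut0 !addr0.
Qed.
Lemma aut_alg r : f r%:A = r%:A.
Proof. by rewrite autZ aut1. Qed.
Lemma aut_Pos a : Pos a -> Pos (f a).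
Proof.
move=> pa; have [s [ps <- _]] := Pos_sqrt pa.
by rewrite autM; apply: Pos_sqr; rewrite -aut_st (Pos_sa ps).
Qed.
(** Positivity is preserved, so [N x ^ 2 - st x * x >= 0] is carried to a bound for
    [st (f x) * f x]. *)
Lemma aut_nm_le x : N (f x) <= N x.
Proof.
rewrite -(ler_pXn2r (n := 2)) ?nnegrE ?nm_ge0 // -!nm_stM -aut_st -autM.
apply: Pos_nm_le; first by apply: aut_Pos; apply: Pos_stM.
rewrite -aut_alg -autB; apply: aut_Pos; apply: Pos_of_nm => //.
by rewrite stM stK.
Qed.
End Aut.
End Interface.

(** * Projections *)

Section Projections.
Context {R : realType} {A : completeNormedModType R[i]} {S : ucstar A}.
Local Notation T := (calg S).
Local Notation N := (@nm R A S).
Local Notation st := (@st R A S).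
Implicit Types (a b c k m p q x y z : T) (r t e : R).

Definition cm x y : T := x * y - y * x.

Lemma cmMl x y z : cm (x * y) z = x * cm y z + cm x z * y.
Proof. by rewrite /cm; ncring. Qed.
Lemma cmDl x y z : cm (x + y) z = cm x z + cm y z.
Proof. by rewrite /cm; ncring. Qed.
Lemma cmNl x z : cm (- x) z = - cm x z.
Proof. by rewrite /cm; ncring. Qed.
Lemma cmZl r x z : cm (r *: x) z = r *: cm x z.
Proof. by rewrite /cm -scalerAl -scalerAr scalerBr. Qed.
Lemma cm1l z : cm 1 z = 0.
Proof. by rewrite /cm; ncring. Qed.
Lemma cm_algl r z : cm r%:A z = 0.
Proof. by rewrite cmZl cm1l scaler0. Qed.
Lemma cm_inv x y z : x * y = 1 -> y * x = 1 -> cm y z = - (y * cm x z * y).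
Proof.
move=> xy yx; rewrite /cm mulrBr mulrBl !mulrA yx mul1r -[y * z * x * y]mulrA xy mulr1.
by rewrite opprB.
Qed.
Lemma nm_cm_inv x y z r : x * y = 1 -> y * x = 1 -> N y <= r -> N (cm y z) <= r * N (cm x z) * r.
Proof. by move=> xy yx yr; rewrite (cm_inv _ xy yx) nmN; apply: nmM2 => //; apply: nmM2. Qed.
Lemma nm_cmM x y z r t u v : N x <= r -> N y <= t -> N (cm x z) <= u -> N (cm y z) <= v ->
  N (cm (x * y) z) <= r * v + u * t.
Proof. by move=> *; rewrite cmMl; apply: nmD2; apply: nmM2. Qed.
Lemma nm_cm_sub x y z : N (cm x z) <= N (cm y z) + N (x - y) * (2 * N z).
Proof.
have -> : cm x z = cm y z + ((x - y) * z - z * (x - y)) by rewrite /cm; ncring.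
apply: nmD2 => //.
have -> : N (x - y) * (2 * N z) = N (x - y) * N z + N z * N (x - y) by ring.
by apply: nmB2; apply: nmM2.
Qed.

Definition proj p := st p = p /\ p * p = p.

Lemma proj_nm p : proj p -> N p <= 1.
Proof.
move=> [sp pp]; have [->|p0] := eqVneq p 0; first by rewrite nm0.
have h := nm_stM p; rewrite sp pp expr2 in h.
have n0 : 0 < N p by rewrite nm_gt0.
by rewrite -(ler_pM2r n0) mul1r -h.
Qed.
Lemma proj_Pos p : proj p -> Pos p.
Proof. by move=> [sp pp]; rewrite -pp; apply: Pos_sqr. Qed.
Lemma projC p : proj p -> proj (1 - p).
Proof.
move=> [sp pp]; split; first by rewrite stB st1 sp.
by rewrite mulrBl !mulrBr pp; ncring.
Qed.
Lemma proj_nm1 p : proj p -> p != 0 -> N p = 1.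
Proof.
move=> [sp pp] p0; have h := nm_stM p; rewrite sp pp expr2 in h.
have n0 : N p != 0 by rewrite nm_eq0.
by apply: (mulfI n0); rewrite -h mulr1.
Qed.

(** The projection is [p = (1 + s) / 2] with [s = |y| y^-1] the sign of [y]. The point is that [C]
    depends only on [M], [L] and [e]: replacing the limit inside [|y|] by its [n]-th iterate costs a
    multiple of [1/n], and commutators with that iterate grow at most like [n]. *)
Lemma spectral_projection (M L e : R) : 0 < M -> 0 < L -> 0 < e -> exists2 C : R, 0 <= C &
  forall y yi, st y = y -> y * yi = 1 -> yi * y = 1 -> N y <= M -> N yi <= L ->
  exists p, [/\ proj p, GRing.comm y p, Pos (y * p), Pos (- (y * (1 - p))) &
    forall z, N (cm p z) <= e * N z + C * N (cm y z)].
Proof.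
move=> M0 L0 e0.
have [n hn] := inv_small (2 * M * L) e0.
(* For [s = m * yi]: [2 M L^2] comes from the commutator of the inverse, [2 n L] from that of the
   iterate inside [m]; the half is the one in [p]. *)
exists (2^-1 * (2 * M * L ^+ 2 + 2 * n%:R * L)).
  by rewrite !(mulr_ge0, addr_ge0, exprn_ge0, invr_ge0) // ltW.
move=> y yi sy xy yx yM yiL.
pose b : T := 1 - (M ^- 2) *: (y * y).
have b1 : N b <= 1.
  have -> : b = M ^- 2 *: ((M ^+ 2)%:A - y * y).
    by rewrite scalerBr scalerA mulVf ?expf_neq0 ?gt_eqF // scale1r.
  rewrite nmZ gtr0_norm ?invr_gt0 ?exprn_gt0 // ler_pdivrMl ?exprn_gt0 // mulr1.
  by apply: nm_sub_sqr => //; exact: ltW.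
have [u [uE u1 hu]] := sqrt_lim b1.
have su : st u = u by apply: (sqrt_lim_sa hu); rewrite stB st1 stZ stM sy.
have uc z : GRing.comm y z -> GRing.comm u z.
  move=> yz; apply: (sqrt_lim_comm hu); apply/commr_sym/commrB; first exact: commr1.
  apply/commr_sym; rewrite /GRing.comm -scalerAl -scalerAr; congr (_ *: _).
  by apply/commr_sym/commrM; apply/commr_sym.
pose m := M *: (1 - u).
have sm : st m = m by rewrite stZ stB st1 su.
have pm : Pos m.
  by rewrite /m scalerBr; apply: Pos_of_nm; rewrite ?stZ ?su // nmZ gtr0_norm // ler_piMr // ltW.
have mE : m * m = y * y.
  rewrite /m -scalerAl -scalerAr scalerA.
  have -> : (1 - u) * (1 - u) = 1 - (u + u) + u * u by ncring.
  have -> : 1 - (u + u) + u * u = M ^- 2 *: (y * y) by rewrite uE /b; ncring.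
  by rewrite scalerA -expr2 mulfV ?expf_neq0 ?gt_eqF // scale1r.
have mc z : GRing.comm y z -> GRing.comm m z.
  move=> yz; rewrite /GRing.comm /m -scalerAl -scalerAr; congr (_ *: _).
  by apply/commr_sym/commrB; [exact: commr1 | apply/commr_sym/uc].
have my := mc y (commr_refl y).
have yyi : GRing.comm y yi by rewrite /GRing.comm xy yx.
have myi := mc yi yyi.
pose s := m * yi.
have ss : s * s = 1.
  rewrite /s -mulrA [yi * _]mulrA -myi !mulrA mE -[y * y * yi]mulrA xy mulr1 xy //.
have sts : st s = s by rewrite /s stM sm (inv_sa xy yx sy) myi.
have ys : y * s = m by rewrite /s mulrA -my -mulrA xy mulr1.
pose p := 2^-1 *: (1 + s).
have yp : y * p = 2^-1 *: (m + y) by rewrite /p -scalerAr mulrDr mulr1 ys addrC.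
have pE : 1 - p = 2^-1 *: (1 - s).
  by rewrite /p -[X in X - _]half_addr -scalerDr -scalerBr; congr (_ *: _); ncring.
have yq : - (y * (1 - p)) = 2^-1 *: (m - y).
  by rewrite pE -scalerAr mulrBr mulr1 ys -scalerN opprB.
exists p; split.
- split; first by rewrite stZ stD st1 sts.
  have xx : (1 + s) * (1 + s) = (1 + s) + (1 + s) by rewrite mulrDl !mulrDr ss; ncring.
  by rewrite /p -scalerAl -scalerAr xx scalerDr half_addr.
- have ysc : GRing.comm y s by apply: commrM => //; apply/commr_sym.
  by rewrite /GRing.comm /p -scalerAl -scalerAr mulrDl mulrDr ysc mulr1 mul1r.
- by rewrite yp; apply: PosZ; rewrite ?invr_ge0 //; apply: Pos_abs_add.
- rewrite yq; apply: PosZ; rewrite ?invr_ge0 //; apply: Pos_abs_add => //.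
  + by rewrite stN sy.
  + by rewrite mulrNN.
  + exact: commrN.
move=> z; set dl := N (cm y z); set nz := N z.
have z0 : 0 <= nz by exact: nm_ge0. have d0 : 0 <= dl by exact: nm_ge0.
have c1 : N (cm yi z) <= L * dl * L by exact: nm_cm_inv.
have c2 : N (cm b z) <= 2 / M * dl.
  rewrite cmDl cm1l add0r cmNl nmN cmZl nmZ gtr0_norm ?invr_gt0 ?exprn_gt0 //.
  rewrite ler_pdivrMl ?exprn_gt0 //.
  have -> : M ^+ 2 * (2 / M * dl) = M * dl + dl * M by field; rewrite gt_eqF.
  exact: nm_cmM.
have c3 : N (cm u z) <= 4 / n.+2%:R * nz + n%:R * (2 / M * dl).
  have := nm_cm_sub u (sqrt_it b n) z; rewrite nmBC.
  have := @sqrt_it_commutator _ _ _ b n z b1; rewrite -/(cm _ _) -/(cm _ _) => h1 h2.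
  apply: le_trans h2 _; rewrite addrC; apply: lerD.
    have -> : 4 / n.+2%:R * nz = 2 / n.+2%:R * (2 * nz) by ring.
    by apply: ler_wpM2r; rewrite ?mulr_ge0.
  by apply: le_trans h1 _; rewrite ler_wpM2l.
have mM : N m <= 2 * M.
  rewrite nmZ gtr0_norm // mulrC ler_pM2r // (_ : 2 = 1 + 1 :> R) //.
  by apply: nmB2; rewrite ?nm1.
have c4 : N (cm m z) <= M * (4 / n.+2%:R * nz + n%:R * (2 / M * dl)).
  by rewrite cmZl cmDl cm1l add0r cmNl nmZ nmN gtr0_norm // ler_pM2l.
have c5 : N (cm s z) <= 2 * M * (L * dl * L) + M * (4 / n.+2%:R * nz + n%:R * (2 / M * dl)) * L.
  exact: nm_cmM.
rewrite cmZl cmDl cm1l add0r nmZ gtr0_norm ?invr_gt0 // ler_pdivrMl //.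
apply: le_trans c5 _.
have -> : M * (4 / n.+2%:R * nz + n%:R * (2 / M * dl)) * L =
   2 * (2 * M * L / n.+2%:R) * nz + 2 * n%:R * L * dl.
  move: (n.+2%:R^-1) => w0; field; exact: lt0r_neq0.
have h : 2 * M * L / n.+2%:R * nz <= e * nz by rewrite ler_wpM2r.
move: h; move: (n.+2%:R^-1) => w0 h; rewrite expr2; lra.
Qed.

(** The corner [p k^2 p] is padded by [t (1 - p)] to an [X] invertible in the whole algebra, so that
    commutators of its inverse are controlled. As [X = (y p + t) - p E p] with [y p >= 0] and
    [N E <= t/2], a Neumann series costs a factor 2 over the bound [1/t]. *)
Lemma projection_step (M L t e : R) : 0 < M -> 0 < L -> 0 < t -> 0 < e -> exists2 C : R, 0 <= C &
  forall k y yi, st k = k -> N k <= 1 ->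
  st y = y -> y * yi = 1 -> yi * y = 1 -> N y <= M -> N yi <= L ->
  N (y - (k * k - t%:A)) <= t / 2 ->
  exists q m, [/\ proj q, q = k * m * k, N m <= 2 / t, N ((1 - q) * k) ^+ 2 <= 2 * t &
    forall z, N (cm q z) <= e * N z + C * (N (cm k z) + N (cm y z))].
Proof.
move=> M0 L0 t0 e0.
pose c1 := 4 / t + 8 / t ^+ 2; pose c2 := 4 / t + 4 / t ^+ 2 * (2 + t).
have c10 : 0 <= c1 by rewrite !(addr_ge0, divr_ge0, exprn_ge0) // ltW.
have c20 : 0 < c2 by rewrite addr_gt0 ?mulr_gt0 ?addr_gt0 ?invr_gt0 ?exprn_gt0.
have [C C0 hC] := spectral_projection M0 L0 (divr_gt0 e0 c20).
exists (c1 + c2 * C); first by rewrite addr_ge0 // mulr_ge0 // ltW.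
move=> k y yi sk k1 sy xy yx yM yiL; set E := y - _ => hE.
have [p [pp yp pyp pyq hp]] := hC y yi sy xy yx yM yiL.
have p1 := proj_nm pp; have q1 := proj_nm (projC pp); have [sp pE] := pp.
have kkE : k * k = y + t%:A - E by rewrite /E; ncring.
have [w [w1 w2 pw wN]] := Pos_add_inv pyp t0.
pose X := p * (k * k) * p + t *: (1 - p).
have XE : X = (y * p + t%:A) * (1 - w * (p * E * p)).
  transitivity ((y * p + t%:A) - ((y * p + t%:A) * w) * (p * E * p)); last by ncring.
  rewrite w1 mul1r /X kkE scalerBr.
  have -> : p * (y + t%:A - E) * p = p * y * p + p * t%:A * p - p * E * p by ncring.
  rewrite -yp -mulrA pE mulr_algr -scalerAl pE; ncring.
have hw : N (w * (p * E * p)) <= 2^-1.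
  have -> : 2^-1 = t^-1 * (1 * (t / 2) * 1) by field; rewrite gt_eqF.
  by apply: nmM2 => //; apply: nmM2 => //; apply: nmM2.
have [|v [v1 v2 vN]] := neumann hw.
  by rewrite invf_lt1 // ltr1n.
pose Xi := v * w.
have X1 : X * Xi = 1.
  by rewrite XE /Xi mulrA -[_ * _ * v]mulrA v1 mulr1.
have X2 : Xi * X = 1.
  by rewrite XE /Xi -mulrA [w * _]mulrA w2 mul1r.
have XiN : N Xi <= 2 / t.
  by apply: nmM2 => //; apply: le_trans vN _; rewrite (_ : (1 - 2^-1)^-1 = 2 :> R) //; field.
clearbody Xi.
have pX : p * X = p * (k * k) * p.
  rewrite /X mulrDr -scalerAr mulrBr mulr1 pE subrr scaler0 addr0.
  by rewrite !mulrA pE.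
have Xp : X * p = p * (k * k) * p.
  rewrite /X mulrDl -scalerAl mulrBl mul1r pE subrr scaler0 addr0.
  by rewrite -!mulrA pE.
have Xip : GRing.comm Xi p by apply: (comm_inv X1 X2); rewrite /GRing.comm pX Xp.
pose m := p * Xi * p; pose q := k * m * k.
(* [m] inverts [k^2] in the corner of [p]; this identity makes [k m k] idempotent. *)
have mkkm : m * (k * k) * m = m.
  have -> : m * (k * k) * m = p * Xi * (p * (k * k) * p) * Xi * p by rewrite /m; ncring.
  rewrite -Xp /m.
  have -> : p * Xi * (X * p) * Xi * p = p * (Xi * X) * (p * Xi) * p by ncring.
  by rewrite X2 mulr1 mulrA pE.
have sX : st X = X.
  by rewrite /X stD stZ !stM stB st1 sp sk !mulrA.
have sXi := inv_sa X1 X2 sX.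
have smm : st m = m by rewrite /m !stM sp sXi mulrA.
have pq : proj q.
  split; first by rewrite /q stM [st (k * m)]stM smm sk mulrA.
  have -> : q * q = k * (m * (k * k) * m) * k by rewrite /q; ncring.
  by rewrite mkkm.
have qkp : q * k * p = k * p.
  have -> : q * k * p = k * p * Xi * (p * (k * k) * p) by rewrite /q /m; ncring.
  rewrite -Xp; have -> : k * p * Xi * (X * p) = k * p * (Xi * X) * p by ncring.
  by rewrite X2 mulr1 -mulrA pE.
have mN : N m <= 2 / t.
  have -> : 2 / t = 1 * (2 / t) * 1 by ring.
  by apply: nmM2 => //; apply: nmM2.
exists q, m; split => //.
(* Since [q] fixes [k p], only [k (1 - p)] survives. As [y (1 - p) <= 0], its square
   [(1 - p) k^2 (1 - p)] is at most [t (1 - p) - (1 - p) E (1 - p)], of norm at most [3t/2]. *)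
- have -> : (1 - q) * k = (1 - q) * (k * (1 - p)).
    transitivity (k - q * k - k * p + k * p); first by ncring.
    by rewrite -{2}qkp; ncring.
  have h1 : N ((1 - q) * (k * (1 - p))) <= N (k * (1 - p)).
    by rewrite -[leRHS]mul1r; apply: nmM2 => //; exact: proj_nm (projC pq).
  apply: (@le_trans _ _ (N (k * (1 - p)) ^+ 2)).
    by apply: lerXn2r; rewrite ?nnegrE ?nm_ge0.
  have sq : st (1 - p) = 1 - p by rewrite stB st1 sp.
  rewrite -nm_stM stM sk sq.
  have qE : (1 - p) * (1 - p) = 1 - p by case: (projC pp).
  have yq : GRing.comm y (1 - p) by apply: commrB; [exact: commr1 |].
  have aE : (1 - p) * k * (k * (1 - p)) - y * (1 - p) = t *: (1 - p) - (1 - p) * E * (1 - p).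
    transitivity ((1 - p) * (k * k) * (1 - p) - y * (1 - p)); first by ncring.
    rewrite kkE; transitivity (((1 - p) * y) * (1 - p) + (1 - p) * t%:A * (1 - p) - (1 - p) * E * (1 - p) - y * (1 - p)).
      by ncring.
    have e1 : (1 - p) * y * (1 - p) = y * (1 - p) by rewrite -yq -mulrA qE.
    have e2 : (1 - p) * t%:A * (1 - p) = t *: (1 - p) by rewrite mulr_algr -scalerAl qE.
    by rewrite e1 e2; ncring.
  apply: (@le_trans _ _ (N (t *: (1 - p) - (1 - p) * E * (1 - p)))).
    apply: Pos_le_nm; last by rewrite -aE addrC addrA addNr add0r.
    by have := Pos_stM (k * (1 - p)); rewrite stM sk sq.
  apply: (@le_trans _ _ (t * 1 + 1 * (t / 2) * 1)); last lra.
  apply: nmB2; first by rewrite nmZ gtr0_norm // ler_pM2l.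
  by apply: nmM2 => //; apply: nmM2.
move=> z; set dk := N (cm k z); set dy := N (cm y z); set nz := N z.
have z0 : 0 <= nz by exact: nm_ge0. have dk0 : 0 <= dk by exact: nm_ge0.
have dy0 : 0 <= dy by exact: nm_ge0.
set dp := N (cm p z); have dp0 : 0 <= dp by exact: nm_ge0.
have kk1 : N (k * k) <= 1 by rewrite -[leRHS]mulr1; apply: nmM2.
have cX : N (cm X z) <= 2 * dk + (2 + t) * dp.
  rewrite cmDl; apply: (@le_trans _ _ ((1 * 1) * dp + (1 * (1 * dk + dk * 1) + dp * 1) * 1 + t * dp)); last lra.
  apply: nmD2.
    apply: nm_cmM => //; first by apply: nmM2.
    by apply: nm_cmM => //; apply: nm_cmM.
  by rewrite cmZl cmDl cm1l add0r cmNl nmZ nmN gtr0_norm.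
have cXi : N (cm Xi z) <= 2 / t * (2 * dk + (2 + t) * dp) * (2 / t).
  apply: le_trans (nm_cm_inv _ X1 X2 XiN) _.
  have t2 : 0 < 2 / t by rewrite divr_gt0.
  by rewrite ler_pM2r // ler_pM2l.
have cq : N (cm q z) <= c1 * dk + c2 * dp.
  apply: (@le_trans _ _ (1 * (2 / t) * dk + (1 * ((1 * (2 / t)) * dp + (1 * (2 / t * (2 * dk + (2 + t) * dp) * (2 / t)) + dp * (2 / t)) * 1) + dk * (2 / t)) * 1)).
    apply: nm_cmM => //; first by apply: nmM2.
    apply: nm_cmM => //.
    apply: nm_cmM => //; first by apply: nmM2.
    exact: nm_cmM.
  rewrite le_eqVlt; apply/orP; left; apply/eqP; rewrite /c1 /c2; field; rewrite gt_eqF //.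
apply: le_trans cq _.
apply: (@le_trans _ _ (c1 * dk + c2 * (e / c2 * nz + C * dy))).
  by rewrite lerD2l ler_pM2l //; exact: hp.
have -> : c1 * dk + c2 * (e / c2 * nz + C * dy) = e * nz + c1 * dk + c2 * C * dy.
  by field; rewrite gt_eqF.
have h1 : 0 <= c1 * dy by rewrite mulr_ge0.
have h2 : 0 <= c2 * C * dk by rewrite !mulr_ge0 // ltW.
move: h1 h2; clearbody c1 c2 dk dy nz dp; clear; move=> h1 h2; lra.
Qed.
End Projections.

(** * Perturbation of projections and comparison with positive elements *)

Section Comparison.
Context {R : realType} {A : completeNormedModType R[i]} {S : ucstar A}.
Local Notation T := (calg S).
Local Notation N := (@nm R A S).
Local Notation st := (@st R A S).
Implicit Types (a b d m p q x y z : T) (r t e : R).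

(** The new [p] is the range projection of [(1 - Q) q], obtained by inverting
    [q (1 - Q) q = (1 - w) q] in the corner of [q]. The norm of [w] is that of [Q q] squared, hence
    at most [e/2]; the total error is at most [2e/3 + 3e]. *)
Lemma orthogonalize_step (Q q : T) (e : R) : proj Q -> proj q -> N (Q * q) <= e -> e <= 2^-1 ->
  exists p, [/\ proj p, Q * p = 0 & N (p - q) <= 4 * e].
Proof.
move=> pQ pq hQq e2; have [sQ QQ] := pQ; have [sq qq] := pq.
have e0 : 0 <= e := le_trans (nm_ge0 _) hQq.
have q1 := proj_nm pq; have Q1 := proj_nm pQ; have QC1 := proj_nm (projC pQ).
set w := q * Q * q.
have wN : N w <= e / 2.
  have -> : w = st (Q * q) * (Q * q).
    by rewrite stM sq sQ; transitivity (q * (Q * Q) * q); [rewrite QQ | ncring].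
  rewrite nm_stM expr2; apply: ler_pM; rewrite ?nm_ge0 //; exact: le_trans e2.
have w4 : N w <= 4^-1 by apply: le_trans wN _; lra.
have [|Xi [X1 X2 XiN]] := neumann w4; first by rewrite invf_lt1 // ltr1n.
have qw : q * w = w by rewrite /w !mulrA qq.
have wq : w * q = w by rewrite /w -!mulrA qq.
have sw : st w = w by rewrite /w !stM sq sQ mulrA.
have qCq : q * (1 - Q) * (1 - Q) * q = (1 - w) * q.
  transitivity (q * q - q * Q * q - q * Q * q + q * (Q * Q) * q); first by ncring.
  by rewrite qq QQ mulrBl mul1r wq /w; ncring.
clearbody w.
have sXi : st Xi = Xi by apply: (inv_sa X1 X2); rewrite stB st1 sw.
have Xiq : GRing.comm Xi q.
  by apply: (comm_inv X1 X2); rewrite /GRing.comm mulrBl mulrBr wq qw mulr1 mul1r.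
have QC : Q * (1 - Q) = 0 by rewrite mulrBr mulr1 QQ subrr.
exists ((1 - Q) * q * Xi * q * (1 - Q)); split.
- split; first by rewrite !stM stB st1 sQ sq sXi !mulrA.
  have -> : (1 - Q) * q * Xi * q * (1 - Q) * ((1 - Q) * q * Xi * q * (1 - Q)) =
    (1 - Q) * q * (Xi * (q * (1 - Q) * (1 - Q) * q) * Xi * q * (1 - Q)) by ncring.
  have h : Xi * ((1 - w) * q) = q by rewrite mulrA X2 mul1r.
  by rewrite qCq h; transitivity ((1 - Q) * (q * q) * Xi * q * (1 - Q)); [ncring | rewrite qq].
- by rewrite !mulrA QC !mul0r.
have XiB : N (Xi - 1) <= 2 / 3 * e.
  have -> : Xi - 1 = Xi * w by rewrite -{1}X2 mulrBr; ncring.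
  apply: le_trans (nmM2 XiN wN) _.
  have -> : (1 - 4^-1)^-1 = 4 / 3 :> R by field.
  lra.
have hqQ : N (q * Q) <= e by rewrite -nm_adj stM sq sQ.
have -> : (1 - Q) * q * Xi * q * (1 - Q) - q =
   ((1 - Q) * q * (Xi - 1) * q * (1 - Q)) - (Q * q + q * Q - Q * q * Q).
  transitivity ((1 - Q) * q * (Xi - 1) * q * (1 - Q) + (1 - Q) * (q * q) * (1 - Q) - q); first by ncring.
  by rewrite qq; ncring.
apply: (@le_trans _ _ (1 * 1 * (2 / 3 * e) * 1 * 1 + (e + e + e * 1))); last lra.
apply: nmB2; last by apply: nmB2; [apply: nmD2 | apply: nmM2].
by do 4?[apply: nmM2 => //].
Qed.

(** Gram-Schmidt for projections: the new one is made orthogonal to the sum [Q] of the others. The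
    threshold [t] depends on [e] and the index list alone, so it can be fixed before the projections
    are found. *)
Lemma orthogonalize (I : eqType) (s : seq I) e : 0 < e -> uniq s -> exists2 t, 0 < t &
  forall P : I -> T, {in s, forall i, proj (P i)} ->
    {in s &, forall i j, i != j -> N (P i * P j) <= t} ->
  exists E : I -> T, {in s, forall i, proj (E i) /\ N (E i - P i) <= e} /\
    {in s &, forall i j, i != j -> E i * E j = 0}.
Proof.
elim: s e => [|i s ih] e e0 /=.
  by move=> _; exists 1 => // P _ _; exists P; split.
move=> /andP[nis us].
pose m : R := (size s)%:R + 1; have m0 : 0 < m by rewrite ltr_wpDl.
(* [Q * P i] will have norm at most [2 m e1]. The three bounds are for the [E j] already built, for
   the condition [<= 1/2] of the step, and for its loss factor 4. *)
pose e1 := Num.min e (Num.min (2^-1) (e / 4)) / (2 * m).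
have e10 : 0 < e1.
  by rewrite divr_gt0 ?mulr_gt0 // !lt_min e0 invr_gt0 ltr0n divr_gt0.
have e1E : 2 * m * e1 = Num.min e (Num.min (2^-1) (e / 4)).
  by rewrite /e1 mulrC divfK // mulf_neq0 // gt_eqF.
have b1 : 2 * m * e1 <= e by rewrite e1E ge_min lexx.
have b2 : 2 * m * e1 <= 2^-1 by rewrite e1E !ge_min lexx !orbT.
have b3 : 2 * m * e1 <= e / 4 by rewrite e1E !ge_min lexx !orbT.
have m1 : 1 <= m by rewrite lerDr.
have e1e : e1 <= e by nra.
have [t t0 ht] := ih e1 e10 us.
exists (Num.min t e1); first by rewrite lt_min t0.
move=> P pP hP.
have [||E [hE oE]] := ht P.
- by move=> j js; apply: pP; rewrite inE js orbT.
- move=> j k js ks jk; have : N (P j * P k) <= Num.min t e1 by apply: hP; rewrite ?inE ?js ?ks ?orbT.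
  by move=> h; apply: le_trans h _; rewrite ge_min lexx.
pose Q := \sum_(j <- s) E j.
have EQ j : j \in s -> E j * Q = E j.
  move=> js; rewrite /Q mulr_sumr (bigD1_seq j) //= (proj2 (proj1 (hE j js))).
  rewrite big_seq_cond big1 ?addr0 // => k /andP[ks kj].
  by apply: oE => //; rewrite eq_sym.
have pQ : proj Q.
  split; first by rewrite /Q st_sum big_seq [in RHS]big_seq; apply: eq_bigr => j /hE[[]].
  by rewrite {1}/Q mulr_suml /Q big_seq [in RHS]big_seq; apply: eq_bigr => j /EQ.
have pi : proj (P i) by apply: pP; rewrite inE eqxx.
have Pi1 := proj_nm pi.
have hQ : N (Q * P i) <= m * (2 * e1).
  rewrite /Q mulr_suml; apply: le_trans (nm_sum _ _ _) _.
  apply: (@le_trans _ _ (\sum_(j <- s) (2 * e1))).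
    rewrite big_seq [leRHS]big_seq; apply: ler_sum => j js.
    have -> : E j * P i = (E j - P j) * P i + P j * P i by ncring.
    have h1 : N (P j * P i) <= e1.
      apply: (@le_trans _ _ (Num.min t e1)); last by rewrite ge_min lexx orbT.
      apply: hP; rewrite ?inE ?js ?eqxx ?orbT //; apply: contraNneq nis => <- //.
    rewrite (_ : 2 * e1 = e1 * 1 + e1); last ring.
    by apply: nmD2 => //; apply: nmM2 => //; case: (hE j js).
  rewrite big_const_seq count_predT iter_addr addr0 -[_ *+ size s]mulr_natl.
  have e20 : 0 < 2 * e1 by rewrite mulr_gt0.
  by rewrite (ler_pM2r e20) /m lerDl.
have [|p [pp Qp hp]] := orthogonalize_step pQ pi hQ; first by rewrite mulrA [m * 2]mulrC.
have Ep j : j \in s -> E j * p = 0 by move=> js; rewrite -(EQ j js) -mulrA Qp mulr0.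
have pE j : j \in s -> p * E j = 0.
  move=> js; have [[sE _] _] := hE j js; have [sp _] := pp.
  by rewrite -[LHS]stK stM sE sp (Ep j js) st0.
exists (fun j => if j == i then p else E j); split.
  move=> j; rewrite inE; case: eqP => [-> _|_ /= js]; last first.
    by have [? h] := hE j js; split => //; exact: le_trans e1e.
  by split => //; apply: le_trans hp _; nra.
move=> j k; rewrite !inE; case: (eqVneq j i) => [->|ji] /=; case: (eqVneq k i) => [->|ki] //=.
- by move=> _ ks _; exact: pE.
- by move=> js _ _; exact: Ep.
- by move=> js ks jk; exact: oE.
Qed.

(** The compression of [y] to [r0] dominates that of [z], hence is at least [1/2] there. Conjugating
    by the inverse square root of [X] turns this into an exact equality, so comparison of a
    projection needs no limit. *)
Lemma projection_compare (r0 V x y z : T) : proj r0 -> Pos x -> y = V * x * st V -> Pos (y - z) ->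
  N (r0 - r0 * z * r0) <= 2^-1 -> exists v, r0 = v * x * st v.
Proof.
move=> pr px yE pyz hr; have [sr rr] := pr.
have sx := Pos_sa px.
have sy : st y = y by rewrite yE !stM stK sx mulrA.
have sz : st z = z by rewrite -[z](subKr y) stB (Pos_sa pyz) sy.
pose W := (2^-1)%:A - (r0 - r0 * z * r0).
have pW : Pos W by apply: Pos_of_nm => //; rewrite stB !stM sr sz mulrA.
pose X := 1 - r0 + r0 * y * r0.
have XE : X = (W + r0 * (y - z) * r0) + (2^-1)%:A.
  have h1 : (2^-1)%:A + (2^-1)%:A = 1 :> T by exact: half_addr.
  transitivity (((2^-1)%:A + (2^-1)%:A) - r0 + r0 * y * r0); first by rewrite h1.
  by rewrite /W; ncring.
have pX0 : Pos (W + r0 * (y - z) * r0) by apply: PosD => //; apply: Pos_conj_sa.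
have [|Xi [X1 X2 pXi _]] := @Pos_add_inv _ _ _ _ (2^-1) pX0; first by rewrite invr_gt0.
rewrite -XE in X1 X2.
have rX : r0 * X = r0 * y * r0.
  by rewrite /X mulrDr mulrBr mulr1 rr subrr add0r !mulrA rr.
have Xr : X * r0 = r0 * y * r0.
  by rewrite /X mulrDl mulrBl mul1r rr subrr add0r -!mulrA rr.
clearbody X.
have Xir : GRing.comm Xi r0 by apply: (comm_inv X1 X2); rewrite /GRing.comm rX Xr.
have [s [ps sE sc]] := Pos_sqrt pXi.
have sr0 := sc _ Xir.
have sX : GRing.comm s X by apply: sc; rewrite /GRing.comm X1 X2.
exists (s * r0 * V).
have -> : s * r0 * V * x * st (s * r0 * V) = s * (r0 * y * r0) * s.
  by rewrite !stM sr (Pos_sa ps) yE !mulrA.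
rewrite -Xr; have -> : s * (X * r0) * s = s * X * (r0 * s) by ncring.
by rewrite -sr0 sX mulrA -[X * s * s]mulrA sE X1 mul1r.
Qed.

(** [w = (d - t)_+] and [w' = (t - d)_+]. On the support of [w'] the element [d] equals [t - w'], so
    it is at most [t] there. *)
Lemma cutoff d t : Pos d -> 0 < t -> exists w w',
  [/\ Pos w, Pos w', d - t%:A = w - w' & w * w' = 0] /\
  [/\ w' * w = 0, N w' <= t, d * w' = (t%:A - w') * w', N (t%:A - w') <= t &
   forall z, GRing.comm d z -> GRing.comm w' z].
Proof.
move=> pd t0; have sd := Pos_sa pd.
have [|w [w' [[pw pw' E ww' w'w] hc]]] := @Pos_parts _ _ _ (d - t%:A); first by rewrite stB sd st_alg.
have dE : d = w - w' + t%:A by rewrite -E subrK.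
have dw' : d * w' = (t%:A - w') * w' by rewrite dE mulrDl !mulrBl ww'; ncring.
have sw' := Pos_sa pw'.
have w't : N w' <= t.
  have [->|w'0] := eqVneq w' 0; first by rewrite nm0 ltW.
  have nu0 : 0 < N w' by rewrite nm_gt0.
  (* Positivity of [w' d w'] gives [w'^3 <= t w'^2]. The norm identity for the fourth power gives
     [N w' ^ 3 <= N (w'^3)], and the two together bound [N w'] by [t]. *)
  have E3 : w' * d * w' = t *: (w' * w') - w' * w' * w'.
    by rewrite -mulrA dw' mulrBl mulrBr mulr_algl -scalerAr mulrA.
  have p3 : Pos (w' * w' * w').
    by apply: Pos_mul => //; [apply: Pos_sqr | rewrite /GRing.comm mulrA].
  have n2 : N (w' * w') = N w' ^+ 2 by rewrite -{1}sw' nm_stM.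
  have n4 : N ((w' * w') * (w' * w')) = N w' ^+ 4.
    have := @nm_stM _ _ _ (w' * w'); rewrite stM sw' n2 => ->; rewrite -exprM //.
  have n3 : N w' ^+ 3 <= N (w' * w' * w').
    rewrite -(ler_pM2r nu0) -exprSr -n4.
    have -> : w' * w' * (w' * w') = w' * w' * w' * w' by ncring.
    exact: nmM.
  have le3 : N (w' * w' * w') <= t * N w' ^+ 2.
    rewrite -n2 -{1}(gtr0_norm t0) -nmZ; apply: Pos_le_nm => //.
    by rewrite -E3; apply: Pos_conj_sa.
  have := le_trans n3 le3.
  by rewrite exprSr mulrC ler_pM2r // exprn_gt0.
exists w, w'; split; split => //; first exact: Pos_nm.
move=> z dz; apply: (proj2 (hc z _)); apply/commr_sym/commrB; first exact/commr_sym.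
by apply/commr_sym/comm_alg.
Qed.

(** If [w'] vanished, then [1 - x >= t], so [x <= 1 - t], against [N x = 1]. *)
Lemma cutoff_neq0 x t (w w' : T) : Pos x -> 0 < t < 1 -> N x = 1 -> Pos w -> (1 - x) - t%:A = w - w' -> w' != 0.
Proof.
move=> px /andP[t0 t1] x1 pw E; apply/eqP => w'0.
rewrite w'0 subr0 in E.
have : N x <= 1 - t.
  by apply: Pos_nm_le => //; rewrite scalerBl scale1r (_ : _ - _ = w) // -E; ncring.
by rewrite x1; lra.
Qed.

(** [w' = (dl - (1 - x))_+] is nonzero and [x] is at least [1 - dl] on its support. Writing 1 as a
    sum of [a w' b] shows that a nonzero, almost central projection [p] cannot nearly annihilate
    [w']; as [p x p] almost fixes [p w'], its norm is nearly 1. Any [E] above [p] inherits the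
    bound. *)
Lemma nm_compression x e : simple_cstar S -> Pos x -> N x = 1 -> 0 < e ->
  exists (F : seq T) (t : R), 0 < t /\ forall p, proj p -> p != 0 ->
    (forall a, a \in F -> N (cm p a) < t) ->
  forall E, p * E = p -> E * p = p -> 1 - e < N (E * x * E).
Proof.
move=> simp px x1 e0.
pose dl := Num.min (e / 4) 2^-1.
have dl0 : 0 < dl by rewrite lt_min divr_gt0 // invr_gt0 ltr0n.
have dl1 : dl <= 2^-1 by rewrite ge_min lexx orbT.
have dle : dl <= e / 4 by rewrite ge_min lexx.
have pd : Pos (1 - x) by rewrite -[1]scale1r; apply: Pos_of_nm; rewrite ?(Pos_sa px) ?x1.
have [w [w' [[pw pw' E _] [_ _ dw' hdw' _]]]] := cutoff pd dl0.
have w'0 : w' != 0 by apply: (cutoff_neq0 px _ x1 pw E); rewrite dl0 /=; lra.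
have [l hl] := simple_full simp w'0.
pose K := \sum_(u <- l) N (w' * u.2); pose L := \sum_(u <- l) N u.1 * N u.2.
have K0 : 0 <= K by apply: sumr_ge0 => u _; exact: nm_ge0.
have L0 : 0 <= L by apply: sumr_ge0 => u _; rewrite mulr_ge0 // nm_ge0.
(* The first bound keeps the commutator errors below [1/2], so that [rho L >= 1/2]; with it the
   second gives [2 t <= rho e / 4]. *)
pose t := Num.min (2 * (K + 1))^-1 (e / (16 * (L + 1))).
have t0 : 0 < t.
  by rewrite lt_min invr_gt0 divr_gt0 ?mulr_gt0 // ltr_wpDl.
have tK : t * K <= 2^-1.
  apply: (@le_trans _ _ ((2 * (K + 1))^-1 * K)).
    by rewrite ler_wpM2r // ge_min lexx.
  rewrite ler_pdivrMl ?mulr_gt0 ?ltr_wpDl //; lra.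
have tL : 16 * t * L <= e.
  apply: (@le_trans _ _ (16 * (e / (16 * (L + 1))) * L)).
    by rewrite ler_wpM2r // ler_wpM2l // ge_min lexx orbT.
  have -> : 16 * (e / (16 * (L + 1))) * L = e * L / (L + 1).
    by field; apply/lt0r_neq0; rewrite ltr_wpDl.
  have L1 : 0 < L + 1 by rewrite ltr_wpDl.
  by rewrite (ler_pdivrMr _ _ L1) mulrDr lerDl mulr1 ltW.
exists (w' :: [seq u.1 | u <- l]), t; split => // p pp p0 hF E' pE' E'p.
have p1 := proj_nm pp; have [sp pE] := pp.
set rho := N (p * w').
have key : 1 <= t * K + rho * L.
  rewrite -[leLHS](proj_nm1 pp p0) -[p]mulr1 -hl mulr_sumr.
  apply: le_trans (nm_sum _ _ _) _.
  rewrite !mulr_sumr -big_split /= big_seq [leRHS]big_seq; apply: ler_sum => u ul.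
  have -> : p * (u.1 * w' * u.2) = cm p u.1 * (w' * u.2) + u.1 * (p * w') * u.2 by rewrite /cm; ncring.
  apply: nmD2.
    by apply: nmM2 => //; apply/ltW/hF; rewrite inE map_f ?orbT.
  rewrite (_ : rho * (N u.1 * N u.2) = N u.1 * rho * N u.2); last ring.
  by apply: nmM2 => //; apply: nmM2.
have rL : 2^-1 <= rho * L by lra.
have rho0 : 0 < rho.
  rewrite lt_def nm_ge0 andbT; apply: contraTneq rL => ->; rewrite mul0r -ltNge.
  by rewrite invr_gt0.
have hw : N (cm p w') <= t by apply/ltW/hF; rewrite inE eqxx.
have pw'p : N (w' * p) = rho by rewrite -nm_adj stM sp (Pos_sa pw').
have nx : N (p * x * p * (p * w')) <= N (p * x * p) * rho by exact: nmM.
have lb : rho <= N (p * x * p * (p * w')) + (2 * t + dl * rho).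
  have E1 : p * x * p * (p * w') = p * x * (p * w') by rewrite !mulrA -[_ * p * p]mulrA pE.
  set Z := p * cm p w' + p * ((1 - x) * w') * p - p * x * cm p w'.
  have E2 : p * w' = p * x * p * (p * w') + Z; first rewrite /Z.
    rewrite E1; have : p * p * w' = p * w' by rewrite pE.
    rewrite /cm => {1}<-; rewrite !mulrDr !mulrN !mulrA !pE.
    transitivity (p * w'); first by [].
    by ncring.
  apply: (@le_trans _ _ (N (p * x * p * (p * w') + Z))); first by rewrite -E2.
  apply: nmD2 => //; rewrite /Z.
  have -> : 2 * t + dl * rho = 1 * t + 1 * (dl * rho) + 1 * 1 * t by ring.
  apply: nmB2; last by apply: nmM2 => //; apply: nmM2 => //; rewrite x1.
  apply: nmD2; first exact: nmM2.
  rewrite dw' -!mulrA; apply: nmM2 => //; apply: nmM2 => //.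
  by rewrite pw'p.
have main : 1 - e < N (p * x * p).
  have h : rho * (1 - dl) - 2 * t <= N (p * x * p) * rho by lra.
  have h2 : 2 * t <= rho * (e / 4).
    have : 4 * t * (2^-1) <= 4 * t * (rho * L) by rewrite ler_wpM2l // mulr_ge0 // ltW.
    have : rho * (16 * t * L) <= rho * e by rewrite ler_wpM2l // ltW.
    lra.
  rewrite -(ltr_pM2r rho0); apply: lt_le_trans h.
  have h3 : rho * dl <= rho * (e / 4) by rewrite ler_wpM2l // ltW.
  have h4 : 0 < rho * e by rewrite mulr_gt0.
  lra.
apply: lt_le_trans main _.
have -> : p * x * p = p * (E' * x * E') * p.
  by rewrite -{1}pE' -{2}E'p; ncring.
by rewrite -[leRHS]mul1r -[leRHS]mulr1; apply: nmM2 => //; apply: nmM2.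
Qed.
End Comparison.

(** * Orthogonal pieces in simple infinite-dimensional algebras *)

Section Hereditary.
Context {R : realType} {A : completeNormedModType R[i]} {S : ucstar A}.
Local Notation T := (calg S).
Local Notation N := (@nm R A S).
Local Notation st := (@st R A S).
Implicit Types (a b d m p q x y z : T) (r t e : R).

(** The [r] with [r x <= D] form a Dedekind cut bounded by norms. At its supremum both [D - r x] and
    its negative are limits of positive elements. *)
Lemma total_scalar (D x : T) : Pos x -> x != 0 -> 
  (forall r, Pos (D - r *: x) \/ Pos (r *: x - D)) -> exists r, D = r *: x.
Proof.
move=> px x0 h; have nx : 0 < N x by rewrite nm_gt0.
pose E : set R := [set r | Pos (D - r *: x)].
have down r : 0 <= r -> Pos (r *: x) by move=> r0; apply: PosZ.
have hs : has_sup E.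
  split.
    exists (- (N D / N x + 1)); case: (h (- (N D / N x + 1))) => // hp; exfalso.
    have h1 : N ((N D / N x + 1) *: x) <= N (- D).
      apply: Pos_le_nm; first by apply: down; rewrite addr_ge0 // divr_ge0 // nm_ge0.
      by move: hp; rewrite scaleNr addrC.
    move: h1; rewrite nmN nmZ ger0_norm ?addr_ge0 // ?divr_ge0 ?nm_ge0 //.
    by rewrite mulrDl divfK ?gt_eqF // mul1r; lra.
  exists (N D / N x) => r /= pr; have [r0|r0] := leP 0 r; last first.
    by apply: (le_trans (ltW r0)); rewrite divr_ge0 // nm_ge0.
  rewrite ler_pdivlMr // -{1}(ger0_norm r0) -nmZ.
  by apply: Pos_le_nm => //; apply: down.
exists (sup E); apply/eqP; rewrite -subr_eq0; apply/eqP/Pos_antisym.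
  apply: Pos_limit => e e0; have d0 : 0 < e / N x by rewrite divr_gt0.
  have [r Er hr] := sup_adherent d0 hs; exists (D - r *: x) => //.
  have rs : r <= sup E by apply: ub_le_sup => //; case: hs.
  have -> : D - sup E *: x - (D - r *: x) = - ((sup E - r) *: x) by rewrite scalerBl; ncring.
  rewrite nmN nmZ ger0_norm ?subr_ge0 // -ler_pdivlMr //; lra.
rewrite opprB; apply: Pos_limit => e e0; have d0 : 0 < e / N x by rewrite divr_gt0.
pose r := sup E + e / N x; exists (r *: x - D).
  case: (h r) => // Er; have : r <= sup E by apply: ub_le_sup => //; case: hs.
  by rewrite /r; lra.
have -> : sup E *: x - D - (r *: x - D) = - ((e / N x) *: x) by rewrite /r scalerDl; ncring.
by rewrite nmN nmZ gtr0_norm // divfK // gt_eqF.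
Qed.

Lemma sa_parts b : exists b1 b2, [/\ st b1 = b1, st b2 = b2 & b = b1 + J S * b2].
Proof.
exists (2^-1 *: (b + st b)), (- (2^-1 *: (J S * (b - st b)))); split.
- by rewrite stZ stD stK addrC.
- by rewrite stN stZ stM st_J stB stK mulrN -mulNr opprB J_comm.
rewrite mulrN -scalerAr mulrA J_sqr mulN1r scalerN opprK -scalerDr -[LHS]half_addr -scalerDr.
by congr (_ *: _); ncring.
Qed.

(* Otherwise s b s is a complex multiple of x for every b, where s^2 = x; writing
   1 = sum a_i s b_i shows that the a_i x b_j span A. *)
Lemma two_orth x : infinite_dimensional A -> simple_cstar S -> Pos x -> x != 0 ->
  exists z1 z2, [/\ z1 * x * st z2 = 0,
    Pos (z1 * x * st z1) /\ z1 * x * st z1 != 0 & Pos (z2 * x * st z2) /\ z2 * x * st z2 != 0].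
Proof.
move=> inf simp px x0; apply: contrapT => nex; apply: inf.
have [s [ps sE _]] := Pos_sqrt px; have ss := Pos_sa ps.
have s0 : s != 0 by apply: contraNneq x0 => s0; rewrite -sE s0 mul0r.
have real b : st b = b -> exists r, s * b * s = r *: x.
  move=> sb; apply: total_scalar => // r; pose c := b - r%:A; pose y := s * c * s.
  have sc : st c = c by rewrite stB st_alg sb.
  have yE : y = s * b * s - r *: x.
    by rewrite /y /c mulrBr mulrBl mulr_algr -scalerAl sE.
  have sy : st y = y by rewrite /y !stM sc ss mulrA.
  have [p [n [[pp pn yE' pn0 np0] _]]] := Pos_parts sy.
  have sp := Pos_sa pp; have sn := Pos_sa pn.
  have [p0|p0] := eqVneq p 0; first by right; rewrite -opprB -yE yE' p0 sub0r opprK.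
  have [n0|n0] := eqVneq n 0; first by left; rewrite -yE yE' n0 subr0.
  (* Since [s c x c s = y^2], these witnesses give [p y^2 n = 0] off the diagonal and [p^4], [n^4]
     on it. *)
  exfalso; apply: nex; exists (p * s * c), (n * s * c).
  have gen u v : st v = v -> (u * s * c) * x * st (v * s * c) = u * y * y * v.
    by move=> sv; rewrite !stM sv ss sc -sE /y; ncring.
  have four u : st u = u -> u != 0 -> Pos (u * u * (u * u)) /\ u * u * (u * u) != 0.
    move=> su u0; split; first by apply: Pos_sqr; rewrite stM su.
    apply: contra_neq u0 => u4; apply/eqP; rewrite -nm_le0.
    apply: nm_sqr_le => //; rewrite expr0n; apply: nm_sqr_le => //; first by rewrite stM su.
    by rewrite u4 nm0 expr0n.
  split.
  - rewrite gen // yE'; transitivity (p * (p * p - p * n - n * p) * n + (p * n) * (n * n)); first by ncring.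
    rewrite pn0 np0 mul0r addr0 !subr0.
    by transitivity (p * p * (p * n)); [ncring | rewrite pn0 mulr0].
  - rewrite gen // yE' (_ : p * _ * _ * p = p * p * (p * p)); first exact: four.
    transitivity (p * p * (p * p) - p * p * (n * p) - (p * n) * p * p + (p * n) * (n * p)); first by ncring.
    by rewrite pn0 np0 !mul0r !mulr0 !subr0 addr0.
  - rewrite gen // yE' (_ : n * _ * _ * n = n * n * (n * n)); first exact: four.
    transitivity (n * n * (n * n) - n * n * (p * n) - (n * p) * n * n + (n * p) * (p * n)); first by ncring.
    by rewrite pn0 np0 !mul0r !mulr0 !subr0 addr0.
have cplx b : exists k : R[i], s * b * s = (k *: (x : A) : A).
  have [b1 [b2 [sb1 sb2 ->]]] := sa_parts b.
  have [r1 h1] := real _ sb1; have [r2 h2] := real _ sb2.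
  exists (r1 +i* r2)%C; rewrite (@complex_scale _ _ S) /= -h1 [J S * x]J_comm scalerAl -h2.
  have Js := J_comm s.
  by rewrite -[_ * J S]J_comm; transitivity (s * b1 * s + (s * J S) * b2 * s); [ncring | rewrite -Js; ncring].
have [l hl] := simple_full simp s0.
(* Expanding both units in [1 a 1] gives terms [a_i (s b_i a a_j s) b_j], whose bracket is a scalar
   multiple of [x]. *)
pose I := ('I_(size l) * 'I_(size l))%type.
pose F (i : I) : T := (tnth (in_tuple l) i.1).1 * x * (tnth (in_tuple l) i.2).2.
exists #|{: I}|, (fun i => F (enum_val i)) => a.
have /choice[k hk] : forall i : I, exists k : R[i],
    s * ((tnth (in_tuple l) i.1).2 * a * (tnth (in_tuple l) i.2).1) * s = (k *: (x : A) : A).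
  by move=> i; exact: cplx.
exists (fun i => k (enum_val i)).
have aE : a = \sum_(i : I) (k i *: (F i : A)) :> A.
  pose L i := tnth (in_tuple l) i.
  pose G (i j : 'I_(size l)) : T := (L i).1 * (s * ((L i).2 * a * (L j).1) * s) * (L j).2.
  have hl' : \sum_(i < size l) (L i).1 * s * (L i).2 = 1 by rewrite -hl [RHS]big_tnth.
  have e1 : (a : T) = \sum_(i : I) G i.1 i.2.
    rewrite -(pair_bigA _ G) /=.
    transitivity (1 * (a : T) * 1); first by rewrite mulr1 mul1r.
    rewrite -hl' !mulr_suml; apply: eq_bigr => i _.
    rewrite mulr_sumr; apply: eq_bigr => j _.
    by rewrite /G -/(L i) -/(L j); ncring.
  rewrite {1}e1; apply: eq_bigr => i _; rewrite /G hk /F /GRing.mul /= cmulZr cmulZl.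
  by [].
rewrite {1}aE.
rewrite -(big_enum_val (A := {: I}) (fun i => (k i *: (F i : A) : A))).
by apply: eq_bigl => i; rewrite inE.
Qed.

(** One of two orthogonal pieces is kept and the induction continues inside the other; conjugators
    compose, so every piece is a conjugate of the original [x]. *)
Lemma orth_family n x : infinite_dimensional A -> simple_cstar S -> Pos x -> x != 0 ->
  exists z : nat -> T, (forall i, (i < n)%N -> Pos (z i * x * st (z i)) /\ z i * x * st (z i) != 0) /\
    (forall i j, (i < n)%N -> (j < n)%N -> i != j -> z i * x * st (z j) = 0).
Proof.
move=> inf simp; elim: n x => [|n ih] x px x0; first by exists (fun _ => 0).
have [z1 [z2 [z12 [p1 n1] [p2 n2]]]] := two_orth inf simp px x0.
have [z [hz oz]] := ih _ p1 n1.
have sx := Pos_sa px.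
exists (fun i => if i is j.+1 then z j * z1 else z2); split.
  move=> [|i] //= /hz; rewrite (_ : z i * z1 * x * st (z i * z1) = z i * (z1 * x * st z1) * st (z i)) //.
  by rewrite stM !mulrA.
have z21 : z2 * x * st z1 = 0.
  by rewrite -st0 -z12 !stM stK sx mulrA.
move=> [|i] [|j] //= hi hj ij.
- by rewrite stM mulrA z21 mul0r.
- by transitivity (z i * (z1 * x * st z2)); [ncring | rewrite z12 mulr0].
- by rewrite stM -(oz i j) // !mulrA.
Qed.

(** Simplicity gives [b] with [s b s'] nonzero for the roots [s] of [y] and [s'] of [x]. The square
    of [n = s b x (st b) s] is an exact conjugate of [y = s^2] and, through the root [k] of [n],
    also of [x], so conjugacy to the earlier elements survives. *)
Lemma common_minorant (l : seq T) : simple_cstar S -> (forall y, y \in l -> Pos y /\ y != 0) ->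
  exists x, [/\ Pos x, x != 0 & forall y, y \in l -> exists u, x = u * y * st u].
Proof.
move=> simp; elim: l => [|y l ih] hl.
  by exists 1; split => //; [exact: Pos1 | exact: oner_neq0].
have [|x [px x0 hx]] := ih; first by move=> z zl; apply: hl; rewrite inE zl orbT.
have [py y0] := hl y (mem_head _ _).
have [s [ps sE _]] := Pos_sqrt py; have [s' [ps' sE' _]] := Pos_sqrt px.
have ss := Pos_sa ps; have ss' := Pos_sa ps'.
have s0 : s != 0 by apply: contraNneq y0 => s0; rewrite -sE s0 mul0r.
have s'0 : s' != 0 by apply: contraNneq x0 => s0'; rewrite -sE' s0' mul0r.
have [b hb] : exists b, s * b * s' != 0.
  apply: contrapT => nb; move/eqP: s'0; apply; have [k hk] := simple_full simp s0.
  rewrite -[s']mul1r -hk mulr_suml big1 // => u _.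
  rewrite -!mulrA [s * _]mulrA (_ : s * u.2 * s' = 0) ?mulr0 //.
  by apply/eqP/negP => /negP h; apply: nb; exists u.2.
pose n := s * b * x * st b * s.
have nE : n = (s * b * s') * st (s * b * s').
  by rewrite !stM ss ss' /n -sE' !mulrA.
have pn : Pos n by rewrite nE; apply: Pos_Mst.
have sn := Pos_sa pn.
have n0 : n != 0 by rewrite -nm_eq0 nE nm_Mst expf_neq0 // nm_eq0.
have [k [pk kE kc]] := Pos_sqrt pn; have sk := Pos_sa pk.
have kn : GRing.comm k n by apply: kc.
have nnE : n * n = (k * s * b) * x * st (k * s * b).
  have -> : k * s * b * x * st (k * s * b) = k * n * k by rewrite !stM ss sk /n !mulrA.
  by rewrite kn -mulrA kE.
exists (n * n); split.
- exact: Pos_sqr.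
- by have := nm_sqr sn; rewrite expr2 -nm_eq0 => ->; rewrite expf_neq0 // nm_eq0.
move=> z; rewrite inE => /orP[/eqP ->|/hx[u hu]].
  exists (s * b * x * st b).
  rewrite !stM stK (Pos_sa px) ss -sE /n; ncring.
by exists (k * s * b * u); rewrite nnE hu [st (k * s * b * u)]stM !mulrA.
Qed.
End Hereditary.

(** * Towers *)

Section Action.
Context {R : realType} {A : completeNormedModType R[i]} {S : ucstar A}.
Context {G : finGroupType} {alpha : G -> A -> A}.
Local Notation T := (calg S).
Local Notation N := (@nm R A S).
Local Notation st := (@st R A S).
Local Notation al := (alpha : G -> T -> T).
Implicit Types (a b c d h k m p q x y z : T) (r t e : R) (g : G) (f E : G -> T).

Hypothesis act : cstar_action S alpha.

Lemma act_aut g : star_automorphism S (al g).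
Proof. by case: act => h _ _; exact: h. Qed.
Lemma act1 x : al 1%g x = x.
Proof. by case: act => _ h _; exact: h. Qed.
Lemma actM g g' x : al (g * g')%g x = al g (al g' x).
Proof. by case: act => _ _ h; exact: h. Qed.
Lemma actKV g x : al g (al g^-1%g x) = x.
Proof. by rewrite -actM mulgV act1. Qed.
Lemma actK g x : al g^-1%g (al g x) = x.
Proof. by rewrite -actM mulVg act1. Qed.
Lemma act_nm g x : N (al g x) = N x.
Proof.
apply/eqP; rewrite eq_le (aut_nm_le (act_aut g)) /= -{1}(actK g x).
exact: (aut_nm_le (act_aut g^-1%g)).
Qed.
Lemma act_cm g x y : al g (cm x y) = cm (al g x) (al g y).
Proof. by rewrite /cm (autB (act_aut g)) !(autM (act_aut g)). Qed.
Lemma act_proj g p : proj p -> proj (al g p).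
Proof.
move=> [sp pp]; split; first by rewrite -(aut_st (act_aut g)) sp.
by rewrite -(autM (act_aut g)) pp.
Qed.

Let nG : R := #|G|%:R.
Lemma nG1 : 1 <= nG.
Proof. by rewrite /nG ler1n; apply/card_gt0P; exists 1%g. Qed.

(** A large [s x s] forces [N s > 1/2], and [s] is a sum of [|G|] elements of norm about [N (f 1)].
    This lower bound is what keeps [k], hence [q], from vanishing. *)
Lemma tower_nm f x e : N x = 1 -> e <= 2^-1 -> e <= (4 * nG)^-1 ->
  (forall g, N (al g (f 1%g) - f g) <= e) ->
  1 - e < N ((\sum_g f g) * (x * \sum_g f g)) -> (4 * nG)^-1 <= N (f 1%g).
Proof.
move=> x1 e2 en hf; set s := \sum_g f g => hs.
have h1 : N (s * (x * s)) <= N s * (1 * N s) by apply: nmM2 => //; apply: nmM2; rewrite ?x1.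
have s0 : 0 <= N s by exact: nm_ge0.
have h2 : 2^-1 < N s by nra.
have h3 : N s <= nG * (N (f 1%g) + e).
  apply: le_trans (nm_sum _ _ _) _.
  apply: (@le_trans _ _ (\sum_(g : G) (N (f 1%g) + e))).
    apply: ler_sum => g _; rewrite -(act_nm g (f 1%g)).
    have -> : f g = al g (f 1%g) - (al g (f 1%g) - f g) by rewrite subKr.
    exact: nmB2.
  by rewrite sumr_const -mulr_natl.
have n1 := nG1; have n0 : 0 < nG by lra.
have h4 : 2^-1 <= nG * (N (f 1%g) + e) by lra.
have h5 : nG * (4 * nG)^-1 = 4^-1 by field; lra.
have h6 : nG * e <= 4^-1 by rewrite -h5 ler_pM2l.
rewrite -(ler_pM2l n0) h5; lra.
Qed.

(** Moving [y] past [b] and one factor [h] in each term of [1 = sum a h^2 b] makes it nearly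
    [sum a (h y h) b], so compression by [h] cannot annihilate a large almost central [y]. *)
Lemma compressed_nm (l : seq (T * T)) h y e : \sum_(u <- l) u.1 * (h * h) * u.2 = 1 -> 
  N h <= 1 -> N (cm y h) <= e -> (forall u, u \in l -> N (cm y u.2) <= e) ->
  N y <= (\sum_(u <- l) N u.1 * N u.2) * (N (h * y * h) + e) + e * \sum_(u <- l) N u.1.
Proof.
move=> hl h1 hh hu.
rewrite -{1}[y]mul1r -{1}hl !mulr_suml mulr_sumr -big_split /=.
apply: le_trans (nm_sum _ _ _) _; rewrite big_seq [leRHS]big_seq; apply: ler_sum => u ul.
have -> : u.1 * (h * h) * u.2 * y =
  u.1 * (h * y * h - h * cm y h) * u.2 - u.1 * (h * h) * cm y u.2 by rewrite /cm; ncring.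
have -> : N u.1 * N u.2 * (N (h * y * h) + e) + e * N u.1 =
  N u.1 * (N (h * y * h) + 1 * e) * N u.2 + N u.1 * (1 * 1) * e by ring.
apply: nmB2.
  by apply: nmM2 => //; apply: nmM2 => //; apply: nmB2 => //; apply: nmM2.
by apply: nmM2; [apply: nmM2 => //; apply: nmM2 | exact: hu].
Qed.

(* q is almost unchanged by c, and c a is almost b. *)
Lemma commutator_transfer c d q a b t e : d = 1 - c -> st d = d -> st q = q -> N q <= 1 -> N (d * q) <= t ->
  N (c * a - b) <= e -> N (cm c a) <= e -> N (cm q a) <= 2 * t * N a + 3 * e + N (cm q b).
Proof.
move=> dE sd sq q1 dq cab ca.
have qd : N (q * d) <= t by rewrite -nm_adj stM sq sd.
have -> : cm q a = q * d * a + q * (c * a - b) + cm q b - a * (d * q) - (c * a - b) * q + cm c a * q.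
  by rewrite dE /cm; ncring.
have -> : 2 * t * N a + 3 * e + N (cm q b) =
   t * N a + 1 * e + N (cm q b) + N a * t + e * 1 + e * 1 by ring.
by do !(apply: nmB2 || apply: nmD2) => //; apply: nmM2.
Qed.

Lemma compressed_orth f h m t e g : g != 1%g -> N h <= 1 -> (forall g, N (f g) <= 1) -> 
  f 1%g * f g = 0 -> N (al g (f 1%g) - f g) <= e -> N (cm (f 1%g) (h * al g h)) <= e ->
  N m <= t -> let k := h * f 1%g * h in
  N (k * m * k * al g k) <= t * (2 * e) /\ N (k * m * k * al g (k * m * k)) <= t * (2 * e) * t.
Proof.
move=> g1 h1 f1 ff fe ch mt k.
have k1 : N k <= 1 * 1 * 1 by apply: nmM2 => //; apply: nmM2.
rewrite !mul1r in k1.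
have kk : N (k * al g k) <= 2 * e.
  rewrite /k !(autM (act_aut g)).
  have -> : h * f 1%g * h * (al g h * al g (f 1%g) * al g h) =
     h * (cm (f 1%g) (h * al g h) * al g (f 1%g) + h * al g h * (f 1%g * (al g (f 1%g) - f g) + f 1%g * f g)) * al g h.
    by rewrite /cm; ncring.
  rewrite ff addr0.
  have -> : 2 * e = 1 * (e * 1 + 1 * 1 * (1 * e)) * 1 by ring.
  apply: nmM2; rewrite ?act_nm //; apply: nmM2 => //.
  by apply: nmD2; do ?[apply: nmM2]; rewrite ?act_nm.
have h2 : N (k * m * k * al g k) <= t * (2 * e).
  rewrite -mulrA; apply: nmM2 => //; rewrite -[t]mul1r; exact: nmM2.
split => //.
have -> : k * m * k * al g (k * m * k) = k * m * k * al g k * al g (m * k).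
  by rewrite !(autM (act_aut g)) !mulrA.
apply: nmM2 => //; rewrite act_nm -[t]mulr1; exact: nmM2.
Qed.

(** Up to small terms only the summand of index [g] acts on [al g k], leaving [al g ((1 - q) k)].
    The others are translates of [q * al g' k] with [g' != 1]. *)
Lemma remainder_nm E k q t u v g : N k <= 1 -> 0 <= v ->
  (forall g, N (E g - al g q) <= t) -> N ((1 - q) * k) <= u ->
  (forall g, g != 1%g -> N (q * al g k) <= v) ->
  N ((1 - \sum_g E g) * al g k) <= u + nG * (t + v).
Proof.
move=> k1 v0 hE hq hv.
have hv' g' : g' != g -> N (al g' q * al g k) <= v.
  move=> gg'; have -> : al g' q * al g k = al g' (q * al (g'^-1 * g)%g k).
    by rewrite (autM (act_aut g')) -actM mulKVg.
  by rewrite act_nm; apply: hv; apply: contra_neq gg' => h; rewrite -[g](mulKVg g') h mulg1.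
have -> : (1 - \sum_g E g) * al g k =
  al g ((1 - q) * k) - \sum_g' ((E g' - (if g' == g then al g q else 0)) * al g k).
  rewrite -mulr_suml sumrB -big_mkcond big_pred1_eq.
  by rewrite (autM (act_aut g)) (autB (act_aut g)) (aut1 (act_aut g)); ncring.
apply: nmB2; first by rewrite act_nm.
apply: le_trans (nm_sum _ _ _) _; rewrite /nG mulr_natl -sumr_const; apply: ler_sum => g' _.
have t0 : 0 <= t := le_trans (nm_ge0 _) (hE g).
case: eqP => [->|/eqP gg'].
  apply: (@le_trans _ _ (t * 1)); last by rewrite mulr1 lerDl.
  by apply: nmM2; rewrite ?act_nm.
have -> : (E g' - 0) * al g k = (E g' - al g' q) * al g k + al g' q * al g k by ncring.
apply: nmD2; last exact: hv'.
by rewrite -[t]mulr1; apply: nmM2; rewrite ?act_nm.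
Qed.

(** The error [d - D] is put inside the lower bound [z], so that [y - z] is exactly a sum of
    translates of [(2/dl) d - f 1 + 2 k >= 0]. Each [al g k] is negligible on [r0], so [z] is close
    to 1 there; the errors add up to at most [3/8]. *)
Lemma remainder_compare f (h d w k x V D Y0 r0 : T) (t e dl : R) : 
  proj r0 -> Pos x -> Pos (f 1%g) -> N (f 1%g) <= 1 -> Pos d -> Pos w -> 0 < dl ->
  Pos h -> N h <= 1 -> 1 - h = dl^-1 *: (d - w) -> k = h * f 1%g * h ->
  (forall g, N (r0 * al g k) <= t) -> nG * t <= 16^-1 ->
  (forall g, N (al g (f 1%g) - f g) <= e) -> nG * e <= 16^-1 ->
  N (1 - \sum_g f g - Y0) <= 16^-1 -> N (d - D) <= dl / (16 * nG) ->
  V * x * st V = Y0 + \sum_g (2 / dl) *: al g D ->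
  exists v, r0 = v * x * st v.
Proof.
move=> pr px pf f1 pd pw dl0 ph h1 hE kE hk kt hf fe hY hD hV.
have n1 := nG1; have n0 : 0 < nG by lra.
have r1 := proj_nm pr; have [sr rr] := pr.
have sh := Pos_sa ph.
pose z := Y0 + \sum_g (al g (f 1%g) - (al g k + al g k) - (2 / dl) *: al g (d - D)).
apply: (@projection_compare _ _ _ r0 V x _ z pr px erefl).
  rewrite hV /z opprD addrA -[Y0 + _ - Y0]addrAC subrr add0r -sumrB; apply: Pos_sum => g _.
  have -> : (2 / dl) *: al g D - (al g (f 1%g) - (al g k + al g k) - (2 / dl) *: al g (d - D)) =
    al g ((2 / dl) *: d - f 1%g + (k + k)).
    have aD := autD (act_aut g); have aB := autB (act_aut g).
    by rewrite aB scalerBr aD aB aD (autZ (act_aut g)); ncring.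
  apply: aut_Pos; first exact: act_aut.
  (* (h - (1-h)) f (h - (1-h)) >= 0 bounds f by 2 h f h + 2 (1-h) f (1-h). *)
  set F := f 1%g in pf f1 kE *.
  have -> : (2 / dl) *: d - F + (k + k) = (2 / dl) *: w + ((h - (1 - h)) * F * (h - (1 - h)) +
     ((h * (1 - h) * h + (1 - h) * h * (1 - h)) + (h * (1 - h) * h + (1 - h) * h * (1 - h)) +
      ((1 - h) * (1 - F) * (1 - h) + (1 - h) * (1 - F) * (1 - h)))).
    have dE : (2 / dl) *: d - (2 / dl) *: w = (1 - h) + (1 - h).
      by rewrite -scalerBr hE -scalerDl; congr (_ *: _); field; rewrite gt_eqF.
    transitivity ((2 / dl) *: w + ((2 / dl) *: d - (2 / dl) *: w) - F + (k + k)); first by ncring.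
    by rewrite dE kE; ncring.
  have ph' : Pos (1 - h) by rewrite -[1]scale1r; apply: Pos_of_nm.
  have pF' : Pos (1 - F) by rewrite -[1]scale1r; apply: Pos_of_nm => //; exact: Pos_sa.
  have sh' := Pos_sa ph'.
  apply: PosD; first by apply: PosZ => //; rewrite divr_ge0 // ltW.
  apply: PosD; first by apply: Pos_conj_sa => //; rewrite stB sh sh'.
  by do ![apply: Pos_conj_sa => // | apply: PosD => //].
have -> : r0 - r0 * z * r0 = r0 * (1 - z) * r0 by rewrite mulrBr mulrBl mulr1 rr.
have -> : r0 * (1 - z) * r0 = r0 * (1 - \sum_g f g - Y0) * r0 + \sum_g (r0 * (f g - al g (f 1%g)) * r0 +
    (r0 * al g k * r0 + r0 * al g k * r0) + (2 / dl) *: (r0 * al g (d - D) * r0)).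
  have -> : 1 - z = (1 - \sum_g f g - Y0) + \sum_g ((f g - al g (f 1%g)) + (al g k + al g k) + (2 / dl) *: al g (d - D)).
    have -> : \sum_g ((f g - al g (f 1%g)) + (al g k + al g k) + (2 / dl) *: al g (d - D)) =
      \sum_g f g - \sum_g (al g (f 1%g) - (al g k + al g k) - (2 / dl) *: al g (d - D)).
      by rewrite -sumrB; apply: eq_bigr => g _; ncring.
    by rewrite /z; ncring.
  rewrite mulrDr mulrDl mulr_sumr mulr_suml; congr (_ + _); apply: eq_bigr => g _.
  by rewrite !mulrDr !mulrDl -scalerAr -scalerAl.
apply: (@le_trans _ _ (1 * 16^-1 * 1 + nG * (1 * e * 1 + (t * 1 + t * 1) + 2 / dl * (1 * (dl / (16 * nG)) * 1)))).
  apply: nmD2; first by apply: nmM2 => //; apply: nmM2.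
  apply: le_trans (nm_sum _ _ _) _; rewrite /nG [leRHS]mulr_natl -sumr_const; apply: ler_sum => g _.
  apply: nmD2; first apply: nmD2.
  - by apply: nmM2 => //; apply: nmM2 => //; rewrite nmBC.
  - by apply: nmD2; apply: nmM2.
  rewrite nmZ gtr0_norm ?divr_gt0 // ler_wpM2l ?divr_ge0 // ?(ltW dl0) //.
  by apply: nmM2 => //; apply: nmM2 => //; rewrite act_nm.
have -> : nG * (1 * e * 1 + (t * 1 + t * 1) + 2 / dl * (1 * (dl / (16 * nG)) * 1)) = nG * e + 2 * (nG * t) + 8^-1.
  by field; rewrite !gt_eqF.
lra.
Qed.
End Action.

(** * Real rank zero along the ultrafilter *)

Section Ultra.
Context {R : realType} {A : completeNormedModType R[i]} {S : ucstar A}.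
Context {w : set_system nat}.
Local Notation T := (calg S).
Local Notation N := (@nm R A S).
Local Notation st := (@st R A S).
Implicit Types (b c k m p q x y z : T) (r t e : R) (B : set A).

Hypothesis free : free_ultrafilter w.

(* Shrinks the context before arithmetic tactics, which fail once a section
   variable has been cleared. *)
Local Tactic Notation "keep" ne_hyp_list(Hs) := revert Hs; clear -S free; intros.

Lemma free_proper : ProperFilter w.
Proof. by case: free => h _; exact: ultra_proper. Qed.
Local Existing Instance free_proper.

Lemma free_tail n0 : w [set n | (n0 <= n)%N].
Proof.
case: free => uw fw; have [//|h] := in_ultra_setVsetC [set n | (n0 <= n)%N] uw.
exfalso; apply: fw h; apply: (@sub_finite_set _ _ `I_n0); last exact: finite_II.
by move=> n /= /negP; rewrite -ltnNge.
Qed.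

Lemma filter_seq (I : eqType) (s : seq I) (P : I -> set nat) :
  (forall i, i \in s -> w (P i)) -> w [set n | forall i, i \in s -> P i n].
Proof.
elim: s => [_|i s ih h]; first by apply: filterS filterT.
have h1 := h i (mem_head _ _).
have h2 : w [set n | forall j, j \in s -> P j n] by apply: ih => j js; apply: h; rewrite inE js orbT.
apply: filterS (filterI h1 h2) => n [/= p1 p2] j; rewrite inE => /orP[/eqP ->|] //.
exact: p2.
Qed.

Lemma w_nullP (x : nat -> T) : w_null w (x : nat -> A) <-> forall e, 0 < e -> w [set n | N (x n) < e].
Proof.
split=> [h e e0|h e e0].
  have := h (e%:C)%C; rewrite ltcR => /(_ e0); apply: filterS => n /=.
  by rewrite (nmE (x n)) ltcR.
have [r0 _] := complex_gt0 e0; apply: filterS (h _ r0) => n /=.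
by rewrite (norm_lt_complex (x n)).
Qed.

Lemma in_relcommP B (x : nat -> T) : in_relcomm S w B x <->
  (exists M : R, forall n, N (x n) <= M) /\
  forall b, B b -> forall e, 0 < e -> w [set n | N (cm (x n) b) < e].
Proof.
split=> [[[M hM] h]|[[M hM] h]]; split.
- exists (complex.Re M) => n; have := hM n; rewrite (nmE (x n)).
  by case: (M) => u v; rewrite lecE /= => /andP[].
- by move=> b Bb; have := h b Bb; rewrite -/(cm _ _) => /w_nullP.
- by exists (M%:C)%C => n; rewrite (nmE (x n)) lecR.
- by move=> b Bb; apply/w_nullP => e e0; apply: h.
Qed.

(** Real rank zero gives [y] and an inverse [z] as bounded sequences, and their bounds fix the
    constant of [projection_step] before any index is chosen. At [w]-almost every index the
    self-adjoint part of [y n] is close to [y n] and has an exact inverse. *)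
Lemma real_rank_zero_projection B (k : nat -> T) t e (bs : seq T) :
  relcomm_real_rank_zero S w B -> 0 < t -> 0 < e ->
  (forall n, st (k n) = k n /\ N (k n) <= 1) ->
  (forall b, B b -> forall e, 0 < e -> w [set n | N (cm (k n) b) < e]) ->
  (forall b, b \in bs -> B b) ->
  w [set n | exists q m, [/\ proj q, q = k n * m * k n, N m <= 2 / t, N ((1 - q) * k n) ^+ 2 <= 2 * t &
    forall b, b \in bs -> N (cm q b) < e]].
Proof.
move=> rr0 t0 e0 hk ck hbs.
pose x n := k n * k n - t%:A.
have rx : in_relcomm S w B x.
  apply/in_relcommP; split.
    exists (1 * 1 + t) => n; apply: nmB2; last by rewrite nm_alg gtr0_norm.
    by apply: nmM2; case: (hk n).
  move=> b Bb e' e'0; apply: filterS (ck b Bb (e' / 2) (divr_gt0 e'0 (ltr0n _ 2))) => n /= h.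
  have -> : cm (x n) b = cm (k n * k n) b by rewrite /x cmDl cmNl cm_algl subr0.
  apply: le_lt_trans (_ : 1 * N (cm (k n) b) + N (cm (k n) b) * 1 < e'); last lra.
  by apply: nm_cmM; case: (hk n).
have sx : w_null w (fun n => cadj S (x n) - x n).
  apply/w_nullP => e' e'0; apply: filterS filterT => n _ /=.
  have -> : cadj S (x n) - x n = 0 :> T.
    rewrite -[cadj S (x n)]/(st (x n)) /x stB stM st_alg; case: (hk n) => -> _.
    by rewrite subrr.
  by rewrite nm0.
have [|y [ry sy [z [rz yz zy]] xy]] := rr0 x rx sx ((t / 8)%:C)%C; first by rewrite ltcR divr_gt0.
have /in_relcommP[[M hM] cy] := ry.
have /in_relcommP[[L hL] _] := rz.
have M0 : 0 <= M := le_trans (nm_ge0 _) (hM 0%N).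
have L0 : 0 <= L := le_trans (nm_ge0 _) (hL 0%N).
pose Bs := \sum_(b <- bs) N b.
have Bs0 : 0 <= Bs by apply: sumr_ge0 => b _; exact: nm_ge0.
have Bsb b : b \in bs -> N b <= Bs.
  by move=> bb; rewrite /Bs (big_rem b) //= lerDl; apply: sumr_ge0 => c _; exact: nm_ge0.
have M1 : 0 < M + 1 by lra.
have L1 : 0 < 2 * (L + 1) by lra.
have B1 : 0 < Bs + 1 by lra.
have e10 : 0 < e / (2 * (Bs + 1)) by rewrite divr_gt0 // mulr_gt0.
have [C C0 hC] := @projection_step _ _ S _ _ _ _ M1 L1 t0 e10.
have C1 : 0 < C + 1 by lra.
pose th := e / (8 * (C + 1)); have th0 : 0 < th by rewrite divr_gt0 // mulr_gt0.
(* Tolerance for the non-self-adjoint part of [y n]: small against commutators with [bs], against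
   [t], and against the bound [L] of the inverse. *)
pose sg := Num.min (th / (Bs + 1)) (Num.min (t / 8) (4 * (L + 1))^-1).
have sg0 : 0 < sg.
  rewrite !lt_min; apply/and3P; split.
  - exact: divr_gt0.
  - exact: divr_gt0.
  - by rewrite invr_gt0; lra.
have sgB : sg * (Bs + 1) <= th by rewrite -ler_pdivlMr // ge_min lexx.
have sgt : sg <= t / 8 by rewrite !ge_min lexx !orbT.
have sgL : sg * (4 * (L + 1)) <= 1.
  have L4 : 0 < 4 * (L + 1) by lra.
  by rewrite -ler_pdivlMr // mul1r !ge_min lexx !orbT.
have h1 : w [set n | forall b, b \in bs -> N (cm (k n) b) < th].
  by apply: filter_seq => b bb; apply: ck => //; apply: hbs.
have h2 : w [set n | forall b, b \in bs -> N (cm (y n : T) b) < th].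
  by apply: filter_seq => b bb; apply: cy => //; apply: hbs.
have /w_nullP/(_ _ sg0) h3 := sy.
have /w_nullP/(_ 4^-1) := yz; rewrite invr_gt0 => /(_ (ltr0n _ 4)) h4.
apply: filterS (filterI h1 (filterI h2 (filterI h3 (filterI h4 xy)))) => n.
move=> [/= g1 [g2 [g3 [g4 g5]]]].
have [sk k1] := hk n.
set Y : T := y n in g2 g3 g4 g5 *; set Z : T := z n in g4 *.
have YM : N Y <= M by exact: hM. have ZL : N Z <= L by exact: hL.
rewrite -[cadj S (y n)]/(st Y) -/Y in g3.
rewrite -[cmul S (y n) (z n)]/(Y * Z) -[cone S]/(1 : T) in g4.
have {}g5 : N (x n - Y) < t / 8.
  by move: g5; rewrite (nmE (x n - Y)) ltcR.
pose Y' := 2^-1 *: (Y + st Y).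
have sY' : st Y' = Y' by rewrite /Y' stZ stD stK addrC.
have dY : N (Y' - Y) <= sg / 2.
  have -> : Y' - Y = 2^-1 *: (st Y - Y).
    transitivity (Y' - (2^-1 *: Y + 2^-1 *: Y)); first by rewrite half_addr.
    by rewrite /Y' scalerDr scalerBr; ncring.
  by rewrite nmZ gtr0_norm ?invr_gt0 // mulrC ler_pM2r ?invr_gt0 // ltW.
have Y'M : N Y' <= M + 1.
  rewrite /Y' nmZ gtr0_norm ?invr_gt0 // ler_pdivrMl //.
  by apply: le_trans (nmD2 YM (_ : N (st Y) <= M)) _; rewrite ?nm_adj //; keep M0; lra.
have s1 : N (1 - Y' * Z) <= 2^-1.
  have -> : 1 - Y' * Z = - (Y * Z - 1) - (Y' - Y) * Z by ncring.
  apply: (@le_trans _ _ (4^-1 + sg / 2 * L)).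
    by apply: nmB2; [rewrite nmN ltW | apply: nmM2].
  keep sgL sg0 L0; nra.
have [|v [v1 _ vN]] := neumann s1; first by rewrite invf_lt1 // ltr1n.
have e2 : 1 - (1 - Y' * Z) = Y' * Z by ncring.
rewrite e2 -mulrA in v1.
(* The adjoint of a right inverse of [Y'] is a left inverse, so the two coincide. *)
have syi : st (Z * v) = Z * v.
  have h : st (Z * v) * Y' = 1 by rewrite -{1}sY' -stM v1 st1.
  by rewrite -[LHS]mulr1 -v1 [LHS]mulrA h mul1r.
have v2 : Z * v * Y' = 1 by rewrite -syi -{1}sY' -stM v1 st1.
have vL : N (Z * v) <= 2 * (L + 1).
  have vN' : N v <= 2 by apply: le_trans vN _; rewrite (_ : (1 - 2^-1)^-1 = 2 :> R) //; field.
  by apply: le_trans (nmM2 ZL vN') _; keep L0; lra.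
have hE : N (Y' - (k n * k n - t%:A)) <= t / 2.
  have -> : Y' - (k n * k n - t%:A) = (Y' - Y) - (x n - Y) by rewrite /x; ncring.
  apply: (@le_trans _ _ (sg / 2 + t / 8)); last by keep sgt t0; lra.
  by apply: nmB2 => //; exact: ltW.
have [q [m [pq qE mN qk hq]]] := hC _ _ _ sk k1 sY' v1 v2 Y'M vL hE.
exists q, m; split => // b bb.
apply: le_lt_trans (hq b) _.
have nb0 : 0 <= N b by exact: nm_ge0. have bB := Bsb b bb.
have c1 : N (cm (k n) b) <= th by apply/ltW/g1.
have c2 : N (cm Y' b) <= 2 * th.
  apply: le_trans (nm_cm_sub Y' Y b) _.
  have : N (Y' - Y) * (2 * N b) <= sg / 2 * (2 * Bs).
    by apply: ler_pM => //; rewrite ?nm_ge0 ?mulr_ge0 // ler_pM2l.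
  have sgBs : sg * Bs <= th by apply: le_trans sgB; rewrite ler_wpM2l ?(ltW sg0) // lerDl.
  have := ltW (g2 b bb); keep sgBs; lra.
have c3 : C * (N (cm (k n) b) + N (cm Y' b)) <= C * (3 * th).
  by rewrite ler_wpM2l //; keep c1 c2; lra.
have c4 : C * (3 * th) < e / 2.
  rewrite /th; keep C0 C1 e0.
  have -> : C * (3 * (e / (8 * (C + 1)))) = 3 / 8 * e * (C / (C + 1)) by field; lra.
  have : C / (C + 1) <= 1 by rewrite ler_pdivrMr //; lra.
  nra.
have c5 : e / (2 * (Bs + 1)) * N b <= e / 2.
  keep bB B1 e0.
  have -> : e / (2 * (Bs + 1)) * N b = e / 2 * (N b / (Bs + 1)) by field; lra.
  rewrite -[leRHS]mulr1 ler_pM2l ?divr_gt0 // ler_pdivrMr //; lra.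
keep c3 c4 c5; lra.
Qed.
End Ultra.

(** * Rokhlin towers in terms of the real norm *)

Section Towers.
Context {R : realType} {A : completeNormedModType R[i]} {S : ucstar A}.
Context {G : finGroupType} {alpha : G -> A -> A}.
Local Notation T := (calg S).
Local Notation N := (@nm R A S).
Local Notation st := (@st R A S).
Local Notation al := (alpha : G -> T -> T).
Implicit Types (a b c d k m p q x y z : T) (r t e : R) (g : G) (f E : G -> T).

Definition tower (F : seq T) e x f :=
  [/\ forall g, Pos (f g), forall g, N (f g) <= 1 & forall g h, g != h -> f g * f h = 0] /\
  [/\ forall g a, a \in F -> N (cm (f g) a) < e, forall g h, N (al g (f h) - f (g * h)%g) < e,
      cuntz_le S (1 - \sum_g f g : T) x & 1 - e < N ((\sum_g f g) * (x * \sum_g f g))].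

Lemma towerP proj_ : rokhlin_towers S alpha proj_ <->
  forall (F : seq T) e, 0 < e -> forall x, Pos x -> N x = 1 ->
  exists f, tower F e x f /\ (proj_ -> forall g, proj (f g)).
Proof.
split=> h F e e0 x px x1.
  have [|||f [[h1 h2 h3] [h4 h5 h6 h7]]] := h F (e%:C)%C _ x.
  - by rewrite ltcR.
  - exact/positiveP.
  - by rewrite (nmE x) x1.
  exists (f : G -> T); split; last by move=> hp g; have := h2 g hp.
  split; split.
  - by move=> g; apply/positiveP; case: (h1 g).
  - by move=> g; have [_] := h1 g; rewrite /Defs.contraction (nmE (f g : T)) lecR.
  - by move=> g g' gg'; exact: h3.
  - by move=> g a aF; have := h4 g a aF; rewrite (nmE (cm (f g) (a : T))) ltcR.
  - by move=> g g'; have := h5 g g'; rewrite (nmE ((alpha g (f g') : T) - f (g * g')%g)) ltcR.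
  - exact: h6.
  - by move: h7; rewrite (nmE ((\sum_g (f g : T)) * ((x : T) * \sum_g (f g : T)))) -(rmorph1 (real_complex R)) -rmorphB ltcR.
have [er eE] := complex_gt0 e0.
have [||f [[[h1 h2 h3] [h4 h5 h6 h7]] hp]] := h F _ er x.
- exact/positiveP.
- by apply: (@complexI R); rewrite -(nmE (x : T)) x1.
exists f; split; split.
- move=> g; split; first exact/positiveP.
  by rewrite /Defs.contraction (nmE (f g)) lecR.
- by move=> g pp; exact: hp.
- by move=> g g' gg'; exact: h3.
- by move=> g a aF; rewrite (norm_lt_complex (cm (f g) a)) // h4.
- by move=> g g'; rewrite (norm_lt_complex (al g (f g') - f (g * g')%g)) // h5.
- exact: h6.
- rewrite eE -(rmorph1 (real_complex R)) -rmorphB.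
  by rewrite (nmE ((\sum_g f g) * ((x : T) * \sum_g f g))) ltcR.
Qed.
End Towers.

(** * From weak towers to projections *)

Section Core.
Context {R : realType} {A : completeNormedModType R[i]} {S : ucstar A}.
Context {G : finGroupType} {alpha : G -> A -> A} {w : set_system nat}.
Local Notation T := (calg S).
Local Notation N := (@nm R A S).
Local Notation st := (@st R A S).
Local Notation tow := (@tower R A S G alpha).
Local Notation al := (alpha : G -> T -> T).
Implicit Types (a b c d k m p q x y z : T) (r t e : R) (g : G) (f E : G -> T).

Hypothesis inf : infinite_dimensional A.
Hypothesis simp : simple_cstar S.
Hypothesis act : cstar_action S alpha.
Hypothesis free : free_ultrafilter w.

Lemma orth_sum x (V0 : T) (V : G -> T) : (forall g h, g != h -> V g * x * st (V h) = 0) ->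
  (forall g, V0 * x * st (V g) = 0) -> (forall g, V g * x * st V0 = 0) ->
  (V0 + \sum_g V g) * x * st (V0 + \sum_g V g) =
  V0 * x * st V0 + \sum_g V g * x * st (V g).
Proof.
move=> oV o1 o2; rewrite stD st_sum !mulrDl !mulrDr.
have -> : V0 * x * (\sum_g st (V g)) = 0 by rewrite mulr_sumr big1.
have -> : (\sum_g V g) * x * st V0 = 0 by rewrite !mulr_suml big1.
rewrite addr0 add0r; congr (_ + _); rewrite !mulr_suml; apply: eq_bigr => g _.
by rewrite mulr_sumr (bigD1 g) //= big1 ?addr0 // => h hg; rewrite oV // eq_sym.
Qed.

(* Room inside x for the |G| + 1 summands of the remainder. *)
Lemma orthogonal_room x : Pos x -> x != 0 -> exists x0 x1,
  [/\ Pos x0, N x0 = 1, Pos x1 & x1 != 0] /\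
  forall (v0 v1 : T) (r : R), 0 <= r -> exists W : T,
    W * x * st W = v0 * x0 * st v0 + \sum_g r *: al g (v1 * x1 * st v1).
Proof.
move=> px x0.
have [z [hz oz]] := orth_family #|G|.+1 inf simp px x0.
pose zg g := z (enum_rank g); pose z0 := z #|G|.
have ltg g : (enum_rank g < #|G|.+1)%N by rewrite ltnS ltnW.
have neg g : (enum_rank g : nat) != #|G| by rewrite neq_ltn ltn_ord.
pose y g := zg g * x * st (zg g).
have [p0 n0] := hz #|G| (ltnSn _).
(* Every translate [al g x1] must fit into the piece [y g], so [x1] is taken below all the
   [al g^-1 (y g)]. The last piece, of index [#|G|], is reserved for [x0] and normalised below. *)
have [|x1 [px1 nx1 hx1]] := @common_minorant _ _ S [seq al g^-1%g (y g) | g <- enum G] simp.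
  move=> _ /mapP[g _ ->]; have [pg ng] := hz _ (ltg g); split.
    by apply: aut_Pos => //; exact: (act_aut act).
  by rewrite -nm_eq0 (act_nm act) nm_eq0.
have /choice[u hu] : forall g, exists u, al g x1 = u * y g * st u.
  move=> g; have [|u ->] := hx1 (al g^-1%g (y g)); first by rewrite map_f // mem_enum.
  have aa := act_aut act g.
  by exists (al g u); rewrite !(autM aa) (aut_st aa) (actKV act).
set y0 := z0 * x * st z0; have ny0 : 0 < N y0 by rewrite nm_gt0.
exists ((N y0)^-1 *: y0), x1; split.
  split => //; first by apply: PosZ => //; rewrite invr_ge0 nm_ge0.
  by rewrite nmZ gtr0_norm ?invr_gt0 // mulVf // gt_eqF.
move=> v0 v1 r r0.
pose W0 := (Num.sqrt (N y0)^-1) *: (v0 * z0).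
pose W g := Num.sqrt r *: (al g v1 * u g * zg g).
have ss (t : R) : 0 <= t -> Num.sqrt t * Num.sqrt t = t by move=> t0; rewrite -expr2 sqr_sqrtr.
exists (W0 + \sum_g W g); rewrite orth_sum.
- congr (_ + _).
    rewrite /W0 stZ -!scalerAl -!scalerAr -!scalerAl scalerA ss ?invr_ge0 ?nm_ge0 //.
    by congr (_ *: _); rewrite stM /y0 !mulrA.
  apply: eq_bigr => g _; have aa := act_aut act g.
  rewrite /W stZ -!scalerAl -!scalerAr scalerA ss // !(autM aa) (aut_st aa) hu.
  by congr (_ *: _); rewrite !stM /y !mulrA.
- move=> g h gh; rewrite /W stZ -!scalerAl -!scalerAr.
  have o : zg g * x * st (zg h) = 0.
    by apply: oz => //; apply: contra_neq gh => /val_inj/enum_rank_inj.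
  have -> : al g v1 * u g * zg g * x * st (al h v1 * u h * zg h) =
    al g v1 * u g * (zg g * x * st (zg h)) * st (al h v1 * u h) by rewrite !stM !mulrA.
  by rewrite o mulr0 mul0r !scaler0.
- move=> g; rewrite /W0 /W stZ -!scalerAl -!scalerAr.
  have o : z0 * x * st (zg g) = 0 by apply: oz => //; rewrite eq_sym.
  have -> : v0 * z0 * x * st (al g v1 * u g * zg g) =
    v0 * (z0 * x * st (zg g)) * st (al g v1 * u g) by rewrite !stM !mulrA.
  by rewrite o mulr0 mul0r !scaler0.
- move=> g; rewrite /W0 /W stZ -!scalerAl -!scalerAr.
  have o : zg g * x * st z0 = 0 by apply: oz.
  have -> : al g v1 * u g * zg g * x * st (v0 * z0) =
    al g v1 * u g * (zg g * x * st z0) * st v0 by rewrite !stM !mulrA.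
  by rewrite o mulr0 mul0r !scaler0.
Qed.

Hypothesis weak : weak_tracial_rokhlin S alpha.

(** The [n]-th tower is almost central for [L] and for the first [n + 1] points of a dense sequence
    in [B], with tolerance [1 / (n + 1)]. As [h] commutes with [B], the commutator of [h f h] with a
    dense point is [h] times that of [f] times [h]. *)
Lemma tower_sequence (B : set A) (h x0 : T) (L : seq T) :
  separable B -> commutes_with S B h -> st h = h -> N h <= 1 -> Pos x0 -> N x0 = 1 ->
  exists f : nat -> G -> T, (forall n, tow L n.+1%:R^-1 x0 (f n)) /\
  forall b, B b -> forall e, 0 < e -> w [set n | N (cm (h * f n 1%g * h) b) < e].
Proof.
move=> [d [dB dd]] hB sh h1 px0 nx0.
have /towerP hw := weak; have wF := free_proper free.
have /choice[f hf] : forall n, exists f : G -> T,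
    tow (L ++ [seq (d j : T) | j <- iota 0 n.+1]) n.+1%:R^-1 x0 f.
  move=> n; have [|f [tf _]] := hw (L ++ [seq (d j : T) | j <- iota 0 n.+1]) n.+1%:R^-1 _ x0 px0 nx0.
    by rewrite invr_gt0.
  by exists f.
exists f; split.
  move=> n; have [H1 [H2 H3 H4 H5]] := hf n; split => //; split => // g a aL.
  by apply: H2; rewrite mem_cat aL.
move=> b Bb e e0.
have /(@closureP _ _ S) hb := dd b Bb.
have e8 : 0 < e / 8 by rewrite divr_gt0.
have [_ [j _ <-] hj] := hb _ e8.
have [n0 hn0] := inv_small 2 e0.
apply: filterS (free_tail free (maxn j n0.+1)) => n /=; rewrite geq_max => /andP[jn nn].
have [[_ fN _] [fc _ _ _]] := hf n.
have c1 : N (cm (f n 1%g) (d j)) < n.+1%:R^-1.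
  by apply: fc; rewrite mem_cat map_f ?orbT // mem_iota.
have c2 : n.+1%:R^-1 <= e / 2.
  have : n.+1%:R^-1 <= n0.+2%:R^-1 :> R by rewrite lef_pV2 ?posrE ?ltr0n // ler_nat ltnS.
  by move=> hh; apply: le_trans hh _; rewrite ler_pdivlMr // mulrC.
have hd : h * (d j : T) = (d j : T) * h by exact: hB.
set dj : T := d j in hd hj c1; clearbody dj.
set f1 := f n 1%g in c1 fN *; have f1N : N f1 <= 1 by exact: fN.
have -> : cm (h * f1 * h) b = h * cm f1 dj * h + cm (h * f1 * h) (b - dj).
  transitivity (cm (h * f1 * h) dj + cm (h * f1 * h) (b - dj)); first by rewrite /cm; ncring.
  congr (_ + _); rewrite /cm.
  transitivity (h * f1 * (h * dj) - dj * h * f1 * h); first by ncring.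
  by rewrite hd; transitivity (h * f1 * (dj * h) - h * dj * f1 * h); [rewrite hd | ncring].
have k1 : N (h * f1 * h) <= 1 * 1 * 1 by apply: nmM2 => //; apply: nmM2.
apply: le_lt_trans (_ : 1 * n.+1%:R^-1 * 1 + (1 * 1 * 1 * (e / 8) + e / 8 * (1 * 1 * 1)) < e);
  last by move: c2; move: (n.+1%:R^-1) => r c2; lra.
apply: nmD2; first by apply: nmM2 => //; apply: nmM2 => //; exact: ltW.
by apply: nmB2; apply: nmM2 => //; exact: ltW.
Qed.

Hypothesis approx : forall (F : seq A) (e : R[i]), 0 < e -> forall x : A,
     positive S x -> x != 0 ->
     exists (B : set A) (c : A),
       [/\ cstar_subalgebra S B, separable B,
           positive S c /\ `|c| = 1 & commutes_with S B c]
       /\ [/\ forall a, a \in F -> `|cmul S c a - cmul S a c| < e,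
           forall a, a \in F -> exists b, B b /\ `|cmul S c a - b| < e,
           cuntz_le S (cone S - c) x
         & relcomm_real_rank_zero S w B].

Lemma approximating_subalgebra (F : seq T) e x : 0 < e -> Pos x -> x != 0 ->
  exists (B : set A) c,
    [/\ separable B, commutes_with S B c, relcomm_real_rank_zero S w B, Pos c & N c = 1] /\
    [/\ forall a, a \in F -> N (cm c a) < e,
        forall a, a \in F -> exists2 b : T, B b & N (c * a - b) < e &
        forall t, 0 < t -> exists v, N ((1 - c) - v * x * st v) < t].
Proof.
move=> e0 px x0; have [||B [c [[_ sepB [pc c1] cB] [h1 h2 h3 h4]]]] := @approx F (e%:C)%C _ x _ x0.
- by rewrite ltcR.
- exact/positiveP.
exists B, (c : T); split; first split => //.
- exact/positiveP.
- by apply: (@complexI R); rewrite -(nmE (c : T)).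
split.
- by move=> a aF; have := h1 a aF; rewrite (nmE (cm (c : T) a)) ltcR.
- move=> a aF; have [b [Bb hb]] := h2 a aF; exists b => //.
  by move: hb; rewrite (nmE ((c : T) * a - b)) ltcR.
by move=> t t0; exact: cuntz_leE h3 t0.
Qed.

Lemma sum_proj E : (forall g, proj (E g)) -> (forall g h, g != h -> E g * E h = 0) ->
  proj (\sum_g E g) /\ forall g, E g * \sum_h E h = E g.
Proof.
move=> pE oE.
have EE g : E g * \sum_h E h = E g.
  rewrite mulr_sumr (bigD1 g) //= (proj2 (pE g)) big1 ?addr0 // => h hg.
  by rewrite oE // eq_sym.
split => //; split.
  by rewrite st_sum; apply: eq_bigr => g _; case: (pE g).
by rewrite mulr_suml; apply: eq_bigr => g _; exact: EE.
Qed.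

Local Tactic Notation "keep" ne_hyp_list(Hs) := revert Hs; clear -S inf simp act free weak approx; intros.

(** [h = (1 - d/r)_+] for [d = 1 - c]. The remainder [w0 = (d - r)_+] is recorded because it turns
    [1 - h <= d / r] into an identity with a positive slack. *)
Lemma spectral_cut c r : Pos c -> N c = 1 -> 0 < r < 1 -> exists h w0 : T,
  [/\ Pos h, N h <= 1, h != 0 & 1 - h = r^-1 *: (1 - c - w0)] /\
  [/\ Pos w0, forall u, N ((1 - c) * (h * u)) <= r * N (h * u) &
    forall z, GRing.comm c z -> GRing.comm h z].
Proof.
move=> pc c1 /[dup] r01 /andP[r0 r1]; have sc := Pos_sa pc.
have pd : Pos (1 - c) by rewrite -[1]scale1r; apply: Pos_of_nm; rewrite ?c1.
have [w0 [w1 [[pw0 pw1 dE _] [_ w1N dw1 hdw1 w1c]]]] := cutoff pd r0.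
have w1n0 : w1 != 0 by exact: (cutoff_neq0 pc r01 c1 pw0 dE).
exists (r^-1 *: w1), w0; split; split => //.
- by apply: PosZ => //; rewrite invr_ge0 ltW.
- by rewrite nmZ gtr0_norm ?invr_gt0 // ler_pdivrMl // mulr1.
- by rewrite scaler_eq0 negb_or invr_eq0 gt_eqF.
- have -> : 1 - c - w0 = r%:A - w1 by rewrite -[1 - c](subrK r%:A) dE; ncring.
  by rewrite scalerBr scalerA mulVf ?gt_eqF // scale1r.
- move=> u; have -> : (1 - c) * (r^-1 *: w1 * u) = (r%:A - w1) * (r^-1 *: w1 * u).
    by rewrite -!scalerAl -!scalerAr !mulrA dw1.
  exact: nmM2.
move=> z cz; have wz : GRing.comm w1 z.
  by apply: w1c; apply/commr_sym/commrB; [exact: commr1 | exact/commr_sym].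
by rewrite /GRing.comm -scalerAl -scalerAr wz.
Qed.

Lemma projection_towers (F : seq T) e x : 0 < e -> Pos x -> N x = 1 -> exists E,
  [/\ forall g, proj (E g), forall g h, g != h -> E g * E h = 0 & E 1%g != 0] /\
  [/\ forall g a, a \in F -> N (cm (E g) a) < e,
      forall g h, N (al g (E h) - E (g * h)%g) < e & cuntz_le S (1 - \sum_g E g : T) x].
Proof.
move=> e0 px x1.
pose nG : R := #|G|%:R; have n1 : 1 <= nG by exact: nG1.
have n0 : 0 < nG by lra.
have xN0 : x != 0 by rewrite -nm_gt0 x1.
have [y0 [y1 [[py0 ny0 py1 ny1] room]]] := orthogonal_room px xN0.
pose Am := 1 + \sum_(a <- F) N a.
have Am1 : 1 <= Am by rewrite /Am lerDl; apply: sumr_ge0 => a _; exact: nm_ge0.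
have Am0 : 0 < Am by lra.
have AmF a : a \in F -> N a <= Am.
  move=> aF; rewrite /Am (big_rem a) //= addrCA lerDl addr_ge0 //.
  by apply: sumr_ge0 => c _; exact: nm_ge0.
(* [al g q] commutes with [a] as well as [q] does with [al g^-1 a]. *)
pose F' := [seq al g^-1%g a | g <- enum G, a <- F].
have F'P g a : a \in F -> al g^-1%g a \in F'.
  by move=> aF; apply/allpairsP; exists (g, a); rewrite mem_enum.
pose e1 := e / 16; have e10 : 0 < e1 by rewrite divr_gt0.
pose e2 := e / (16 * Am); have e20 : 0 < e2 by rewrite divr_gt0 // mulr_gt0.
have e2A : e2 * Am = e1 by rewrite /e2 /e1; field; lra.
(* On the range of [h] the element [d] is at most [dl], so multiplying [q] by [c] moves it by at
   most [dl]; against elements of norm at most [Am] this costs [e/16]. *)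
pose dl := Num.min 2^-1 e2.
have dl0 : 0 < dl by rewrite lt_min invr_gt0 ltr0n.
have dl1 : dl <= 2^-1 by rewrite ge_min lexx.
have dle : dl <= e2 by rewrite ge_min lexx orbT.
have [B [c [[sepB cB rr0 pc c1] [cF bF cz]]]] := @approximating_subalgebra F' e1 y1 e10 py1 ny1.
pose d := 1 - c.
have [|h [w0 [[ph h1 hNZ hE] [pw0 hd hcomm]]]] := spectral_cut pc c1 (_ : 0 < dl < 1).
  by rewrite dl0 (le_lt_trans dl1) // invf_lt1 // ltr1n.
have sh := Pos_sa ph; have sc := Pos_sa pc.
have pd : Pos d by rewrite /d -[1]scale1r; apply: Pos_of_nm; rewrite ?c1.
have hB : commutes_with S B h.
  by move=> b Bb; apply: (hcomm (b : T)); exact: cB.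
have hn0 : h * h != 0 by rewrite -nm_eq0 -{1}sh nm_stM expf_neq0 // nm_eq0.
have [l hl] := simple_full simp hn0.
pose K := \sum_(u <- l) N u.1 * N u.2; pose Ka := \sum_(u <- l) N u.1.
have K0 : 0 <= K by apply: sumr_ge0 => u _; rewrite mulr_ge0 // nm_ge0.
have Ka0 : 0 <= Ka by apply: sumr_ge0 => u _; exact: nm_ge0.
(* Lower bound for [N k]: [1 / (4 |G|) <= N (f 1)] goes through [compressed_nm], and half of it is
   given up to the errors in [eta]. *)
pose kap := (8 * nG * (K + 1))^-1.
have k8 : 0 < 8 * nG * (K + 1) by rewrite !mulr_gt0 // ltr_wpDl.
have kap0 : 0 < kap by rewrite invr_gt0.
pose tau := Num.min (64 * nG)^-1 (kap / 2).
have tau0 : 0 < tau by rewrite lt_min invr_gt0 mulr_gt0 // divr_gt0.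
have tau1 : tau * (64 * nG) <= 1.
  have n64 : 0 < 64 * nG by rewrite mulr_gt0.
  by rewrite -ler_pdivlMr // mul1r ge_min lexx.
have tauk : tau < kap by apply: (@le_lt_trans _ _ (kap / 2)); [rewrite ge_min lexx orbT | keep kap0; lra].
(* Makes [2 t = tau^2], the bound for the square of [N ((1 - q) k)]; then [tau < kap] forces [q] to
   be nonzero. *)
pose t := tau ^+ 2 / 2.
have t0 : 0 < t by rewrite divr_gt0 // exprn_gt0.
have t1 : t <= 1.
  rewrite /t; keep tau0 tau1 n1; have : tau <= 1 by nra.
  nra.
have [|v1 hv1] := cz (dl / (16 * nG)); first by rewrite divr_gt0 // mulr_gt0.
(* [e3] and [mu] reach the final comparison with a factor [|G|^2]: one from summing over the tower,
   one from summing over translates of [k]. *)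
pose iq := (64 * nG ^+ 2)^-1.
have iq0 : 0 < iq by rewrite invr_gt0 mulr_gt0 // exprn_gt0.
have iqE : nG * (nG * iq) = 64^-1 by rewrite /iq; keep n0; field; lra.
pose e3 := Num.min e2 (Num.min iq 2^-1).
have e30 : 0 < e3 by rewrite !lt_min e20 iq0 invr_gt0 ltr0n.
have e32 : e3 <= e2 by rewrite ge_min lexx.
have e3i : e3 <= iq by rewrite !ge_min lexx !orbT.
have e3h : e3 <= 2^-1 by rewrite !ge_min lexx !orbT.
have [t3 t30 ortho] := @orthogonalize _ _ S _ (enum G) e3 e30 (enum_uniq G).
pose mu := Num.min t3 iq.
have mu0 : 0 < mu by rewrite lt_min t30.
have mu3 : mu <= t3 by rewrite ge_min lexx.
have mui : mu <= iq by rewrite ge_min lexx orbT.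
(* The first two bounds keep [f 1] large, the second also serving the final comparison; the third is
   for compression by [h], the last for orthogonality of translates, where [m] costs [(2/t)^2]. *)
pose eta := Num.min 2^-1 (Num.min (16 * nG)^-1 (Num.min (8 * nG * (K + Ka + 1))^-1 (t ^+ 2 * mu / 8))).
have KK : 0 < K + Ka + 1 by rewrite ltr_wpDl ?addr_ge0.
have eta0 : 0 < eta.
  rewrite !lt_min; apply/and4P; split; first by rewrite invr_gt0.
  - by rewrite invr_gt0 mulr_gt0.
  - by rewrite invr_gt0 !mulr_gt0.
  - by rewrite divr_gt0 // mulr_gt0 // exprn_gt0.
have eta1 : eta <= 2^-1 by rewrite ge_min lexx.
have eta2 : eta <= (16 * nG)^-1 by rewrite !ge_min lexx !orbT.
have eta3 : eta <= (8 * nG * (K + Ka + 1))^-1 by rewrite !ge_min lexx !orbT.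
have eta4 : eta <= t ^+ 2 * mu / 8 by rewrite !ge_min lexx !orbT.
(* Almost commuting with [h] and the [u.2] bounds [k] from below; almost commuting with [h * al g h]
   makes the translates of [k] almost orthogonal. *)
pose L := h :: [seq u.2 | u <- l] ++ [seq h * al g h | g <- enum G].
have [f [tf fB]] := @tower_sequence B h y0 L sepB hB sh h1 py0 ny0.
have /choice[bf hbf] : forall a, exists b : T, a \in F' -> B b /\ N (c * a - b) < e1.
  move=> a; case: (boolP (a \in F')) => [aF|]; last by exists 0.
  by have [b Bb hb] := bF a aF; exists b.
have kn n : st (h * f n 1%g * h) = h * f n 1%g * h /\ N (h * f n 1%g * h) <= 1.
  have [[pf fN _] _] := tf n; split; first by rewrite !stM sh (Pos_sa (pf _)) mulrA.
  apply: (@le_trans _ _ (1 * 1 * 1)); last by rewrite !mulr1.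
  by apply: nmM2 => //; apply: nmM2.
have bsB b : b \in [seq bf a | a <- F'] -> B b.
  by move=> /mapP[a aF' ->]; case: (hbf a aF').
have near_n := real_rank_zero_projection free rr0 t0 e10 kn fB bsB.
have [n0' hn0'] := inv_small 1 eta0.
have wF := free_proper free.
have [n [/= [q [m [pq qE mN qk hq]]] nn]] := filter_ex (filterI near_n (free_tail free n0'.+1)).
have ne : n.+1%:R^-1 <= eta.
  have : n.+1%:R^-1 <= n0'.+2%:R^-1 :> R by rewrite lef_pV2 ?posrE ?ltr0n // ler_nat ltnS.
  by move=> hh; apply: le_trans hh _; rewrite -div1r.
have [[pf fN of_] [fc fa fz fx]] := tf n.
have {}fc g a : a \in L -> N (cm (f n g) a) <= eta.
  by move=> aL; apply/ltW/(lt_le_trans _ ne)/fc.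
have {}fa g g' : N (al g (f n g') - f n (g * g')%g) <= eta by apply/ltW/(lt_le_trans _ ne)/fa.
have fa1 g : N (al g (f n 1%g) - f n g) <= eta by have := fa g 1%g; rewrite mulg1.
have f1n : (4 * nG)^-1 <= N (f n 1%g).
  apply: (tower_nm act ny0 eta1 _ fa1); last by apply: le_lt_trans fx; rewrite lerD2l lerN2.
  by apply: le_trans eta2 _; rewrite lef_pV2 ?posrE ?mulr_gt0 // ler_pM2r // ler_nat.
set k := h * f n 1%g * h in qE qk kn.
have k1 : N k <= 1 by case: (kn n).
have kN : kap <= N k.
  have := @compressed_nm _ _ S l h (f n 1%g) eta hl h1.
  rewrite -/k -/K -/Ka => H.
  have {}H : N (f n 1%g) <= K * (N k + eta) + eta * Ka.
    apply: H; first by apply: fc; rewrite mem_head.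
    by move=> u ul; apply: fc; rewrite inE mem_cat map_f ?orbT.
  have hk : eta * (8 * nG * (K + Ka + 1)) <= 1.
    by rewrite -ler_pdivlMr ?mul1r // !mulr_gt0.
  have E4 : nG * (4 * nG)^-1 = 4^-1 by keep n0; field; lra.
  have h4 : 4^-1 <= nG * (K * (N k + eta) + eta * Ka).
    by rewrite -E4 ler_pM2l // (le_trans f1n).
  rewrite /kap -div1r ler_pdivrMr //.
  have nk0 : 0 <= nG * N k by rewrite mulr_ge0 ?nm_ge0 // ltW.
  have ne0 : 0 <= eta * nG by rewrite mulr_ge0 // ltW.
  keep h4 hk nk0 ne0; lra.
have qkN : N ((1 - q) * k) <= tau.
  rewrite -(ler_pXn2r (n := 2)) ?nnegrE ?nm_ge0 ?(ltW tau0) //.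
  by apply: le_trans qk _; rewrite /t mulrC divfK.
have q0 : q != 0.
  apply/eqP => q0; move: qkN; rewrite q0 subr0 mul1r => h5.
  by have := lt_le_trans tauk (le_trans kN h5); rewrite ltxx.
have [sq qq] := pq; have q1 := proj_nm pq.
have qo g : g != 1%g -> N (q * al g k) <= mu /\ N (q * al g q) <= mu.
  move=> g1; have [] := @compressed_orth _ _ S _ _ act (f n) h m (2 / t) eta g g1 h1 (fN) _ (fa1 g) _ mN.
  - by apply: of_; rewrite eq_sym.
  - apply: fc; have hg : h * al g h \in [seq h * al g' h | g' <- enum G].
      by apply/mapP; exists g; rewrite ?mem_enum.
    by rewrite inE mem_cat hg !orbT.
  rewrite -/k -qE => b1 b2.
  have E8 : 2 / t * (2 * eta) * (2 / t) <= mu.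
    have -> : 2 / t * (2 * eta) * (2 / t) = 8 * eta / t ^+ 2 by keep t0; field; lra.
    by rewrite ler_pdivrMr ?exprn_gt0 //; keep eta4; lra.
  split; last exact: le_trans b2 E8.
  apply: le_trans b1 _; apply: le_trans E8.
  rewrite ler_peMr //; first by rewrite !mulr_ge0 // ?invr_ge0 // ltW.
  by rewrite ler_pdivlMr //; keep t1; lra.
have [||E [hEE oE]] := ortho (fun g => al g q).
- by move=> g _; apply: act_proj.
- move=> g g' _ _ gg'; have -> : al g q * al g' q = al g (q * al (g^-1 * g')%g q).
    by rewrite (autM (act_aut act g)) -(actM act) mulKVg.
  rewrite (act_nm act); apply: le_trans mu3; apply: (proj2 (qo _ _)).
  by apply: contra_neq gg' => hh; rewrite -[g'](mulKVg g) hh mulg1.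
have pE g : proj (E g) by case: (hEE g (mem_enum _ _)).
have Eq g : N (E g - al g q) <= e3 by case: (hEE g (mem_enum _ _)).
have {}oE g g' : g != g' -> E g * E g' = 0 by apply: oE; exact: mem_enum.
have [psE _] := sum_proj pE oE.
exists E; split; split => //.
- apply/eqP => E0; have := Eq 1%g; rewrite E0 sub0r nmN (act_nm act) (proj_nm1 pq q0) => hh.
  by have := le_trans hh e3h; rewrite leNgt invf_lt1 ?ltr1n.
- move=> g a aF; apply: le_lt_trans (nm_cm_sub _ (al g q) a) _.
  set a' := al g^-1%g a; have a'F : a' \in F' by exact: F'P.
  have -> : cm (al g q) a = al g (cm q a') by rewrite (act_cm act) (actKV act).
  rewrite (act_nm act).
  have na : N a <= Am by exact: AmF.
  have na' : N a' <= Am by rewrite (act_nm act).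
  have [_ hb] := hbf a' a'F.
  have dq : N (d * q) <= dl.
    have qh : q = h * (f n 1%g * h * m * k) by rewrite qE /k !mulrA.
    rewrite qh; apply: le_trans (hd _) _; rewrite -qh -[leRHS]mulr1.
    by rewrite ler_wpM2l // ltW.
  have c2 := @commutator_transfer _ _ S c d q a' (bf a') dl e1 erefl (Pos_sa pd) sq q1 dq (ltW hb) (ltW (cF _ a'F)).
  have c3 : N (cm q (bf a')) < e1 by apply: hq; rewrite map_f.
  have na0 : 0 <= N a by exact: nm_ge0. have na'0 : 0 <= N a' by exact: nm_ge0.
  have c4 : dl * N a' <= e1.
    by rewrite -e2A; apply: ler_pM => //; exact: ltW.
  have c5 : N (E g - al g q) * N a <= e1.
    by rewrite -e2A; apply: ler_pM => //; rewrite ?nm_ge0 //; apply: le_trans (Eq g) e32.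
  have e16 : 16 * e1 = e by rewrite /e1; field.
  keep c2 c3 c4 c5 e16 e10; lra.
- move=> g g'.
  have -> : al g (E g') - E (g * g')%g = al g (E g' - al g' q) - (E (g * g')%g - al (g * g')%g q).
    by rewrite (autB (act_aut act g)) -(actM act) opprB subrKA.
  apply: (@le_lt_trans _ _ (e3 + e3)); first by apply: nmB2; rewrite ?(act_nm act).
  have : e2 <= e1 by rewrite -e2A ler_peMr // ltW.
  have e16 : 16 * e1 = e by rewrite /e1; field.
  keep e16 e32 e10; lra.
have [|v0 hv0] := cuntz_leE fz (_ : 0 < 16^-1); first by rewrite invr_gt0.
have [|W hW] := room v0 v1 (2 / dl); first by rewrite divr_ge0 // ltW.
pose rho := tau + nG * (e3 + mu).
have hrho g : N ((1 - \sum_g E g) * al g k) <= rho.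
  by apply: (@remainder_nm _ _ S _ _ act E k q) => //; [exact: ltW | move=> g' g1; case: (qo g' g1)].
have rho1 : nG * rho <= 16^-1.
  have : nG * (nG * (e3 + mu)) <= nG * (nG * (iq + iq)).
    by rewrite !ler_pM2l // lerD.
  rewrite /rho; keep tau1 iqE; lra.
have hfe : nG * eta <= 16^-1.
  apply: (@le_trans _ _ (nG * (16 * nG)^-1)); first by rewrite ler_pM2l.
  by have -> : nG * (16 * nG)^-1 = 16^-1 by keep n0; field; lra.
have [v hv] := @remainder_compare _ _ S _ _ act (f n) h d w0 k x W (v1 * y1 * st v1) (v0 * y0 * st v0)
   (1 - \sum_g E g) rho eta dl (projC psE) px (pf _) (fN _) pd pw0 dl0 ph h1 hE erefl hrho rho1 fa1 hfe
   (ltW hv0) (ltW hv1) hW.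
apply: cuntz_leP => s s0; exists v.
by rewrite -[X in X - _]/(1 - \sum_g E g) {1}hv subrr nm0.
Qed.

Lemma weak_to_tracial : tracial_rokhlin S alpha.
Proof.
apply/towerP => F e e0 x px x1.
have [Fx [ex [ex0 hx]]] := nm_compression simp px x1 e0.
pose e' := Num.min e ex; have e'0 : 0 < e' by rewrite lt_min e0.
have [E [[pE oE E1] [cE aE zE]]] := @projection_towers (F ++ Fx) e' x e'0 px x1.
have e'e : e' <= e by rewrite ge_min lexx.
have [psE EE] := sum_proj pE oE.
exists E; split => //; split; split.
- by move=> g; exact: proj_Pos.
- by move=> g; exact: proj_nm.
- exact: oE.
- by move=> g a aF; apply: lt_le_trans e'e; apply: cE; rewrite mem_cat aF.
- by move=> g h; apply: lt_le_trans e'e.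
- exact: zE.
(* The norm condition is tested on [E 1], a nonzero projection below the sum that almost commutes
   with [Fx]. *)
rewrite mulrA; apply: (hx (E 1%g)) => //.
- by move=> a aF; apply: lt_le_trans (cE _ _ _) _; [rewrite mem_cat aF orbT | rewrite ge_min lexx orbT].
rewrite -[LHS]stK stM (proj1 (pE _)) (proj1 psE) EE.
by case: (pE 1%g).
Qed.
End Core.

Unset Implicit Arguments.

Theorem theorem1p2 (R : realType) (A : completeNormedModType R[i])
  (S : ucstar A) (G : finGroupType) (alpha : G -> A -> A)
  (w : set_system nat) :
  infinite_dimensional A -> simple_cstar S -> cstar_action S alpha ->
  free_ultrafilter w ->
  (forall (F : seq A) (e : R[i]), 0 < e -> forall x : A,
     positive S x -> x != 0 ->
     exists (B : set A) (c : A),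
       [/\ cstar_subalgebra S B, separable B,
           positive S c /\ `|c| = 1 & commutes_with S B c]
       /\ [/\ forall a, a \in F -> `|cmul S c a - cmul S a c| < e,
           forall a, a \in F -> exists b, B b /\ `|cmul S c a - b| < e,
           cuntz_le S (cone S - c) x
         & relcomm_real_rank_zero S w B]) ->
  (tracial_rokhlin S alpha <-> weak_tracial_rokhlin S alpha).
Proof.
move=> inf simp act free approx; split; last first.
  by move=> weak; exact: (weak_to_tracial inf simp act free weak approx).
move=> /towerP h; apply/towerP => F e e0 x px x1.
by have [f [tf _]] := h F e e0 x px x1; exists f.
Qed.
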